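(* Let $n\ge3$, $\emptyset\ne S\subseteq\{1,\dots,n-1\}$, $\mathfrak p:=\sum_{i\in S}\mathfrak p_i'$. Then, as sets of products, $$\mathrm{GL}_\infty(\mathbb S_{n-1},\mathfrak p)=(1+\mathfrak p\mathfrak p_n)^*=\widetilde\Theta_{n,2}(\mathfrak p)\widetilde{\mathcal E}_{n,2}(\mathfrak p)\cdots\widetilde\Theta_{n,n-1}(\mathfrak p)\widetilde{\mathcal E}_{n,n-1}(\mathfrak p),$$ and for $2\le s\le n-1$, $(1+\mathfrak p\mathfrak p_n)^*_s=\widetilde\Theta_{n,s}(\mathfrak p)\widetilde{\mathcal E}_{n,s}(\mathfrak p)\cdots\widetilde\Theta_{n,n-1}(\mathfrak p)\widetilde{\mathcal E}_{n,n-1}(\mathfrak p)$, while $(1+\mathfrak p\mathfrak p_n)^*_n=(1+F_n)^*$.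
   Context: $K$ is a field, $\mathbb N=\{0,1,\dots\}$. $\mathbb S_n$: $K$-algebra generated by $x_1,\dots,x_n,y_1,\dots,y_n$ with relations $y_ix_i=1$, $[x_i,y_j]=[x_i,x_j]=[y_i,y_j]=0$ ($i\ne j$). $E_{st}(i):=x_i^sy_i^t-x_i^{s+1}y_i^{t+1}$, $e_i:=E_{00}(i)$, $e_I:=\prod_{i\in I}e_i$, $E_{\alpha\beta}(I):=\prod_{i\in I}E_{\alpha_i\beta_i}(i)$ for $\alpha,\beta\in\mathbb N^I$. $\theta_{ij}(J):=(1+(y_i-1)e_{J\setminus\{i\}})(1+(x_j-1)e_{J\setminus\{j\}})$. $\mathfrak p_i$ = ideal of $\mathbb S_n$ generated by $e_i$; $\mathfrak p_I:=\prod_{i\in I}\mathfrak p_i$; $\mathfrak a_{n,s}:=\sum_{|I|=s}\mathfrak p_I$; $F_n:=\mathfrak p_{\{1,\dots,n\}}$; $(1+\mathfrak b)^*$ = units of $\mathbb S_n$ in $1+\mathfrak b$. $\mathbb S_{n-1}$ = subalgebra generated by $x_k,y_k$ ($k<n$); $\mathfrak p_i'$ = ideal of $\mathbb S_{n-1}$ generated by $e_i$; $\mathfrak p\mathfrak p_n:=\sum_{i\in S}\mathfrak p_i\mathfrak p_n$; $(1+\mathfrak p\mathfrak p_n)^*_s:=(1+\mathfrak p\mathfrak p_n)^*\cap(1+\mathfrak a_{n,s})^*$. $\mathrm{GL}_\infty(\mathbb S_{n-1})$ is identified with $(1+\mathfrak p_n)^*$ via $(a_{kl})\mapsto1+\sum(a_{kl}-\delta_{kl})E_{kl}(n)$,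 under which the congruence subgroup $\mathrm{GL}_\infty(\mathbb S_{n-1},\mathfrak p):=\ker(\mathrm{GL}_\infty(\mathbb S_{n-1})\to\mathrm{GL}_\infty(\mathbb S_{n-1}/\mathfrak p))$ corresponds to $(1+\mathfrak p\mathfrak p_n)^*$. $\mathcal J(\mathfrak p):=\{J\subseteq\{1,\dots,n\}:n\in J,\ J\cap S\ne\emptyset\}$. $\mu_I(\lambda):=\lambda e_I+1-e_I$, $U_I(K):=\{\mu_I(\lambda):\lambda\in K^*\}$; $\mathbb S_{CI}$ = subalgebra generated by $x_k,y_k$, $k\notin I$; $E_\infty(\mathbb S_{CI})$ = subgroup of $\mathbb S_n^*$ generated by $1+aE_{\alpha\beta}(I)$, $a\in\mathbb S_{CI}$, $\alpha\ne\beta\in\mathbb N^I$. $\widetilde{\mathcal E}_{n,s}(\mathfrak p)$: set of products, in a fixed order over all $I\in\mathcal J(\mathfrak p)$ with $|I|=s$, of elements of $U_I(K)E_\infty(\mathbb S_{CI})$. $\widetilde\Theta_{n,s}(\mathfrak p)$ ($2\le s\le n-1$): set of products, in a fixed order, of integer powers of the following elements: (i) $\theta_{m'(J'),j'}(J')$ where $i\in S$, $|J'|=s+1$, $n\in J'$, $J'\cap S=\{i\}$, $m'(J'):=\max(J'\setminus\{n,i\})$, $j'\in J'\setminus\{n,i,m'(J')\}$; (ii) $\theta_{m(J),j}(J)$ where $|J|=s+1$, $n\in J$, $|J\cap S|\ge2$, $m(J):=\max(J\setminus\{n\})$, $j\in J\setminus\{n,m(J)\}$. Products of sets mean sets of products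 of elements. *)

(* Defs.v *)
(* Model of the Jacobson algebra S_n by its faithful
   representation on K-valued functions on N^n. *)
From HB Require Import structures.
From mathcomp Require Import all_boot all_order all_algebra.
Unset Printing Implicit Defensive.
Import GRing.Theory.
Local Open Scope ring_scope.

Section Jacobson.
Variable K : fieldType.
Variable n : nat.

(* Variable number i (paper) is the ordinal / nat index i-1; the variable
   "n" of the paper is index n.-1. *)
Definition mon := 'I_n -> nat.
Definition vec := mon -> K.
Definition op := vec -> vec.

Definition upm (i : nat) (a : mon) : mon :=
  fun k => if nat_of_ord k == i then (a k).+1 else a k.
Definition downm (i : nat) (a : mon) : mon :=
  fun k => if nat_of_ord k == i then (a k).-1 else a k.
Definition posc (i : nat) (a : mon) : bool :=
  [exists k : 'I_n, (nat_of_ord k == i) && (0 < a k)%N].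

(* x_i : multiplication by t_i ; y_i : "division" by t_i *)
Definition Xo (i : nat) : op := fun f a => if posc i a then f (downm i a) else 0.
Definition Yo (i : nat) : op := fun f a => f (upm i a).

Definition o1 : op := fun f => f.
Definition o0 : op := fun f a => 0.
Definition oadd (u v : op) : op := fun f a => u f a + v f a.
Definition oopp (u : op) : op := fun f a => - u f a.
Definition osub (u v : op) : op := oadd u (oopp v).
Definition oscal (c : K) (u : op) : op := fun f a => c * u f a.
Definition omul (u v : op) : op := fun f => u (v f).
Definition oexp (u : op) (k : nat) : op := iter k (omul u) o1.
Definition oprod (s : seq op) : op := foldr omul o1 s.
Definition osum (s : seq op) : op := foldr oadd o0 s.

Inductive subalg (I : pred 'I_n) : op -> Prop :=
 | sa_scal c : subalg I (oscal c o1)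
 | sa_X k : I k -> subalg I (Xo k)
 | sa_Y k : I k -> subalg I (Yo k)
 | sa_add u v : subalg I u -> subalg I v -> subalg I (oadd u v)
 | sa_mul u v : subalg I u -> subalg I v -> subalg I (omul u v).

Definition lastb (k : 'I_n) : bool := nat_of_ord k == n.-1.

Definition Sn : op -> Prop := subalg predT.
Definition Sn1 : op -> Prop := subalg (fun k => ~~ lastb k).
Definition SCI (I : {set 'I_n}) : op -> Prop := subalg (fun k => k \notin I).

Inductive idealgen (A G : op -> Prop) : op -> Prop :=
 | ig0 : idealgen A G o0
 | igg a g b : A a -> G g -> A b -> idealgen A G (omul a (omul g b))
 | igadd u v : idealgen A G u -> idealgen A G v -> idealgen A G (oadd u v).

Definition Est (s t i : nat) : op :=
  osub (omul (oexp (Xo i) s) (oexp (Yo i) t))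
       (omul (oexp (Xo i) s.+1) (oexp (Yo i) t.+1)).
Definition eo (i : nat) : op := Est 0 0 i.
Definition eI (I : {set 'I_n}) : op := oprod [seq eo (nat_of_ord k) | k <- enum I].
Definition EI (al be : 'I_n -> nat) (I : {set 'I_n}) : op :=
  oprod [seq Est (al k) (be k) (nat_of_ord k) | k <- enum I].

Definition theta (i j : nat) (J : {set 'I_n}) : op :=
  omul (oadd o1 (omul (osub (Yo i) o1) (eI [set k in J | nat_of_ord k != i])))
       (oadd o1 (omul (osub (Xo j) o1) (eI [set k in J | nat_of_ord k != j]))).

Definition pid (i : nat) : op -> Prop := idealgen Sn (fun g => g = eo i).
Definition idealmul (A B : op -> Prop) : op -> Prop :=
  idealgen Sn (fun g => exists a b, A a /\ B b /\ g = omul a b).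
Definition pI (I : {set 'I_n}) : op -> Prop :=
  foldr idealmul Sn [seq pid (nat_of_ord k) | k <- enum I].
Definition ans (s : nat) : op -> Prop :=
  idealgen Sn (fun g => exists I : {set 'I_n}, #|I| = s /\ pI I g).
Definition Fn : op -> Prop := pI setT.

Definition pid' (i : nat) : op -> Prop := idealgen Sn1 (fun g => g = eo i).
Definition pfrak (S : {set 'I_n}) : op -> Prop :=
  idealgen Sn1 (fun g => exists i : 'I_n, i \in S /\ pid' (nat_of_ord i) g).
Definition ppn (S : {set 'I_n}) : op -> Prop :=
  idealgen Sn (fun g => exists i, i \in S /\ idealmul (pid (nat_of_ord i)) (pid n.-1) g).

Definition unitS (u : op) : Prop :=
  Sn u /\ exists v, Sn v /\ omul u v = o1 /\ omul v u = o1.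
Definition onePlus (B : op -> Prop) (u : op) : Prop := unitS u /\ B (osub u o1).
Definition onePlus_s (S : {set 'I_n}) (s : nat) (u : op) : Prop :=
  onePlus (ppn S) u /\ onePlus (ans s) u.

(* image of GL_oo(S_{n-1}, p) in S_n *)
Definition delta {m : nat} (k l : 'I_m) : op := if k == l then o1 else o0.
Definition GLcong (P : op -> Prop) (u : op) : Prop :=
  exists (m : nat) (A B : 'I_m -> 'I_m -> op),
    (forall k l, Sn1 (A k l) /\ Sn1 (B k l)) /\
    (forall k l, osum [seq omul (A k j) (B j l) | j <- enum 'I_m] = delta k l) /\
    (forall k l, osum [seq omul (B k j) (A j l) | j <- enum 'I_m] = delta k l) /\
    (forall k l, P (osub (A k l) (delta (m:=m) k l))) /\
    u = oadd o1 (osum [seq omul (osub (A k l) (delta (m:=m) k l)) (Est (nat_of_ord k) (nat_of_ord l) n.-1)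
                       | k <- enum 'I_m, l <- enum 'I_m]).

Inductive grpgen (G : op -> Prop) : op -> Prop :=
 | gg1 : grpgen G o1
 | ggl g h : G g -> grpgen G h -> grpgen G (omul g h)
 | ggi g v h : G g -> omul g v = o1 -> omul v g = o1 -> grpgen G h ->
               grpgen G (omul v h).

Definition Egen (I : {set 'I_n}) (g : op) : Prop :=
  exists (a : op) (al be : 'I_n -> nat),
    SCI I a /\ (exists k, k \in I /\ al k <> be k) /\ g = oadd o1 (omul a (EI al be I)).
Definition Einf (I : {set 'I_n}) : op -> Prop := grpgen (Egen I).
Definition mu (I : {set 'I_n}) (lam : K) : op :=
  oadd (oscal lam (eI I)) (osub o1 (eI I)).
Definition UE (I : {set 'I_n}) (u : op) : Prop :=
  exists (lam : K) g, lam != 0 /\ Einf I g /\ u = omul (mu I lam) g.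

Definition setprod (s : seq (op -> Prop)) : op -> Prop :=
  foldr (fun A P u => exists a b, A a /\ P b /\ u = omul a b) (fun u => u = o1) s.

Definition Jp (S I : {set 'I_n}) : bool :=
  [exists k in I, lastb k] && (I :&: S != set0).

Definition validE (S : {set 'I_n}) (s : nat) (ord : seq {set 'I_n}) : Prop :=
  uniq ord /\ forall J0 : {set 'I_n}, (J0 \in ord) = Jp S J0 && (#|J0| == s).
Definition Etil (S : {set 'I_n}) (ord : seq {set 'I_n}) : op -> Prop :=
  setprod [seq UE J0 | J0 <- ord].

Definition mx (A : {set 'I_n}) : nat := (\max_(k in A) nat_of_ord k)%N.
Definition mJ (J : {set 'I_n}) : nat := mx [set k in J | ~~ lastb k].
Definition mJ' (S J : {set 'I_n}) : nat := mx [set k in J | ~~ lastb k & k \notin S].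

Definition thidx (S : {set 'I_n}) (s : nat) (J : {set 'I_n}) (j : 'I_n) : bool :=
  [&& #|J| == s.+1, [exists k in J, lastb k], J :&: S != set0 &
    if #|J :&: S| == 1 then
      [&& j \in J, ~~ lastb j, j \notin S & nat_of_ord j != mJ' S J]
    else [&& j \in J, ~~ lastb j & nat_of_ord j != mJ J]].
Definition thgen (S J : {set 'I_n}) (j : 'I_n) : op :=
  if #|J :&: S| == 1 then theta (mJ' S J) (nat_of_ord j) J else theta (mJ J) (nat_of_ord j) J.

Definition powers (u v : op) : Prop :=
  exists k : nat, v = oexp u k \/
    exists w, omul u w = o1 /\ omul w u = o1 /\ v = oexp w k.

Definition validT (S : {set 'I_n}) (s : nat) (ord : seq ({set 'I_n} * 'I_n)) : Prop :=
  uniq ord /\ forall p, (p \in ord) = thidx S s p.1 p.2.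
Definition Thtil (S : {set 'I_n}) (ord : seq ({set 'I_n} * 'I_n)) : op -> Prop :=
  setprod [seq powers (thgen S p.1 p.2) | p <- ord].

Definition chain (S : {set 'I_n}) (ordT : nat -> seq ({set 'I_n} * 'I_n))
  (ordE : nat -> seq {set 'I_n}) (s0 : nat) : op -> Prop :=
  setprod (flatten [seq [:: Thtil S (ordT s); Etil S (ordE s)]
                   | s <- iota s0 (n - s0)]).

End Jacobson.

(* Main.v *)
(** For a set [A] of indices let [Z A] be the ideal of operators killed by a high power of
    all [x_k], [k] not in [A].  Every ideal in the theorem is an intersection of such ideals,
    so a unit lies in [(1 + p p_n)^*_s] iff it is congruent to [1] modulo [Z A] for every
    [A] that is not in [J(p)] or has fewer than [s] elements.  Modulo [Z I], a unit that is
    congruent to [1] modulo every [Z (I \ k)] is an invertible finitary matrix, indexed by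
    [N^I], over the Laurent polynomial ring in the variables outside [I].  Over that ring an
    invertible matrix is, stably, a unit times a product of elementary matrices: this is
    the Bass-Heller-Swan computation of [K_1], carried out by finite free resolutions over
    polynomial rings, which gives the factors [mu_I] and [E_oo(S_CI)] up to a Laurent monomial.
    The monomials are adjusted by powers of the [theta]; what the prescribed [theta] do
    not reach is trivial, because by a Fredholm index argument the exponents attached to the
    faces of a set [J] sum to zero.  Induction on [s] finishes the proof; at the top, the
    factor in [(1 + F_n)^*] is absorbed in the last [E_oo(S_CI)], where [mu] of the full
    index set is a product of elementary matrices since [y x = 1] while [x y <> 1]. *)
From HB Require Import structures.
Require Import Defs.
From mathcomp Require Import all_boot all_order all_algebra.
From mathcomp Require Import boolp zify ring.
Set Implicit Arguments. Unset Strict Implicit. Unset Printing Implicit Defensive.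
Import GRing.Theory.
Local Open Scope ring_scope.

(** No group K_1 is formed: stable triviality is the closure property [KG], whose only relation that
    changes sizes passes from [1 + YX] to [1 + XY]. The nilpotent part of the Laurent computation is
    removed by devissage: if [E] acts on the quotients of a filtration by 0 or 1, then
    [1 + (t - 1) E] acts on them by 1 or [t], and a resolution lifts it to triangular matrices with
    these diagonal entries. Symbols of operators are relations, not maps; one equivalence, symbol
    zero iff operator in [Z I], yields both single-valuedness and injectivity. The shape of the last
    part comes from the scarcity of the [theta]. Each one raises the exponent of [x_j] on a face
    [J \ j] and lowers that of [x_m] on [J \ m], with one [m] for all [j] of the same [J]. So all
    exponents away from [m] are corrected independently, and a single one per [J] is out of reach.
    No index is defined to show that it vanishes: a finitary perturbation of 1 with a right inverse
    also has a left inverse, because matrices over a commutative ring do, and a nonzero exponent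
    would contradict this through [y_m e_J = 0]. *)

(** * Matrices that are stably trivial up to prescribed units *)

(** [KG_swap] makes the class stable: it relates the sizes [q] and [r], so that stabilising,
    destabilising and block unipotent matrices are all instances of it. [KG_cancel] stands in for
    closure under inverses. *)
Inductive KG (R : comNzRingType) (U : R -> Prop) : forall n, 'M[R]_n -> Prop :=
| KG_unit c : U c -> KG U (c%:M : 'M_1)
| KG_mul n (M N : 'M_n) : KG U M -> KG U N -> KG U (M *m N)
| KG_cancel n (M N : 'M_n) : KG U M -> KG U (M *m N) -> KG U N
| KG_swap q r (X : 'M_(q, r)) (Y : 'M_(r, q)) :
    KG U (1%:M + Y *m X) -> KG U (1%:M + X *m Y).

Section KGTheory.
Variables (R : comNzRingType) (U : R -> Prop).
Hypothesis U1 : U 1.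

Lemma KG1 n : KG U (1%:M : 'M[R]_n).
Proof.
have -> : (1%:M : 'M[R]_n) = 1%:M + (0 : 'M_(n, 1)) *m (0 : 'M_(1, n)).
  by rewrite mulmx0 addr0.
by apply: KG_swap; rewrite mulmx0 addr0; apply: KG_unit.
Qed.

Lemma KG_square0 q r (X : 'M[R]_(q, r)) (Y : 'M_(r, q)) :
  Y *m X = 0 -> KG U (1%:M + X *m Y).
Proof. by move=> YX; apply: KG_swap; rewrite YX addr0; apply: KG1. Qed.

(** The swap turns a rank-one update of a row into a 1 x 1 matrix. *)
Lemma KG_rowupdate n (i : 'I_n) (r : 'rV[R]_n) :
  U (1 + r 0 i) -> KG U (1%:M + delta_mx i (0 : 'I_1) *m r).
Proof.
move=> Ur; apply: KG_swap.
have -> : 1%:M + r *m delta_mx i 0 = (1 + r 0 i)%:M :> 'M_1.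
  apply/matrixP => a b; rewrite !ord1 !mxE eqxx /= mulr1n (bigD1 i) //=.
  rewrite !mxE !eqxx mulr1 big1 ?addr0 // => j ji.
  by rewrite mxE (negPf ji) mulr0.
exact: KG_unit.
Qed.

Lemma mul_delta_col n p (i k : 'I_n) (r : 'M[R]_(1, p)) j :
  (delta_mx i (0 : 'I_1) *m r) k j = (k == i)%:R * r 0 j.
Proof. by rewrite mxE big_ord1 mxE eqxx andbT. Qed.

(** Weights replace an ordering of the indices. The rows of [M] are put into the identity matrix one
    at a time, each by a row update. *)
Lemma KG_triangular n (w : 'I_n -> nat) (M : 'M[R]_n) :
  (forall i j, i != j -> (w i <= w j)%N -> M i j = 0) ->
  (forall i, U (M i i)) -> KG U M.
Proof.
move=> Mtri Mdiag.
pose MA (A : {set 'I_n}) := \matrix_(i, j) if i \in A then M i j else (i == j)%:R.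
have -> : M = MA setT by apply/matrixP => i j; rewrite mxE inE.
move: {-1}#|[set: 'I_n]| (leqnn #|[set: 'I_n]|) => m.
elim: m [set: 'I_n] => [|m IH] A.
  rewrite leqn0 cards_eq0 => /eqP ->.
  suff -> : MA set0 = 1%:M by apply: KG1.
  by apply/matrixP => i j; rewrite !mxE inE.
move=> leA; have [->|[i1 i1A]] := set_0Vmem A.
  by apply: IH; rewrite cards0.
(* Minimality of the weight makes row [i0] of [M] vanish at the other indices of [A], so it meets
   only identity rows of the right factor. *)
pose i0 := [arg min_(i < i1 in A) w i].
have [i0A i0min] : i0 \in A /\ forall j, j \in A -> (w i0 <= w j)%N.
  by rewrite /i0; case: arg_minnP => // i iA imin; split.
have -> : MA A = (1%:M + delta_mx i0 (0 : 'I_1) *m (row i0 M - delta_mx 0 i0))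
                  *m MA (A :\ i0).
  rewrite mulmxDl mul1mx -mulmxA; apply/matrixP => i j.
  rewrite [RHS]mxE mul_delta_col [MA _ i j]mxE [MA _ i j]mxE !inE.
  case: (eqVneq i i0) => [->|nii0] /=; last by rewrite mul0r addr0.
  rewrite i0A mul1r mulmxBl -rowE [X in _ + X]mxE [X in _ + (_ + X)]mxE.
  rewrite [X in _ - X]mxE [MA _ i0 j]mxE !inE eqxx /= addrCA subrr addr0 mxE.
  rewrite (bigD1 j) //= !mxE !inE eqxx big1 ?addr0.
    case: (eqVneq j i0) => [->|nji0]; first by rewrite mulr1.
    case: (boolP (j \in A)) => jA /=; last by rewrite mulr1.
    by rewrite Mtri ?mul0r // ?i0min // eq_sym.
  move=> k nkj; rewrite !mxE !inE (negPf nkj).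
  case: (eqVneq k i0) => [->|nki0]; first by rewrite mulr0.
  case: (boolP (k \in A)) => kA /=; last by rewrite mulr0.
  by rewrite Mtri ?mul0r // ?i0min // eq_sym.
apply: KG_mul; last by apply: IH; rewrite (cardsD1 i0) i0A in leA.
by apply: KG_rowupdate; rewrite !mxE !eqxx addrCA subrr addr0.
Qed.

Lemma KG_upper q r (X : 'M[R]_(q, r)) : KG U (block_mx 1%:M X 0 1%:M).
Proof.
have -> : block_mx 1%:M X 0 1%:M = 1%:M + col_mx 1%:M 0 *m row_mx 0 X :> 'M_(q+r).
  rewrite mul_col_row !mulmx0 mul1mx mul0mx (scalar_mx_block _ _ (1:R)).
  by rewrite add_block_mx !add0r !addr0.
by apply: KG_square0; rewrite mul_row_col mulmx0 mul0mx addr0.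
Qed.

Lemma KG_lower q r (X : 'M[R]_(r, q)) : KG U (block_mx 1%:M 0 X 1%:M).
Proof.
have -> : block_mx 1%:M 0 X 1%:M = 1%:M + col_mx 0 1%:M *m row_mx X 0 :> 'M_(q+r).
  rewrite mul_col_row !mul0mx mulmx0 mul1mx (scalar_mx_block _ _ (1:R)).
  by rewrite add_block_mx !add0r !addr0.
by apply: KG_square0; rewrite mul_row_col mulmx0 mul0mx addr0.
Qed.

Lemma KG_unstab q r (P : 'M[R]_q) : KG U (block_mx P 0 0 (1%:M : 'M_r)) -> KG U P.
Proof.
have -> : block_mx P 0 0 1%:M = 1%:M + col_mx 1%:M 0 *m row_mx (P - 1%:M) 0 :> 'M_(q+r).
  rewrite mul_col_row !mulmx0 mul1mx !mul0mx (scalar_mx_block _ _ (1:R)).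
  by rewrite add_block_mx !addr0 addrC subrK.
move=> H; have -> : P = 1%:M + row_mx (P - 1%:M) 0 *m col_mx 1%:M (0 : 'M_(r, q)).
  by rewrite mul_row_col mulmx1 mulmx0 addr0 addrC subrK.
exact: KG_swap.
Qed.

Lemma KG_stab q r (P : 'M[R]_q) : KG U P -> KG U (block_mx P 0 0 (1%:M : 'M_r)).
Proof.
have -> : block_mx P 0 0 1%:M = 1%:M + col_mx 1%:M 0 *m row_mx (P - 1%:M) 0 :> 'M_(q+r).
  rewrite mul_col_row !mulmx0 mul1mx !mul0mx (scalar_mx_block _ _ (1:R)).
  by rewrite add_block_mx !addr0 addrC subrK.
move=> H; apply: KG_swap.
by rewrite mul_row_col mulmx1 mulmx0 addr0 addrC subrK.
Qed.

End KGTheory.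

Lemma KG_map (R B : comNzRingType) (i : {rmorphism R -> B}) (U : R -> Prop) (V : B -> Prop) :
  (forall c, U c -> V (i c)) -> forall n (M : 'M_n), KG U M -> KG V (map_mx i M).
Proof.
move=> UV n M; elim=> {n M} [c Uc|n M N _ IM _ IN|n M N _ IM _ IN|q r X Y _ IH].
- by rewrite map_scalar_mx; apply/KG_unit/UV.
- by rewrite map_mxM; apply: KG_mul.
- by rewrite map_mxM in IN; apply: KG_cancel IN.
- by move: IH; rewrite !map_mxD !map_mxM !map_mx1 => ?; apply: KG_swap.
Qed.

Definition KGall (R : comNzRingType) (U : R -> Prop) :=
  forall n (M N : 'M[R]_n), M *m N = 1%:M -> KG U M.

(** Base case of the Laurent tower, by Gaussian elimination: a nonzero corner gives a block LDU
    decomposition with the Schur complement [D']; a zero corner is first made nonzero by adding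
    another row. *)
Lemma KGall_field (F : fieldType) : KGall (fun c : F => c != 0).
Proof.
have H1 : (1 : F) != 0 by rewrite oner_eq0.
have key n (a : F) (b : 'rV_n) (c : 'cV_n) (D : 'M_n) N :
    (forall (M M' : 'M[F]_n), M *m M' = 1%:M -> KG (fun c => c != 0) M) -> a != 0 ->
    block_mx a%:M b c D *m N = 1%:M ->
    KG (fun c => c != 0) (block_mx (a%:M : 'M_1) b c D).
  move=> IH a0 HN.
  pose D' := D - a^-1 *: (c *m b).
  have eqM : block_mx (a%:M : 'M_1) b c D =
     block_mx 1%:M 0 (a^-1 *: c) 1%:M *m
       (block_mx (a%:M : 'M_1) 0 0 1%:M *m (block_mx 1%:M 0 0 D' *m
         block_mx 1%:M (a^-1 *: b) 0 1%:M)).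
    rewrite !mulmx_block !mulmx1 !mul1mx !mul0mx !mulmx0 !addr0 ?add0r mulmx1.
    rewrite -!scalemxAl -!scalemxAr !mul_scalar_mx !mul_mx_scalar !scalerA.
    rewrite ?mulVf // ?mulfV // ?scale1r ?mulr1 ?mul1mx ?scaleN1r /D'.
    by rewrite -scalemxAr scalerA divfK // addrC subrK.
  rewrite eqM; apply: KG_mul; first exact: KG_lower.
  apply: KG_mul; first by apply: KG_stab; apply: KG_unit.
  apply: KG_mul; last exact: KG_upper.
  have swapD (Z : 'M_n) : KG (fun c : F => c != 0) Z ->
      KG (fun c : F => c != 0) (block_mx (1%:M : 'M_1) 0 0 Z).
    have -> : block_mx 1%:M 0 0 Z = 1%:M + col_mx 0 1%:M *m row_mx 0 (Z - 1%:M) :> 'M_(1+n).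
      rewrite mul_col_row !mulmx0 mul1mx !mul0mx (scalar_mx_block _ _ (1:F)).
      by rewrite add_block_mx !addr0 addrC subrK.
    move=> H; apply: KG_swap.
    by rewrite mul_row_col mulmx1 mulmx0 add0r addrC subrK.
  apply: swapD.
  have : block_mx (a%:M : 'M_1) b c D \in unitmx by case: (mulmx1_unit HN).
  rewrite eqM unitmxE !det_mulmx !det_lblock !det_ublock !det1 !mul1r !mulr1 unitrM.
  by case/andP=> _ uD; apply: (IH _ (invmx D')); rewrite mulmxV // unitmxE.
elim=> [|n IH] M N MN.
  rewrite (_ : M = 1%:M); first exact: (@KG1 F _ H1).
  by apply/matrixP => -[].
have key' (M' N' : 'M[F]_(1 + n)) : M' *m N' = 1%:M -> M' 0 0 != 0 ->
    KG (fun c => c != 0) M'.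
  move=> MN' M0.
  have eM : M' = block_mx ((ulsubmx M' 0 0)%:M : 'M_1) (ursubmx M') (dlsubmx M') (drsubmx M').
    by rewrite -mx11_scalar submxK.
  rewrite eM in MN' *; have := key _ _ _ _ _ _ IH _ MN'. apply.
  by rewrite !mxE (_ : lshift n 0 = 0) //; apply: val_inj.
have [M00|] := eqVneq (M 0 0) 0; last exact: (key' M N MN).
have [i Mi0] : exists i, M i 0 != 0.
  apply/existsP; apply: contraT; rewrite negb_exists => /forallP M0.
  have /matrixP/(_ 0 0) : N *m M = 1%:M by apply: mulmx1C.
  rewrite !mxE big1 ?eqxx; first by move/eqP; rewrite eq_sym oner_eq0.
  by move=> j _; rewrite (eqP (negbNE (M0 j))) mulr0.
have i0 : i != 0 by apply: contraNneq Mi0 => ->; rewrite M00.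
pose T : 'M[F]_n.+1 := 1%:M + delta_mx 0 (0 : 'I_1) *m delta_mx 0 i.
have KT : KG (fun c : F => c != 0) T.
  by apply: KG_rowupdate; rewrite mxE (_ : 0 == i = false) ?andbF ?addr0 // eq_sym (negPf i0).
have TT : (1%:M - delta_mx 0 (0 : 'I_1) *m delta_mx 0 i) *m T = 1%:M.
  have ed : (delta_mx 0 i : 'rV[F]_n.+1) *m delta_mx 0 (0 : 'I_1) = 0.
    by rewrite mul_delta_mx_0.
  rewrite /T; move: (delta_mx 0 0) (delta_mx 0 i) ed => d e ed.
  rewrite mulmxBl mul1mx mulmxDr mulmx1 mulmxA -(mulmxA d e d) ed.
  by rewrite mulmx0 mul0mx addr0 addrK.
apply: KG_cancel KT _; apply: (key' _ (N *m (1%:M - delta_mx 0 (0 : 'I_1) *m delta_mx 0 i))).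
  rewrite -mulmxA (mulmxA M) MN mul1mx; exact: mulmx1C.
rewrite /T mulmxDl mul1mx -mulmxA -rowE mxE M00 add0r mxE big_ord1 !mxE !eqxx /= mul1r.
exact: Mi0.
Qed.

(** * Matrices as operators on functions over an infinite label set *)

Section Operators.
Variables (R : comNzRingType) (W : Type).

Definition wop := (W -> R) -> (W -> R).
Definition tv (i j : W) (a : R) : wop :=
  fun v k => v k + (if `[< k = i >] then a * v j else 0).
Definition dg (i : W) (c : R) : wop := fun v k => if `[< k = i >] then c * v k else v k.

Inductive ET : wop -> Prop :=
| ET1 : ET id
| ETt i j a t : i <> j -> ET t -> ET (tv i j a \o t).

Variable U : R -> Prop.
Inductive DE : wop -> Prop :=
| DE1 : DE id
| DEt i j a t : i <> j -> DE t -> DE (tv i j a \o t)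
| DEd i c t : U c -> DE t -> DE (dg i c \o t).

Lemma ET_comp s t : ET s -> ET t -> ET (s \o t).
Proof. by elim=> {s} [|i j a s ij _ IH] Et //; rewrite -compA; apply: ETt => //; apply: IH. Qed.

Lemma ET_tv i j a : i <> j -> ET (tv i j a).
Proof. by move=> ij; apply: (ETt _ ij ET1). Qed.

Lemma DE_comp s t : DE s -> DE t -> DE (s \o t).
Proof.
elim=> {s} [|i j a s ij _ IH|i c s Uc _ IH] Et //; rewrite -compA.
  by apply: DEt => //; apply: IH.
by apply: DEd => //; apply: IH.
Qed.

Lemma DE_tv i j a : i <> j -> DE (tv i j a).
Proof. by move=> ij; apply: (DEt _ ij DE1). Qed.

Lemma asT (P : Prop) : P -> `[< P >] = true. Proof. by move=> ?; apply/asboolP. Qed.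
Lemma asF (P : Prop) : ~ P -> `[< P >] = false. Proof. by move=> ?; apply/asboolPn. Qed.

Lemma tvN i j a : i <> j -> tv i j a \o tv i j (- a) = id.
Proof.
move=> ij; apply/funext => v; apply/funext => k; rewrite /= /tv.
case: (asboolP (k = i)) => [->|ki]; last by rewrite !addr0.
by rewrite (asF (not_eq_sym ij)) addr0 mulNr subrK.
Qed.

Hypotheses (U1 : U 1) (UM : forall a b, U a -> U b -> U (a * b))
           (UV : forall a, U a -> exists2 b, U b & a * b = 1).

Lemma dgM i a b : dg i a \o dg i b = dg i (a * b).
Proof.
apply/funext => v; apply/funext => k; rewrite /= /dg.
by case: asboolP => // _; rewrite mulrA.
Qed.

Lemma dg1 i : dg i 1 = id.
Proof.
apply/funext => v; apply/funext => k; rewrite /= /dg.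
by case: asboolP => // _; rewrite mul1r.
Qed.

Lemma DE_inv t : DE t -> exists2 t', DE t' & t \o t' = id /\ t' \o t = id.
Proof.
elim=> {t} [|i j a t ij _ [t' Dt' [tt' t't]]|i c t Uc _ [t' Dt' [tt' t't]]].
- by exists id; [exact: DE1|].
- exists (t' \o tv i j (- a)); first by apply: DE_comp => //; apply: DE_tv.
  split; first by rewrite -compA (compA t) tt' /= tvN.
  rewrite -compA (compA _ _ t); have := tvN (- a) ij; rewrite opprK => -> /=.
  exact: t't.
- have [b Ub cb] := UV Uc; exists (t' \o dg i b).
    by apply: DE_comp => //; apply: (DEd _ Ub DE1).
  split; first by rewrite -compA (compA t) tt' /= dgM cb dg1.
  by rewrite -compA (compA _ _ t) dgM mulrC cb dg1.
Qed.

(** Diagonal operators normalise transvections; [a'] is the conjugated entry, which picks up [c]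
    when [w] is its column and [d = 1/c] when [w] is its row. *)
Lemma dg_tv w c d i j a : c * d = 1 -> i <> j ->
  exists2 t, ET t & tv i j a \o dg w c = dg w c \o t.
Proof.
move=> cd ij; pose a' := (if `[< j = w >] then c * a else a) * (if `[< i = w >] then d else 1).
exists (tv i j a'); first exact: ET_tv.
apply/funext => v; apply/funext => k; rewrite /= /dg /tv /a'.
case: (asboolP (k = w)) => [->|kw]; case: (asboolP (j = w)) => [jw|jw];
  case: (asboolP (i = w)) => [iw|iw]; try (by case: ij; rewrite iw jw).
- by rewrite (asF (not_eq_sym iw)) !addr0.
- rewrite iw (asT erefl).
  have -> : c * (v w + a * d * v j) = c * v w + c * d * (a * v j) by ring.
  by rewrite cd mul1r.
- by rewrite (asF (not_eq_sym iw)) !addr0.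
- by case: asboolP => // _; rewrite mulr1 [c * a]mulrC mulrA.
- by rewrite iw (asF kw) !addr0.
- by case: asboolP => // _; rewrite mulr1.
Qed.

(* Whitehead: [diag(c, 1/c)] is a product of six transvections. *)
Lemma ET_dg2 i j c d : c * d = 1 -> i <> j -> ET (dg i c \o dg j d).
Proof.
move=> cd ij; have ji := not_eq_sym ij.
pose w c d := tv i j c \o tv j i (- d) \o tv i j c.
have -> : dg i c \o dg j d = w c d \o w (- 1) (- 1).
  apply/funext => v; apply/funext => k; rewrite /w /= /dg /tv.
  rewrite ?(asT (erefl i)) ?(asT (erefl j)) ?(asF ij) ?(asF ji).
  case: (asboolP (k = i)) => [->|ki]; rewrite ?(asT (erefl i)) ?(asF ij).
    rewrite !addr0; move: (v i) (v j) => x y.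
    transitivity (c * x + (c * d - 1) * (y - c * x)); last by ring.
    by rewrite cd subrr mul0r addr0.
  case: (asboolP (k = j)) => [->|kj]; rewrite ?addr0 //.
  move: (v i) (v j) => x y.
  transitivity (d * y + (1 - c * d) * x); last by ring.
  by rewrite cd subrr mul0r addr0.
have Ew a b : ET (w a b).
  by apply: ET_comp; [apply: ET_comp|]; apply: ET_tv.
exact: ET_comp.
Qed.

(** By Whitehead's identity a unit at label [i] can be traded, at the cost of transvections, for the
    same unit at the fixed label [w]; all units thus collect in one place. *)
Lemma DE_normal w t : DE t -> exists c, exists2 e, U c /\ ET e & t = dg w c \o e.
Proof.
elim=> {t} [|i j a t ij _ [c [e [Uc Ee] ->]]|i b t Ub _ [c [e [Uc Ee] ->]]].
- by exists 1, id; [split=> //; exact: ET1|rewrite dg1].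
- have [d Ud cd] := UV Uc; have [e' Ee' eq] := dg_tv w a cd ij.
  exists c, (e' \o e); first by split=> //; apply: ET_comp.
  by rewrite compA eq compA.
- have [->|iw] := pselect (i = w).
    by exists (b * c), e; [split=> //; apply: UM|rewrite compA dgM].
  have [b' Ub' bb'] := UV Ub; have [c' Uc' cc'] := UV Uc.
  have bb2 : b' * b = 1 by rewrite mulrC.
  exists (b * c), (dg i b \o dg w b' \o e).
    by split; [apply: UM|apply: ET_comp => //; apply: ET_dg2].
  apply/funext => v; apply/funext => k; rewrite /= /dg; move: (e v k) => y.
  case: (asboolP (k = i)) => [->|ki]; first by rewrite (asF iw).
  by case: asboolP => // _; rewrite mulrACA bb' mul1r.
Qed.

Hypothesis Winf : forall n (f : 'I_n -> W), exists w, forall i, w <> f i.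

Definition ext n (f : 'I_n -> W) (M : 'M[R]_n) : wop := fun v k =>
  v k + \sum_i (if `[< k = f i >] then \sum_j (M - 1%:M) i j * v (f j) else 0).

Lemma extE n (f : 'I_n -> W) M v i : injective f ->
  ext f M v (f i) = \sum_j M i j * v (f j).
Proof.
move=> fi; rewrite /ext (bigD1 i) //= (asT erefl) [X in _ + (_ + X)]big1 ?addr0; last first.
  by move=> j /eqP ji; rewrite asF // => /fi /esym.
under eq_bigr do rewrite !mxE mulrBl.
rewrite sumrB addrCA [X in _ - X](bigD1 i) //= eqxx mul1r [X in _ - (_ + X)]big1 ?addr0.
  by rewrite subrr addr0.
by move=> j ji; rewrite eq_sym (negPf ji) mul0r.
Qed.

Lemma extN n (f : 'I_n -> W) M v k : (forall i, k <> f i) -> ext f M v k = v k.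
Proof. by move=> kf; rewrite /ext big1 ?addr0 // => i _; rewrite asF. Qed.

Lemma ext_ind n (f : 'I_n -> W) (P : W -> Prop) :
  (forall i, P (f i)) -> (forall k, (forall i, k <> f i) -> P k) -> forall k, P k.
Proof.
move=> Pf PN k; have [[i ->]|kf] := pselect (exists i, k = f i); first exact: Pf.
by apply: PN => i ki; apply: kf; exists i.
Qed.

Lemma ext_mul n (f : 'I_n -> W) M N : injective f -> ext f (M *m N) = ext f M \o ext f N.
Proof.
move=> fi; apply/funext => v; apply/funext; apply: (ext_ind (f := f)) => [i|k kf] /=.
  rewrite !extE //; under eq_bigr do rewrite mxE mulr_suml.
  rewrite exchange_big /=; apply: eq_bigr => j _; rewrite extE // mulr_sumr.
  by apply: eq_bigr => k _; rewrite mulrA.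
by rewrite !extN.
Qed.

Lemma ext1 n (f : 'I_n -> W) : ext f 1%:M = id.
Proof.
apply/funext => v; apply/funext => k; rewrite /ext subrr big1 ?addr0 // => i _.
by case: ifP => // _; rewrite big1 // => j _; rewrite mxE mul0r.
Qed.

(** Fresh labels exist because [W] is infinite. This room is what turns a stable statement about
    matrices into a statement about one operator. *)
Lemma inj_extend q r (f : 'I_q -> W) : injective f ->
  exists2 F : 'I_(q + r) -> W, injective F & forall i, F (lshift r i) = f i.
Proof.
move=> fi; suff [F' [iF' dF']] : exists F' : 'I_r -> W, injective F' /\ forall i j, F' i <> f j.
  exists (fun k => match split k with inl i => f i | inr j => F' j end).
    move=> a b; case: (splitP a) => i ai; case: (splitP b) => j bj.
    - by move/fi => ij; apply: val_inj; rewrite /= ai bj ij.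
    - by move/esym/dF'.
    - by move/dF'.
    - by move/iF' => ij; apply: val_inj; rewrite /= ai bj ij.
  by move=> i; rewrite (unsplitK (inl i)).
elim: r => [|r [F' [iF' dF']]]; first by exists (fun i : 'I_0 => match i with Ordinal _ h => False_rect _ (Bool.diff_false_true h) end); split=> -[].
have [w wF] := Winf (fun k : 'I_(r + q) => match split k with inl i => F' i | inr j => f j end).
have w1 i : w <> F' i by have := wF (lshift _ i); rewrite (unsplitK (inl i)).
have w2 i : w <> f i by have := wF (rshift _ i); rewrite (unsplitK (inr i)).
exists (fun i => if unlift ord0 i is Some j then F' j else w); split.
  move=> a b; case: unliftP => [a' ->|->]; case: unliftP => [b' ->|->] //.
  - by move/iF' => ->.
  - by move/esym/w1.
  - by move/w1.
by move=> i j; case: unliftP => [a' _|_]; [apply: dF'|apply: w2].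
Qed.

Lemma ext_lblock q r (F : 'I_(q + r) -> W) P : injective F ->
  ext F (block_mx P 0 0 1%:M) = ext (F \o lshift r) P.
Proof.
move=> Fi; have Fl : injective (F \o lshift r) by move=> a b /Fi /lshift_inj.
apply/funext => v; apply/funext; apply: (ext_ind (f := F)) => [i|k kf] /=; last first.
  by rewrite !extN // => i; apply: kf.
rewrite -(splitK i); case: (split i) => a /=.
  rewrite extE // (extE P v a Fl) big_split_ord /= [X in _ + X]big1 ?addr0.
    by apply: eq_bigr => j _; rewrite block_mxEul.
  by move=> j _; rewrite block_mxEur mxE mul0r.
rewrite extE // extN; last by move=> b /Fi /eqP; rewrite eq_sym eq_lrshift.
rewrite big_split_ord /= big1 ?add0r; last first.
  by move=> j _; rewrite block_mxEdl mxE mul0r.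
rewrite (bigD1 a) //= block_mxEdr mxE eqxx mul1r big1 ?addr0 // => j ja.
by rewrite block_mxEdr mxE eq_sym (negPf ja) mul0r.
Qed.

Lemma ext_rblock q r (F : 'I_(q + r) -> W) P : injective F ->
  ext F (block_mx 1%:M 0 0 P) = ext (F \o @rshift q r) P.
Proof.
move=> Fi; have Fl : injective (F \o @rshift q r) by move=> a b /Fi /rshift_inj.
apply/funext => v; apply/funext; apply: (ext_ind (f := F)) => [i|k kf] /=; last first.
  by rewrite !extN // => i; apply: kf.
rewrite -(splitK i); case: (split i) => a /=; last first.
  rewrite extE // (extE P v a Fl) big_split_ord /= big1 ?add0r.
    by apply: eq_bigr => j _; rewrite block_mxEdr.
  by move=> j _; rewrite block_mxEdl mxE mul0r.
rewrite extE // extN; last by move=> b /Fi /eqP; rewrite eq_lrshift.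
rewrite big_split_ord /= [X in _ + X]big1 ?addr0; last first.
  by move=> j _; rewrite block_mxEur mxE mul0r.
rewrite (bigD1 a) //= block_mxEul mxE eqxx mul1r big1 ?addr0 // => j ja.
by rewrite block_mxEul mxE eq_sym (negPf ja) mul0r.
Qed.

(** Rows and columns of the nonzero entries are disjoint sets of labels, so the corresponding
    transvections do not interact and their product just adds the entries. *)
Lemma DE_ext_sep n (f : 'I_n -> W) (P : pred 'I_n) (Z : 'M[R]_n) : injective f ->
  (forall i j, ~~ (P i && ~~ P j) -> Z i j = 0) -> DE (ext f (1%:M + Z)).
Proof.
move=> fi HZ.
pose op (s : seq ('I_n * 'I_n)) : wop := fun v k =>
  v k + \sum_(p <- s) (if `[< k = f p.1 >] then Z p.1 p.2 * v (f p.2) else 0).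
have DEop s : all (fun p => P p.1 && ~~ P p.2) s -> DE (op s).
  elim: s => [_|[i j] s IH /= /andP [/andP [Pi Pj] sP]].
    have -> : op [::] = id; last exact: DE1.
    by apply/funext => v; apply/funext => k; rewrite /op big_nil addr0.
  have -> : op ((i, j) :: s) = tv (f i) (f j) (Z i j) \o op s.
    apply/funext => v; apply/funext => k; rewrite /= /op /tv big_cons /= addrCA addrC.
    congr (_ + _); case: asboolP => // _.
    rewrite [X in _ + X]big_seq big1 ?addr0 // => -[i' j'] /(allP sP) /= /andP [Pi' _].
    by rewrite asF // => /fi ji'; rewrite ji' Pi' in Pj.
  apply: DEt; last exact: IH.
  by move/fi => ij; rewrite -ij Pi in Pj.
have -> : ext f (1%:M + Z) = op [seq p <- [seq (i, j) | i <- enum 'I_n, j <- enum 'I_n] | P p.1 && ~~ P p.2].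
  apply/funext => v; apply/funext => k; rewrite /ext /op; congr (_ + _).
  rewrite big_filter [RHS]big_mkcond big_allpairs /= big_enum /=; apply: eq_bigr => i _.
  rewrite big_enum /= addrC addrA addNr add0r; case: asboolP => ki; last first.
    by rewrite big1 // => j _; case: ifP.
  by apply: eq_bigr => j _; case: ifP => // /negbT /HZ ->; rewrite mul0r.
by apply: DEop; apply: filter_all.
Qed.

(** Both sides of a swap are compared on a common set of [q + r] labels. *)
Lemma KG_sound n (M : 'M[R]_n) : KG U M -> forall f : 'I_n -> W, injective f -> DE (ext f M).
Proof.
elim=> {n M} [c Uc|n M N _ IM _ IN|n M N _ IM _ IN|q r X Y _ IH] f fi.
- have -> : ext f c%:M = dg (f ord0) c \o id; last by apply: DEd => //; apply: DE1.
  apply/funext => v; apply/funext => k; rewrite /= /dg.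
  case: asboolP => [->|kf]; first by rewrite extE // big_ord1 mxE eqxx.
  by rewrite extN // => i; rewrite ord1.
- by rewrite ext_mul //; apply: DE_comp; [apply: IM|apply: IN].
- have [t' Dt' [_ t't]] := DE_inv (IM f fi).
  have -> : ext f N = t' \o ext f (M *m N) by rewrite ext_mul // compA t't.
  by apply: DE_comp => //; apply: IN.
- have [F Fi Ff] := inj_extend r fi.
  have -> : f = F \o lshift r by apply/funext => i; rewrite /= Ff.
  rewrite -ext_lblock //.
  (* Four block unipotent factors carry [1 + YX] in the lower corner to [1 + XY] in the upper one;
     no inverse of either enters. *)
  have -> : block_mx (1%:M + X *m Y) 0 0 1%:M =
     block_mx 1%:M X 0 1%:M *m (block_mx 1%:M 0 Y 1%:M *m (block_mx 1%:M 0 0 (1%:M + Y *m X)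
       *m (block_mx 1%:M (- X) 0 1%:M *m block_mx 1%:M 0 (- Y) 1%:M))) :> 'M_(q + r).
    rewrite !mulmx_block ?(mulmx1, mul1mx, mul0mx, mulmx0, addr0, add0r).
    rewrite !mulmxDl !mulmxDr ?mulmx1 ?mul1mx ?mulmxN ?mulNmx ?opprK ?mulmxA.
    congr block_mx; rewrite ?mulmxDr ?mulmxDl ?mulmxN ?mulNmx ?mulmx1 ?mul1mx ?mulmxA ?opprK ?opprD.
    - by rewrite -opprD subrr addr0.
    - by rewrite addrA -opprD addNr.
    - by rewrite -opprD subrr.
    - by rewrite addrCA addNr addr0.
  have KU (Z : 'M_(q, r)) : DE (ext F (block_mx 1%:M Z 0 1%:M)).
    have -> : block_mx 1%:M Z 0 1%:M = 1%:M + block_mx 0 Z 0 0 :> 'M_(q + r).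
      by rewrite (scalar_mx_block _ _ (1:R)) add_block_mx !addr0 add0r.
    apply: (@DE_ext_sep _ F (fun k => (k < q)%N)) => // i j.
    rewrite -(splitK i) -(splitK j); case: (split i) => a; case: (split j) => b /=.
    + by rewrite block_mxEul mxE.
    + by rewrite ltn_ord ltnNge leq_addr.
    + by rewrite block_mxEdl mxE.
    + by rewrite block_mxEdr mxE.
  have KL (Z : 'M_(r, q)) : DE (ext F (block_mx 1%:M 0 Z 1%:M)).
    have -> : block_mx 1%:M 0 Z 1%:M = 1%:M + block_mx 0 0 Z 0 :> 'M_(q + r).
      by rewrite (scalar_mx_block _ _ (1:R)) add_block_mx !addr0 add0r.
    apply: (@DE_ext_sep _ F (fun k => (q <= k)%N)) => // i j.
    rewrite -(splitK i) -(splitK j); case: (split i) => a; case: (split j) => b /=.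
    + by rewrite block_mxEul mxE.
    + by rewrite block_mxEur mxE.
    + by rewrite leq_addr leqNgt ltn_ord.
    + by rewrite block_mxEdr mxE.
  rewrite !ext_mul //; do 2![apply: DE_comp => //].
  apply: DE_comp; last exact: DE_comp.
  rewrite ext_rblock //; by apply: IH => a b /Fi /rshift_inj.
Qed.
End Operators.

(** * Finite free resolutions and devissage *)

Section Resolutions.
Variable R : comNzRingType.

Definition submod r (M : 'rV[R]_r -> Prop) :=
  [/\ M 0, forall u v, M u -> M v -> M (u + v) & forall a u, M u -> M (a *: u)].

(** A free resolution of length [l] of the quotient [M / M']. Working with pairs of predicates
    inside one free module keeps the syzygies in the same format; at [l = 0] the quotient is
    zero. *)
Fixpoint ffr (l r : nat) (M M' : 'rV[R]_r -> Prop) : Prop :=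
  if l is l'.+1 then
    exists q (g : 'M[R]_(q, r)), [/\ forall i, M (row i g),
      forall v, M v -> exists c, M' (v - c *m g) &
      ffr l' (fun c : 'rV_q => M' (c *m g)) (fun c => c = 0)]
  else forall v, M v -> M' v.

(** The form of regularity that is used; in particular it makes [R] Noetherian. *)
Definition FFR := forall r (M : 'rV[R]_r -> Prop), submod M -> exists l, ffr l M (fun c => c = 0).

Lemma submodB r (M : 'rV[R]_r -> Prop) u v : submod M -> M u -> M v -> M (u - v).
Proof. by case=> _ MD MZ Mu Mv; apply: MD => //; rewrite -scaleN1r; apply: MZ. Qed.

Lemma submod0 r : submod (fun c : 'rV[R]_r => c = 0).
Proof. by split=> [|_ _ -> ->|a _ ->]; rewrite ?addr0 ?scaler0. Qed.

Lemma submod_comb q r (M : 'rV[R]_r -> Prop) (g : 'M_(q, r)) (c : 'rV_q) :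
  submod M -> (forall i, M (row i g)) -> M (c *m g).
Proof.
case=> M0 MD MZ Mg; rewrite mulmx_sum_row.
by apply: (big_ind M) => // i _; apply: MZ.
Qed.

Lemma submod_preim q r (M : 'rV[R]_r -> Prop) (g : 'M_(q, r)) :
  submod M -> submod (fun c => M (c *m g)).
Proof.
case=> M0 MD MZ; split=> [|u v|a u]; first by rewrite mul0mx.
  by rewrite mulmxDl; apply: MD.
by rewrite -scalemxAl; apply: MZ.
Qed.

Lemma ffr_ext l r (M N M' N' : 'rV[R]_r -> Prop) : (forall v, M v <-> N v) ->
  (forall v, M' v <-> N' v) -> ffr l M M' -> ffr l N N'.
Proof.
move=> MN MN'; have -> : M = N by apply/funext => v; apply/propext.
by have -> : M' = N' by apply/funext => v; apply/propext.
Qed.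

Lemma ffrS l r (M M' : 'rV[R]_r -> Prop) : M' 0 -> ffr l M M' -> ffr l.+1 M M'.
Proof.
elim: l r M M' => [|l IH] r M M' M0 H.
  exists 0%N, 0; split=> [[]//|v /H Mv|c _]; first by exists 0; rewrite mul0mx subr0.
  by rewrite (thinmx0 c).
have [q [g [Mg Hg Hl]]] := H.
by exists q, g; split=> //; apply: IH.
Qed.

Lemma ffr_le l l' r (M M' : 'rV[R]_r -> Prop) : M' 0 -> (l <= l')%N -> ffr l M M' -> ffr l' M M'.
Proof.
by move=> M0 /subnK <-; elim: (l' - l)%N => // k IH H; rewrite addSn; apply: ffrS => //; apply: IH.
Qed.

(** Generators of [M] generate the quotient too, and the relations among them form a submodule of a
    free module, to which [FFR] applies once more. *)
Lemma ffr_quot r (M M' : 'rV[R]_r -> Prop) : FFR -> submod M -> submod M' ->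
  exists l, ffr l M M'.
Proof.
move=> HF sM sM'; have M'0 : M' 0 by case: sM'.
have [[|l]] := HF _ _ sM; first by move=> H; exists 0%N => v /H ->.
case=> q [g [Mg Hg _]]; have [l' H'] := HF _ _ (submod_preim g sM').
exists l'.+1, q, g; split=> // v /Hg [c vc]; exists c.
by rewrite vc.
Qed.

(** Transport along the isomorphism [M / M' -> N / N'] induced by [phi]: the generators are lifted
    and keep the same relations. *)
Lemma ffr_lift l a b (phi : {linear 'rV[R]_a -> 'rV[R]_b}) M M' N N' :
  submod M ->
  (forall v, M v -> N (phi v)) -> (forall v, M v -> N' (phi v) -> M' v) ->
  (forall v, M' v -> N' (phi v)) -> (forall w, N w -> exists2 v, M v & phi v = w) ->
  ffr l N N' -> ffr l M M'.
Proof.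
move=> sM MN N'M' M'N' surj.
case: l => [|l]; first by move=> H v Mv; apply: N'M' => //; apply/H/MN.
case=> q [g [Ng Hg Hl]].
have [gh Hgh] := @choice _ _ (fun i v => M v /\ phi v = row i g)
  (fun i => let: ex_intro2 v Mv pv := surj _ (Ng i) in ex_intro _ v (conj Mv pv)).
pose G := \matrix_(i < q) gh i.
have MG i : M (row i G) by rewrite rowK; case: (Hgh i).
have phiG c : phi (c *m G) = c *m g.
  rewrite mulmx_sum_row linear_sum mulmx_sum_row; apply: eq_bigr => i _.
  by rewrite linearZ /= rowK (proj2 (Hgh i)).
exists q, G; split=> // [v Mv|].
  have [c Hc] := Hg _ (MN _ Mv); exists c; apply: N'M'; last by rewrite linearB /= phiG.
  by apply: submodB => //; apply: submod_comb.
apply: ffr_ext Hl => // c; split=> [H|/M'N']; last by rewrite phiG.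
by apply: N'M'; rewrite ?phiG //; apply: submod_comb.
Qed.

(** The syzygies of [g], filtered by the weight of the generators that they involve. *)
Definition ker_level q r (g : 'M[R]_(q, r)) (w : 'I_q -> nat) i (c : 'rV[R]_q) :=
  (forall j, (i <= w j)%N -> c 0 j = 0) /\ c *m g = 0.

Lemma ker_level_submod q r (g : 'M[R]_(q, r)) w i : submod (ker_level g w i).
Proof.
split=> [|u v [u0 ug] [v0 vg]|a u [u0 ug]]; split.
- by move=> j _; rewrite mxE.
- by rewrite mul0mx.
- by move=> j ij; rewrite mxE u0 // v0 // addr0.
- by rewrite mulmxDl ug vg addr0.
- by move=> j ij; rewrite mxE u0 // mulr0.
- by rewrite -scalemxAl ug scaler0.
Qed.

(** A filtered horseshoe lemma. Generators of the successive quotients are stacked, and weight [i]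
    marks those coming from [C i.+1] modulo [C i]. Modulo lower weights a syzygy is determined by
    its top coefficients, so the quotients of the syzygy filtration are the syzygies of the
    quotients and their resolutions are one step shorter. *)
Lemma chain_cover l r (C : nat -> 'rV[R]_r -> Prop) k :
  (forall i, submod (C i)) -> (forall i v, C i v -> C i.+1 v) -> (forall v, C 0%N v -> v = 0) ->
  (forall i, (i < k)%N -> ffr l.+1 (C i.+1) (C i)) ->
  exists q (g : 'M[R]_(q, r)) (w : 'I_q -> nat),
   [/\ forall j, (w j < k)%N, forall j, C (w j).+1 (row j g),
       forall i v, (i <= k)%N -> C i v ->
         exists2 c : 'rV_q, forall j, (i <= w j)%N -> c 0 j = 0 & v = c *m g &
       forall i, (i < k)%N -> ffr l (ker_level g w i.+1) (ker_level g w i)].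
Proof.
move=> sC Cmono C0.
have Cle i j v : (i <= j)%N -> C i v -> C j v.
  by move=> /subnK <-; elim: (j - i)%N => // m IH /IH; rewrite addSn; apply: Cmono.
elim: k => [|k IH] HC.
  exists 0%N, 0, (fun=> 0%N); split=> // [[]//|[]//|i v].
  by rewrite leqn0 => /eqP -> /C0 ->; exists 0; rewrite ?mul0mx // => j; rewrite mxE.
have [q [g [w [wk Cg Hg Hf]]]] := IH (fun i ik => HC i (leqW ik)).
have [qk [gk [Cgk Hgk Hfk]]] := HC k (ltnSn k).
pose w' (j : 'I_(q + qk)) := match split j with inl a => w a | inr _ => k end.
have w'l a : w' (lshift _ a) = w a by rewrite /w' (unsplitK (inl a)).
have w'r a : w' (rshift _ a) = k by rewrite /w' (unsplitK (inr a)).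
pose g' := col_mx g gk.
have zl i (c : 'rV[R]_(q + qk)) : (forall j, (i <= w' j)%N -> c 0 j = 0) ->
    forall j, (i <= w j)%N -> lsubmx c 0 j = 0.
  by move=> H j ij; rewrite mxE H // w'l.
have zr i (c : 'rV[R]_(q + qk)) : (forall j, (i <= w' j)%N -> c 0 j = 0) -> (i <= k)%N ->
    rsubmx c = 0.
  by move=> H ik; apply/rowP => j; rewrite !mxE H // w'r.
exists (q + qk)%N, g', w'; split.
- by move=> j; rewrite /w'; case: split => [a|_] //; apply: leqW.
- move=> j; rewrite -(splitK j); case: (split j) => a /=.
    by rewrite w'l /g' rowKu.
  by rewrite w'r /g' rowKd.
- move=> i v; rewrite leq_eqVlt => /orP [/eqP -> Cv|ik Cv].
    have [ck Ck] := Hgk _ Cv; have [c c0 vc] := Hg k _ (leqnn k) Ck.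
    exists (row_mx c ck); last by rewrite mul_row_col -vc subrK.
    move=> j; rewrite -(splitK j); case: (split j) => a /=.
      by rewrite w'l => /(ltn_trans (wk a)); rewrite ltnn.
    by rewrite w'r ltnn.
  have [c c0 ->] := Hg i v ik Cv; exists (row_mx c 0); last by rewrite mul_row_col mul0mx addr0.
  move=> j; rewrite -(splitK j); case: (split j) => a /=.
    by rewrite w'l row_mxEl => /c0.
  by rewrite row_mxEr mxE.
- move=> i; rewrite ltnS leq_eqVlt => /orP [/eqP ->|ik].
    (* The new top quotient: projecting to the last [qk] coordinates identifies it with the
       relations of [gk] modulo [C k]. *)
    apply: (@ffr_lift l _ _ (@rsubmx R 1 q qk) _ _ _ (fun c => c = 0)) Hfk.
    + exact: ker_level_submod.
    + move=> c [_]; rewrite -{1}(hsubmxK c) mul_row_col => cg.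
      have -> : rsubmx c *m gk = - (lsubmx c *m g) by apply/eqP; rewrite eq_sym -subr_eq0 -opprD cg oppr0.
      rewrite -mulNmx; apply: submod_comb => // j; exact: Cle (Cg j).
    + move=> c [c0 cg] rc; split=> // j; rewrite leq_eqVlt => /orP [/eqP kj|]; last exact: c0.
      move/rowP: rc; case: (splitP j) => a ja.
        by move: kj; rewrite (_ : j = lshift _ a) ?w'l; [move=> e; have := wk a; rewrite -e ltnn|apply: val_inj].
      by move/(_ a); rewrite !mxE => <-; congr (c 0 _); apply: val_inj.
    + by move=> c [c0 _]; apply: (zr k).
    + move=> ck Ck; have [c c0 vc] := Hg k _ (leqnn k) Ck.
      exists (row_mx (- c) ck); last by rewrite /= row_mxKr.
      split; last by rewrite mul_row_col mulNmx -vc addNr.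
      move=> j; rewrite -(splitK j); case: (split j) => a /=.
        by rewrite w'l => /(ltn_trans (wk a)); rewrite ltnn.
      by rewrite w'r ltnn.
  apply: (@ffr_lift l _ _ (@lsubmx R 1 q qk)) (Hf i ik).
  + exact: ker_level_submod.
  + move=> c [c0 cg]; split; first exact: zl c0.
    by move: cg; rewrite -{1}(hsubmxK c) mul_row_col (zr i.+1) // mul0mx addr0.
  + move=> c [c0 cg] [lc0 lcg]; split=> // j; case: (splitP j) => a ja.
      rewrite (_ : j = lshift _ a) ?w'l; last exact: val_inj.
      by move/lc0; rewrite mxE.
    move=> _; rewrite (_ : j = rshift _ a); last exact: val_inj.
    by have /rowP/(_ a) := zr _ _ c0 ik; rewrite !mxE.
  + move=> c [c0 cg]; split; first exact: zl c0.
    by move: cg; rewrite -{1}(hsubmxK c) mul_row_col (zr i) ?mul0mx ?addr0 // ltnW.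
  + move=> c [c0 cg]; exists (row_mx c 0); last by rewrite /= row_mxKl.
    split; last by rewrite mul_row_col mul0mx addr0.
    move=> j; rewrite -(splitK j); case: (split j) => a /=.
      by rewrite w'l row_mxEl => /c0.
    by rewrite row_mxEr mxE.
Qed.

(** [B0] is an endomorphism of the projective module [im P = C k], acting on each quotient of the
    chain by the scalar [b i]. On a free module covering the chain it lifts to a triangular matrix
    with diagonal entries 0 or 1, for which the claim is clear; the kernel of the covering carries a
    chain with shorter resolutions, which the induction treats. *)
Lemma chain_KG l (B : comNzRingType) (h : {rmorphism R -> B}) (U : B -> Prop) t :
  U 1 -> U t ->
  forall r (C : nat -> 'rV[R]_r -> Prop) k (P B0 : 'M[R]_r) (b : nat -> bool),
  (forall i, submod (C i)) -> (forall i v, C i v -> C i.+1 v) -> (forall v, C 0%N v -> v = 0) ->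
  (forall v, C k (v *m P)) -> (forall v, C k v -> v *m P = v) ->
  P *m B0 = B0 -> B0 *m P = B0 ->
  (forall i v, (i < k)%N -> C i.+1 v -> C i (v *m B0 - (b i)%:R *: v)) ->
  (forall i, (i < k)%N -> ffr l (C i.+1) (C i)) ->
  KG U (1%:M + (t - 1) *: map_mx h B0).
Proof.
move=> U1 Ut; elim: l => [|l IH] r C k P B0 b sC Cmono C0 CkP Pid PB BP Cb Cf.
  suff -> : B0 = 0 by rewrite map_mx0 scaler0 addr0; apply: KG1.
  have Ck j v : (j <= k)%N -> C j v -> v = 0.
    by elim: j v => [|j IHj] v jk Cv; [apply: C0|apply: IHj (ltnW jk) (Cf _ jk _ Cv)].
  rewrite -PB; suff -> : P = 0 by rewrite mul0mx.
  by apply/row_matrixP => i; rewrite row0 rowE; apply: (Ck k) => //; apply: CkP.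
have [q [g [w [wk Cg Hg Hf]]]] := chain_cover sC Cmono C0 Cf.
have Cle i j v : (i <= j)%N -> C i v -> C j v.
  by move=> /subnK <-; elim: (j - i)%N => // m IHm /IHm; rewrite addSn; apply: Cmono.
have [h0 Hh0] := @choice _ _ (fun (i : 'I_r) (c : 'rV[R]_q) => row i P = c *m g)
  (fun i => let: ex_intro2 c _ pc := Hg k (row i P) (leqnn k) (eq_ind_r (C k) (CkP _) (rowE i P))
            in ex_intro _ c pc).
(* [H] splits the covering [g] of the projective module [im P]; the matrix [p] below is the
   resulting projection onto the syzygies. *)
pose H := P *m \matrix_i h0 i.
have P2 : P *m P = P.
  by apply/row_matrixP => i; rewrite row_mul Pid // rowE; apply: CkP.
have HgP : H *m g = P.
  rewrite /H -mulmxA; suff -> : (\matrix_i h0 i) *m g = P by [].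
  by apply/row_matrixP => i; rewrite row_mul rowK -Hh0.
have PH : P *m H = H by rewrite /H mulmxA P2.
have gP : g *m P = g.
  by apply/row_matrixP => i; rewrite row_mul Pid //; apply: Cle (Cg i).
have Hex (j : 'I_q) : exists c : 'rV[R]_q, (forall j', (w j <= w j')%N -> c 0 j' = 0) /\
    row j g *m B0 - (b (w j))%:R *: row j g = c *m g.
  have [c c0 cg] := Hg (w j) _ (ltnW (wk j)) (Cb _ _ (wk j) (Cg j)).
  by exists c.
have [bt Hbt] := @choice _ _ _ Hex.
(* Row [j] lifts the action of [B0] on generator [j]: the scalar on the diagonal plus a correction
   [bt j] of strictly smaller weight. *)
pose Bt : 'M[R]_q := \matrix_j (bt j + (b (w j))%:R *: delta_mx 0 j).
have Btg : Bt *m g = g *m B0.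
  apply/row_matrixP => j; rewrite !row_mul rowK mulmxDl -(proj2 (Hbt j)) -scalemxAl -rowE.
  by rewrite subrK.
have Btd j : Bt j j = (b (w j))%:R.
  by rewrite !mxE (proj1 (Hbt j)) // !eqxx mulr1 add0r.
have Bt0 j j' : j != j' -> (w j <= w j')%N -> Bt j j' = 0.
  move=> jj' wj; rewrite !mxE (proj1 (Hbt j)) // eqxx /= eq_sym (negPf jj').
  by rewrite mulr0 addr0.
pose p := 1%:M - g *m H.
have pg : p *m g = 0 by rewrite mulmxBl mul1mx -mulmxA HgP gP subrr.
have p2 : p *m p = p by rewrite {2}/p mulmxBr mulmx1 mulmxA pg mul0mx subr0.
have kerp c : c *m g = 0 -> c *m p = c by move=> cg; rewrite mulmxBr mulmx1 mulmxA cg mul0mx subr0.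
have pBg : p *m Bt *m g = 0 by rewrite -mulmxA Btg mulmxA pg mul0mx.
have Hp : H *m p = 0 by rewrite mulmxBr mulmx1 mulmxA HgP PH subrr.
have KH : KG U (1%:M + (t - 1) *: map_mx h (p *m Bt)).
  apply: (IH q (ker_level g w) k p (p *m Bt) b).
  - by move=> i; apply: ker_level_submod.
  - by move=> i v [v0 vg]; split=> // j ij; apply: v0; apply: ltnW.
  - by move=> v [v0 _]; apply/rowP => j; rewrite mxE v0.
  - move=> v; split; last by rewrite -mulmxA pg mulmx0.
    by move=> j; rewrite leqNgt wk.
  - by move=> v [_ /kerp].
  - by rewrite mulmxA p2.
  - by rewrite {2}/p mulmxBr mulmx1 mulmxA pBg mul0mx subr0.
  - move=> i c ik [c0 cg]; rewrite mulmxA kerp //; split; last first.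
      by rewrite mulmxBl -scalemxAl cg scaler0 subr0 -mulmxA Btg mulmxA cg mul0mx.
    move=> j ij; rewrite !mxE (bigD1 j) //= Btd big1 ?addr0.
      case: (ltngtP i (w j)) ij => // [iw|->] _; last by rewrite mulrC subrr.
      by rewrite c0 // mul0r mulr0 subr0.
    move=> j' jj'; case: (leqP (w j') (w j)) => ww; first by rewrite Bt0 ?mulr0.
    by rewrite c0 ?mul0r //; apply: leq_ltn_trans ww.
  - exact: Hf.
have KT : KG U (1%:M + (t - 1) *: map_mx h Bt).
  apply: (@KG_triangular _ _ U1 _ w) => [i j ij wij|i].
    by rewrite 4!mxE Bt0 // rmorph0 mulr0 (negPf ij) addr0.
  rewrite 4!mxE Btd eqxx rmorph_nat; case: (b _); last by rewrite mulr0 addr0.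
  by rewrite mulr1 addrC subrK.
have KX : KG U (1%:M + (t - 1) *: map_mx h (g *m H *m Bt *m p)).
  rewrite -!mulmxA map_mxM scalemxAr; apply: KG_square0 => //.
  by rewrite -scalemxAl -map_mxM -!mulmxA pg !mulmx0 map_mx0 scaler0.
(* In the decomposition [im (g H) + ker g] the lift [Bt] is block triangular. *)
have dec : Bt = p *m Bt + g *m H *m Bt *m p + g *m B0 *m H.
  rewrite {2}/p mulmxBr mulmx1 -(mulmxA (g *m H) Bt (g *m H)) (mulmxA Bt g) Btg.
  have -> : g *m H *m (g *m B0 *m H) = g *m B0 *m H.
    by rewrite -!(mulmxA g) (mulmxA H g) HgP !mulmxA -(mulmxA g P) PB.
  by rewrite addrA subrK -mulmxDl /p subrK mul1mx.
have KA : KG U (1%:M + (t - 1) *: map_mx h (g *m B0 *m H)).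
  have := KG_cancel KX; apply; apply: KG_cancel KH _.
  move: KT; congr KG; rewrite {1}dec.
  set s := t - 1; set a := g *m B0 *m H; set x := _ *m p; set c := p *m Bt.
  have xa : x *m a = 0 by rewrite /x /a -!mulmxA (mulmxA p) pg mul0mx !mulmx0.
  have ca : c *m a = 0 by rewrite /c /a !mulmxA pBg !mul0mx.
  have cx : c *m x = 0 by rewrite /c /x !mulmxA pBg !mul0mx.
  have E y z : y *m z = 0 -> map_mx h y *m map_mx h z = 0 by move=> yz; rewrite -map_mxM yz map_mx0.
  have -> : (1%:M + s *: map_mx h x) *m (1%:M + s *: map_mx h a) =
      1%:M + s *: map_mx h x + s *: map_mx h a.
    by rewrite mulmxDr mulmx1 mulmxDl mul1mx -scalemxAl -scalemxAr E // !scaler0 addr0.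
  rewrite mulmxDl mul1mx !mulmxDr mulmx1 -!scalemxAl -!scalemxAr !E // !scaler0 !addr0.
  by rewrite !map_mxD !scalerDr -!addrA; congr (_ + _); rewrite addrC -addrA.
(* Swapping [g] with [B0 H] returns from the free module to the original one, since [H g = P]. *)
move: KA; rewrite -mulmxA map_mxM scalemxAr => /KG_swap.
by rewrite -scalemxAl -map_mxM -mulmxA HgP BP.
Qed.

End Resolutions.

(* [lia] does not identify convertible instances of [size p]; they are abstracted first. *)
Ltac slia :=
  repeat match goal with H : is_true (leq _ _) |- _ => revert H end;
  repeat match goal with |- context [size ?s] => move: (size s) => ? end;
  intros; lia.

(** A matrix of maximal rank among those with rows in [M] spans [M], and a basis of its row space
    has no relations. *)
Lemma FFR_field (F : fieldType) : FFR F.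
Proof.
move=> r M sM.
pose Q m := `[< exists2 A : 'M[F]_r, forall i, M (row i A) & \rank A = m >].
have Q0 : exists m, Q m.
  exists 0%N; apply/asboolP; exists 0; last exact: mxrank0.
  by move=> i; rewrite row0; case: sM.
have Qr m : Q m -> (m <= r)%N by move=> /asboolP [A _ <-]; apply: rank_leq_row.
case: (ex_maxnP Q0 Qr) => m /asboolP [A MA rA] mmax.
have comb q (X : 'M[F]_(q, r)) v : (forall i, M (row i X)) -> (v <= X)%MS -> M v.
  by move=> MX /submxP [c ->]; apply: submod_comb.
have sub v : M v -> (v <= A)%MS.
  move=> Mv; apply: contraT => nvA.
  have : Q (\rank <<col_mx A v>>%MS).
    apply/asboolP; exists <<col_mx A v>>%MS => // i.
    apply: (comb _ (col_mx A v)); last by rewrite (submx_trans (row_sub _ _)) ?genmxE.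
    move=> j; rewrite -(splitK j); case: (split j) => a /=; first by rewrite rowKu.
    by rewrite rowKd row_id.
  move/mmax; rewrite genmxE -rA => rk; case/negP: nvA.
  have sA : (A <= col_mx A v)%MS by rewrite -addsmxE addsmxSl.
  have /eqmxP eqA : (A == col_mx A v)%MS by rewrite -(geq_leqif (mxrank_leqif_eq sA)).
  by rewrite eqA -addsmxE addsmxSr.
exists 1%N, (\rank A), (row_base A); split.
- by move=> i; apply: (comb _ A) => //; rewrite (submx_trans (row_sub _ _)) ?eq_row_base.
- move=> v /sub; rewrite -(eq_row_base A) => /submxP [c ->]; exists c.
  by rewrite subrr.
- move=> c cA; apply: (row_free_inj (row_base_free A)).
  by rewrite cA mul0mx.
Qed.

(** * Resolutions over polynomial rings, by leading coefficients *)

Section PolyResolution.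
Variable R : comNzRingType.
Local Notation P := {poly R}.

(* [dlt e w v] says that [v] has degree [< e] when the [j]-th basis vector has degree [w j]. *)
Definition dlt r e (w : 'I_r -> nat) (v : 'rV[P]_r) := forall j, (size (v 0%R j) <= e - w j)%N.
(** The subtraction is truncated: a coordinate of weight above [e] contributes its constant
    coefficient, which is zero as soon as [dlt e.+1] holds. *)
Definition lead r e (w : 'I_r -> nat) (v : 'rV[P]_r) : 'rV[R]_r := \row_j (v 0 j)`_(e - w j).
Definition LM r (M : 'rV[P]_r -> Prop) w e x := exists v, [/\ M v, dlt e.+1 w v & x = lead e w v].
Definition LC r (M : 'rV[P]_r -> Prop) w i := if i is e.+1 then LM M w e else fun x => x = 0.

Lemma dlt0 r e (w : 'I_r -> nat) : dlt e w 0.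
Proof. by move=> j; rewrite mxE size_poly0. Qed.

Lemma dltD r e (w : 'I_r -> nat) u v : dlt e w u -> dlt e w v -> dlt e w (u + v).
Proof. by move=> du dv j; rewrite mxE (leq_trans (size_polyD _ _)) // geq_max du dv. Qed.

Lemma dltN r e (w : 'I_r -> nat) u : dlt e w u -> dlt e w (- u).
Proof. by move=> du j; rewrite mxE size_polyN. Qed.

Lemma leadD r e (w : 'I_r -> nat) u v : lead e w (u + v) = lead e w u + lead e w v.
Proof. by apply/rowP => j; rewrite !mxE coefD. Qed.

Lemma leadN r e (w : 'I_r -> nat) u : lead e w (- u) = - lead e w u.
Proof. by apply/rowP => j; rewrite !mxE coefN. Qed.

Lemma lead_lt r e (w : 'I_r -> nat) u : dlt e w u -> lead e w u = 0.
Proof. by move=> du; apply/rowP => j; rewrite !mxE nth_default. Qed.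

Lemma dltS r e (w : 'I_r -> nat) u : dlt e w u -> dlt e.+1 w u.
Proof. by move=> du j; rewrite (leq_trans (du j)) // leq_sub2r. Qed.

Lemma dlt_lead0 r e (w : 'I_r -> nat) v : dlt e.+1 w v -> lead e w v = 0 -> dlt e w v.
Proof.
move=> dv /rowP l0 j; have := l0 j; rewrite !mxE => c0.
apply/leq_sizeP => k; rewrite leq_eqVlt => /orP [/eqP <- //|ek].
by apply/(leq_sizeP _ _ (dv j)); lia.
Qed.

Lemma dlt_ex r (w : 'I_r -> nat) v : exists e, dlt e w v.
Proof.
exists (\max_j (size (v 0%R j) + w j))%N => j.
by have := @leq_bigmax _ (fun j => (size (v 0%R j) + w j)%N) j; rewrite /=; slia.
Qed.

Lemma coef_top (p q : P) a b : (size p <= a.+1)%N -> (size q <= b.+1)%N ->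
  (p * q)`_(a + b) = p`_a * q`_b.
Proof.
move=> sp sq; have la : (a < (a + b).+1)%N by lia.
rewrite coefM (bigD1 (Ordinal la)) //= addKn big1 ?addr0 // => -[j jl] /= nj.
have {}nj : j <> a by move=> e; case/eqP: nj; apply: val_inj.
case: (ltnP j a) => ja; first by rewrite [q`_ _]nth_default ?mulr0 //; apply: leq_trans sq _; lia.
by rewrite [p`_ _]nth_default ?mul0r //; apply: leq_trans sp _; lia.
Qed.

Section Mul.
Variables (q r : nat) (w' : 'I_q -> nat) (w : 'I_r -> nat) (G : 'M[P]_(q, r)) (g : 'M[R]_(q, r)).
Hypothesis dG : forall j, dlt (w' j).+1 w (row j G).
Hypothesis lG : forall j, lead (w' j) w (row j G) = row j g.

Lemma dlt_mul e h : dlt e.+1 w' h -> dlt e.+1 w (h *m G).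
Proof.
move=> dh k; rewrite mxE; apply: (leq_trans (size_sum _ _ _)); apply/bigmax_leqP => j _.
have := dh j; have := dG j k; rewrite mxE => s1 s2.
have [->|h0] := eqVneq (h 0 j) 0; first by rewrite mul0r size_poly0.
have [->|g0] := eqVneq (G j k) 0; first by rewrite mulr0 size_poly0.
apply: (leq_trans (size_polyMleq _ _)).
rewrite -size_poly_gt0 in h0; rewrite -size_poly_gt0 in g0.
slia.
Qed.

Lemma lead_mul e h : dlt e.+1 w' h -> lead e w (h *m G) = lead e w' h *m g.
Proof.
move=> dh; apply/rowP => k; rewrite !mxE coef_sum; apply: eq_bigr => j _.
have := dh j; have := dG j k; rewrite !mxE => s1 s2.
have /rowP/(_ k) := lG j; rewrite !mxE => <-.
case: (leqP (w' j) e) => w'e; last first.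
  have /eqP -> : h 0 j == 0 by rewrite -size_poly_eq0; slia.
  by rewrite mul0r !coef0 mul0r.
case: (leqP (w k) (w' j)) => ww; last first.
  have /eqP -> : G j k == 0 by rewrite -size_poly_eq0; slia.
  by rewrite mulr0 !coef0 mulr0.
by have -> : (e - w k = (e - w' j) + (w' j - w k))%N; [lia | apply: coef_top; slia].
Qed.
End Mul.

Definition homog q e (w : 'I_q -> nat) (c : 'rV[R]_q) : 'rV[P]_q :=
  \row_j (c 0 j *: 'X^(e - w j)).

Lemma dlt_homog q e (w : 'I_q -> nat) (c : 'rV[R]_q) :
  (forall j, (e < w j)%N -> c 0 j = 0) -> dlt e.+1 w (homog e w c).
Proof.
move=> c0 j; rewrite mxE; case: (leqP (w j) e) => we; last by rewrite c0 // scale0r size_poly0.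
by apply: (leq_trans (size_scale_leq _ _)); rewrite size_polyXn; lia.
Qed.

Lemma lead_homog q e (w : 'I_q -> nat) c : lead e w (homog e w c) = c.
Proof. by apply/rowP => j; rewrite !mxE coefZ coefXn eqxx mulr1. Qed.

Lemma LC_submod r (M : 'rV[P]_r -> Prop) w i : submod M -> submod (LC M w i).
Proof.
move=> [M0 MD MZ]; case: i => [|e]; first exact: submod0.
split=> [|x y [u [Mu du ->]] [v [Mv dv ->]]|a x [u [Mu du ->]]].
- by exists 0; split=> //; [apply: dlt0|rewrite lead_lt //; apply: dlt0].
- by exists (u + v); split; [apply: MD|apply: dltD|rewrite leadD].
- exists (a%:P *: u); split; first exact: MZ.
    by move=> j; rewrite mxE mul_polyC (leq_trans (size_scale_leq _ _)).
  by apply/rowP => j; rewrite !mxE coefCM.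
Qed.

Lemma LC_mono r (M : 'rV[P]_r -> Prop) w i x : submod M -> LC M w i x -> LC M w i.+1 x.
Proof.
move=> sM; case: i => [|e].
  by move=> ->; have [] := LC_submod w 1 sM.
case=> u [Mu du ->]; exists ('X *: u); split; first by case: sM => _ _; apply.
  move=> j; rewrite mxE mulrC; have := du j.
  have [->|h0] := eqVneq (u 0 j) 0; first by rewrite mul0r size_poly0.
  by rewrite size_mulX //; rewrite -size_poly_gt0 in h0; slia.
apply/rowP => j; rewrite !mxE coefXM; case: (leqP (w j) e) => we.
  by rewrite subSn.
have /eqP -> : u 0 j == 0 by rewrite -size_poly_eq0; have := du j; slia.
by rewrite !coef0 if_same.
Qed.

(** Generators adapted to the chain of leading modules are lifted to [M], and the new free module is
    graded by their degrees [w']. The leading modules of the syzygies are then the filtered syzygies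
    of the leading vectors, whose resolutions are shorter, with the same bound [D] for
    stabilisation. *)
Lemma poly_ffr l : forall r (M : 'rV[P]_r -> Prop) w D, submod M ->
  (forall e x, (D <= e)%N -> LM M w e x -> LM M w D x) ->
  (forall i, (i < D.+1)%N -> ffr l (LC M w i.+1) (LC M w i)) ->
  ffr l M (fun v => v = 0).
Proof.
elim: l => [|l IH] r M w D sM stab Hf.
  have z e x : (e <= D)%N -> LM M w e x -> x = 0.
    elim: e x => [|e IHe] x eD Hx; first exact: (Hf 0%N _ x).
    by apply: IHe (ltnW eD) _; apply: (Hf e.+1 _ x).
  have z' e x : LM M w e x -> x = 0.
    case: (leqP e D) => eD; first exact: z.
    by move/(stab _ _ (ltnW eD)); apply: z.
  move=> v; have [e] := dlt_ex w v; elim: e v => [|e IHe] v dv Mv.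
    by apply/rowP => j; apply/eqP; rewrite mxE -size_poly_eq0 -leqn0; apply: dv.
  by apply: (IHe v _ Mv); apply: dlt_lead0 => //; apply: (z' e); exists v.
have [q [g [w' [wk Cg Hg Hk]]]] :=
  chain_cover (fun i => LC_submod w i sM) (fun i x => LC_mono (w := w) (i := i) (x := x) sM)
   (fun v (h : LC M w 0 v) => h) Hf.
have [gh Hgh] := @choice _ _ (fun j v => [/\ M v, dlt (w' j).+1 w v & row j g = lead (w' j) w v]) Cg.
pose G := \matrix_j gh j.
have MG j : M (row j G) by rewrite rowK; case: (Hgh j).
have dG j : dlt (w' j).+1 w (row j G) by rewrite rowK; case: (Hgh j).
have lG j : lead (w' j) w (row j G) = row j g by rewrite rowK; case: (Hgh j).
(* Division with control of the degree: subtract a homogeneous combination with the same leading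
   vector and recurse. *)
have gen e v : M v -> dlt e w v -> exists2 h, dlt e w' h & v = h *m G.
  elim: e v => [|e IHe] v Mv dv.
    exists 0; first exact: dlt0.
    by rewrite mul0mx; apply/rowP => j; apply/eqP; rewrite mxE -size_poly_eq0 -leqn0; apply: dv.
  have lv : LM M w e (lead e w v) by exists v.
  have [c c0 cg] : exists2 c : 'rV_q, forall j, (e < w' j)%N -> c 0 j = 0 & lead e w v = c *m g.
    case: (leqP e D) => eD; first exact: (Hg e.+1).
    have [c c0 cg] := Hg D.+1 _ (leqnn _) (stab _ _ (ltnW eD) lv).
    by exists c => // j ej; have := wk j; lia.
  have dh := dlt_homog c0.
  have [h1 dh1 eh1] : exists2 h, dlt e w' h & v - homog e w' c *m G = h *m G.
    apply: IHe; first by apply: submodB => //; apply: submod_comb.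
    apply: dlt_lead0.
      by apply: dltD => //; apply: dltN; apply: (dlt_mul dG).
    by rewrite leadD leadN (lead_mul dG lG) // lead_homog cg subrr.
  exists (h1 + homog e w' c); first by apply: dltD => //; apply: dltS.
  by rewrite mulmxDl -eh1 subrK.
exists q, G; split=> // [v Mv|].
  have [e dv] := dlt_ex w v; have [h _ ->] := gen e v Mv dv.
  by exists h; rewrite subrr.
(* A relation between leading vectors lifts to a relation between the rows of [G]: the error has
   smaller degree, so dividing it by [G] does not disturb the leading coefficients. *)
have LMH e x : LM (fun h => h *m G = 0) w' e x <-> ker_level g w' e.+1 x.
  split=> [[h [hG dh ->]]|[c0 cg]].
    split; last by rewrite -(lead_mul dG lG) // hG lead_lt //; apply: dlt0.
    move=> j ej; have := dh j; rewrite mxE => sh.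
    have /eqP -> : h 0 j == 0 by rewrite -size_poly_eq0; slia.
    by rewrite coef0.
  have dh := dlt_homog c0.
  have [h1 dh1 eh1] : exists2 h, dlt e w' h & homog e w' x *m G = h *m G.
    apply: gen; first exact: submod_comb.
    apply: dlt_lead0; first exact: (dlt_mul dG).
    by rewrite (lead_mul dG lG) // lead_homog.
  exists (homog e w' x - h1); split; first by rewrite mulmxBl eh1 subrr.
    by apply: dltD => //; apply: dltN; apply: dltS.
  by rewrite leadD leadN (lead_lt dh1) subr0 lead_homog.
apply: (IH q _ w' D); first exact: submod_preim (submod0 _ _).
  move=> e x eD /LMH [x0 xg]; apply/LMH; split=> // j jD.
  by have := wk j; lia.
move=> i iD; apply: ffr_ext (Hk i iD) => x; first by split=> /LMH.
case: i {iD} => [|i]; last by split=> /LMH.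
split=> [[x0 _]|->]; first by apply/rowP => j; rewrite mxE x0.
by split=> [j _|]; rewrite ?mxE ?mul0mx.
Qed.

Lemma ffr_uniform r (C : nat -> 'rV[R]_r -> Prop) k : FFR R -> (forall i, submod (C i)) ->
  exists l, forall i, (i < k)%N -> ffr l (C i.+1) (C i).
Proof.
move=> HF sC; elim: k => [|k [l Hl]]; first by exists 0%N.
have [l' Hl'] := ffr_quot HF (sC k.+1) (sC k).
have C0 i : C i 0 by case: (sC i).
exists (maxn l l') => i; rewrite ltnS leq_eqVlt => /orP [/eqP ->|ik].
  by apply: ffr_le Hl' => //; apply: leq_maxr.
by apply: ffr_le (Hl i ik) => //; apply: leq_maxl.
Qed.

(** The union of the increasing leading modules is finitely generated and hence reached at some
    degree [D], as in Hilbert's basis theorem. *)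
Lemma FFR_poly : FFR R -> FFR P.
Proof.
move=> HF r M sM; pose w (j : 'I_r) := 0%N.
have LMle e e' x : (e <= e')%N -> LM M w e x -> LM M w e' x.
  move=> /subnK <-; elim: (e' - e)%N => // k IH /IH; rewrite addSn.
  exact: (@LC_mono _ _ _ (k + e).+1).
have sU : submod (fun x => exists e, LM M w e x).
  split=> [|x y [e ex] [e' ey]|a x [e ex]].
  - by exists 0%N; case: (LC_submod w 1 sM).
  - exists (maxn e e'); have [_ H _] := LC_submod w (maxn e e').+1 sM; apply: H.
      exact: LMle (leq_maxl _ _) ex.
    exact: LMle (leq_maxr _ _) ey.
  - by exists e; have [_ _ H] := LC_submod w e.+1 sM; apply: H.
have [D HD] : exists D, forall e x, LM M w e x -> LM M w D x.
  have [[|l]] := HF _ _ sU.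
    move=> H; exists 0%N => e x ex; rewrite (H x); last by exists e.
    by case: (LC_submod w 1 sM).
  case=> q [g [Ug Hg _]]; have [es Hes] := @choice _ _ _ Ug.
  exists (\max_j es j) => e x ex; have [|c /subr0_eq ->] := Hg x; first by exists e.
  apply: (submod_comb c (LC_submod w (\max_j es j).+1 sM)) => j.
  exact: LMle (leq_bigmax j) (Hes j).
have [l Hl] := ffr_uniform D.+1 HF (fun i => LC_submod w i sM).
exists l; apply: (poly_ffr (w := w) (D := D)) => // e x _; exact: HD.
Qed.

End PolyResolution.

(** * The Bass-Heller-Swan step for a Laurent extension *)

Section LaurentExtension.
Variables (R B : comNzRingType) (i : {rmorphism {poly R} -> B}) (ti : B).
Local Notation t := (i 'X).
Hypotheses (i_inj : injective i) (tti : t * ti = 1).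
Hypothesis clear1 : forall b : B, exists k p, t ^+ k * b = i p.

Lemma tXK k : t ^+ k * ti ^+ k = 1.
Proof. by rewrite -exprMn tti expr1n. Qed.

Lemma clear_mx m n (A : 'M[B]_(m, n)) : exists k P, t ^+ k *: A = map_mx i P.
Proof.
have [k Hk] := @choice _ _ (fun (x : 'I_m * 'I_n) k => exists p, t ^+ k * A x.1 x.2 = i p)
   (fun x => clear1 (A x.1 x.2)).
pose K := (\max_x k x)%N.
have HK x : exists p, t ^+ K * A x.1 x.2 = i p.
  have [p Hp] := Hk x; exists ('X^(K - k x) * p).
  by rewrite rmorphM /= rmorphXn -Hp mulrA -exprD subnK // leq_bigmax.
have [P HP] := @choice _ _ _ HK.
exists K, (\matrix_(a, b) P (a, b)); apply/matrixP => a b.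
by rewrite !mxE -HP.
Qed.

(** The contraction to the polynomial ring is resolved and scalars are extended; denominators are
    powers of the invertible [t]. *)
Lemma ffr_loc l : forall r (M : 'rV[B]_r -> Prop), submod M ->
  ffr l (fun p => M (map_mx i p)) (fun p => p = 0) -> ffr l M (fun c => c = 0).
Proof.
have map_inj m n : injective (map_mx i : 'M_(m, n) -> _).
  by move=> a b /matrixP ab; apply/matrixP => x y; apply: i_inj; have := ab x y; rewrite !mxE.
elim: l => [|l IH] r M sM.
  move=> H v Mv; have [k [P HP]] := clear_mx v.
  have : P = 0 by apply: H; rewrite -HP; case: sM => _ _; apply.
  move=> P0; rewrite P0 map_mx0 in HP.
  by rewrite -[v]scale1r -(tXK k) mulrC -scalerA HP scaler0.
case=> q [g [Mg Hg Hl]]; exists q, (map_mx i g); split.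
- by move=> j; rewrite -map_row.
- move=> v Mv; have [k [P HP]] := clear_mx v.
  have [|c /subr0_eq Pc] := Hg P; first by rewrite -HP; case: sM => _ _; apply.
  exists (ti ^+ k *: map_mx i c).
  rewrite -scalemxAl -map_mxM -Pc -HP scalerA mulrC tXK scale1r subrr //.
- apply: IH; first exact: submod_preim (submod0 _ _).
  apply: ffr_ext Hl => // c; rewrite -map_mxM; split=> [->|]; first by rewrite map_mx0.
  by rewrite -(map_mx0 i) => /map_inj.
Qed.

Lemma FFR_loc : FFR R -> FFR B.
Proof.
move=> HF r M sM; have [|l Hl] := FFR_poly HF (r := r) (M := fun p => M (map_mx i p)).
  case: sM => M0 MD MZ; split=> [|u v|a u]; first by rewrite map_mx0.
    by rewrite map_mxD; apply: MD.
  by rewrite map_mxZ; apply: MZ.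
by exists l; apply: ffr_loc.
Qed.

Variables (U : R -> Prop) (V : B -> Prop).
Hypotheses (V1 : V 1) (VM : forall a b, V a -> V b -> V (a * b)) (Vt : V t)
  (UV : forall c, U c -> V (i c%:P)).
Hypotheses (HF : FFR R) (HU : KGall U).

(** Compare coefficients in [(D + X E) C = X^N], where [D = 1 - E]: below degree [N] powers of [D]
    kill the coefficients of [C], from [N] on powers of [E] kill them, and the equation
    [D c_N + E c_(N-1) = 1] combines the two. *)
Lemma unipotent_split n (E : 'M[R]_n) (C : 'M[{poly R}]_n) N :
  (1%:M + ('X - 1) *: map_mx polyC E) *m C = ('X^N)%:M ->
  exists a, E ^+ a * (1 - E) ^+ N = 0.
Proof.
move=> EC; pose c j : 'M[R]_n := map_mx (coefp j) C; pose D := 1 - E.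
have DE k m : D ^+ k * E ^+ m = E ^+ m * D ^+ k.
  apply/commrX/commr_sym/commrX; apply: commrB; [exact: commr1|exact: commr_refl].
have coefC A j : map_mx (coefp j) (map_mx polyC A *m C) = A * c j.
  apply/matrixP => x y; rewrite !mxE /= coef_sum; apply: eq_bigr => k _.
  by rewrite !mxE coefCM.
have coefN j : map_mx (coefp j) ('X^N)%:M = (j == N)%:R :> 'M[R]_n.
  by apply/matrixP => x y; rewrite !mxE /= coefMn coefXn; case: (j == N); rewrite ?mxE // mul0rn.
have ECD : map_mx polyC D *m C + 'X *: (map_mx polyC E *m C) = ('X^N)%:M.
  rewrite -EC mulmxDl mul1mx -scalemxAl scalerBl scale1r map_mxB map_mx1 mulmxBl mul1mx.
  by rewrite addrAC -!addrA.
have rec0 : D * c 0%N = (0 == N)%:R.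
  rewrite -coefN -ECD map_mxD coefC -[LHS]addr0; congr (_ + _).
  by apply/matrixP => x y; rewrite !mxE /= coefXM.
have rec j : D * c j.+1 + E * c j = (j.+1 == N)%:R.
  rewrite -coefN -ECD map_mxD coefC -(coefC E); congr (_ + _).
  by apply/matrixP => x y; rewrite !mxE /= coefXM /=.
have D0 j : (j < N)%N -> D ^+ j.+1 * c j = 0.
  elim: j => [|j IH] jN; first by rewrite expr1 rec0 ltn_eqF.
  have := rec j; rewrite ltn_eqF // => /eqP; rewrite addr_eq0 => /eqP e.
  rewrite exprSr -mulrA e mulrN mulrA -[E]expr1 DE -mulrA IH ?mulr0 ?oppr0 //.
  exact: ltnW.
have [m0 Hm0] : exists m0, forall j, (m0 <= j)%N -> c j = 0.
  exists (\max_x size (C x.1 x.2))%N => j mj; apply/matrixP => x y; rewrite !mxE /=.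
  apply: nth_default; apply: leq_trans mj.
  exact: (@leq_bigmax _ (fun x => size (C x.1 x.2)) (x, y)).
have E0 m j : (N <= j)%N -> (m0 <= m + j)%N -> E ^+ m * c j = 0.
  elim: m j => [|m IH] j Nj mj; first by rewrite Hm0 ?mulr0.
  have := rec j; rewrite gtn_eqF // => /eqP; rewrite addrC addr_eq0 => /eqP e.
  rewrite exprSr -mulrA e mulrN mulrA -[D]expr1 -DE -mulrA IH ?mulr0 ?oppr0 //.
    exact: leqW.
  by rewrite addnS.
exists m0.+1; clear coefN ECD; case: N => [|N'] in EC rec0 rec D0 E0 *.
  have := E0 m0.+1 0%N (leqnn _); rewrite addn0 leqnSn => /(_ isT) e.
  have r1 : D * c 0%N = 1 by rewrite rec0.
  by rewrite expr0 mulr1 -[LHS]mulr1 -{1}r1 mulrA -[D]expr1 -DE -mulrA e mulr0.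
have r1 : D * c N'.+1 + E * c N' = 1 by rewrite rec eqxx.
have e1 : E ^+ m0.+1 * c N'.+1 = 0 by apply: E0 => //; lia.
have e2 := D0 N' (leqnn _).
rewrite -/D -[LHS]mulr1 -r1 mulrDr.
have -> : E ^+ m0.+1 * D ^+ N'.+1 * (D * c N'.+1) = 0.
  by rewrite mulrA -[_ * D]mulrA -exprSr -DE -mulrA e1 mulr0.
by rewrite add0r mulrA -[_ * E]mulrA -[X in _ * (_ * X) * _]expr1 DE mulrA -mulrA e2 mulr0.
Qed.

(** The images of the growing products of [a] factors [E] followed by [b] factors [1 - E] form a
    chain from the whole module down to zero, on whose quotients [E] acts by 0 and then by 1. These
    modules need not be free, which is why resolutions are needed. *)
Lemma KG_linear n (E : 'M[R]_n) a b : E ^+ a * (1 - E) ^+ b = 0 ->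
  KG V (1%:M + (t - 1) *: map_mx (i \o polyC) E).
Proof.
move=> Eab; pose D := 1 - E; pose Q m := E ^+ minn m a * D ^+ (m - a).
pose k := (a + b)%N; pose C j (v : 'rV[R]_n) := exists u : 'rV_n, v = u *m Q (k - j)%N.
have DE m m' : D ^+ m * E ^+ m' = E ^+ m' * D ^+ m.
  apply/commrX/commr_sym/commrX; apply: commrB; [exact: commr1|exact: commr_refl].
have QE m : (m < a)%N -> Q m.+1 = Q m * E /\ Q m.+1 = E * Q m.
  move=> ma; rewrite /Q (minn_idPl ma) (minn_idPl (ltnW ma)).
  have -> : (m.+1 - a = 0)%N by lia. have -> : (m - a = 0)%N by lia.
  by rewrite !expr0 !mulr1 -exprSr -exprS.
have QD m : (a <= m)%N -> Q m.+1 = Q m * D /\ Q m.+1 = D * Q m.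
  move=> am; rewrite /Q (minn_idPr am) (minn_idPr (leqW am)) subSn //.
  split; first by rewrite exprSr mulrA.
  by have := DE 1 a; rewrite expr1 => DE1; rewrite exprS mulrA -DE1 -mulrA.
have sC j : submod (C j).
  split=> [|_ _ [u ->] [v ->]|x _ [u ->]]; first by exists 0; rewrite mul0mx.
    by exists (u + v); rewrite mulmxDl.
  by exists (x *: u); rewrite scalemxAl.
have Cm j v : C j v -> C j.+1 v.
  case=> u ->; case: (leqP k j) => kj.
    by exists u; congr (_ *m Q _); lia.
  have e : (k - j = (k - j.+1).+1)%N by lia.
  rewrite e /C; case: (ltnP (k - j.+1) a) => h.
    by exists (u *m E); have [_ ->] := QE _ h; rewrite mulmxA.
  by exists (u *m D); have [_ ->] := QD _ h; rewrite mulmxA.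
have [l Hl] := ffr_uniform k HF sC.
(* The product at stage [k - j] was obtained by appending a factor [1 - E] exactly when this stage
   exceeds [a]; on that quotient [E] acts as 1. *)
apply: (@chain_KG R l B _ V t V1 Vt n C k 1%:M E (fun j => (a < k - j)%N)) => //.
- move=> v [u ->]; rewrite subn0 /Q /k (minn_idPr (leq_addr _ _)) addKn Eab mulmx0 //.
- by move=> v; exists v; rewrite mulmx1 subnn /Q min0n sub0n expr0 mulr1 mulmx1.
- by move=> v _; rewrite mulmx1.
- by rewrite mul1mx.
- by rewrite mulmx1.
move=> j v jk [u ->]; have e : (k - j = (k - j.+1).+1)%N by lia.
rewrite /C e ltnS; case: leqP => h.
  exists (- u); have [-> _] := QD _ h.
  have -> : Q (k - j.+1)%N * D = Q (k - j.+1)%N - Q (k - j.+1)%N *m E by rewrite /D mulrBr mulr1.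
  by rewrite scale1r mulNmx mulmxBr opprB; congr (_ - _); exact: (esym (mulmxA _ _ _)).
by exists u; have [-> _] := QE _ h; rewrite scale0r subr0; exact: (esym (mulmxA _ _ _)).
Qed.

(** Higman's linearisation: doubling the size lowers the degree by one until it is at most 1, where
    the matrix is [A (1 + (X - 1) E)]. *)
Lemma KG_poly d : forall n (P P' : 'M[{poly R}]_n) N, P *m P' = ('X^N)%:M ->
  (forall x y, (size (P x y) <= d.+2)%N) -> KG V (map_mx i P).
Proof.
elim: d => [|d IH] n P P' N PP' sP.
  (* Evaluation is at 1 and not at 0, since there the relation [P P' = X^N] makes the value [A]
     invertible. *)
  pose ev := [the {rmorphism {poly R} -> R} of horner_eval (1 : R)].
  pose A := map_mx ev P; pose A' := map_mx ev P'; pose P1 : 'M[R]_n := map_mx (coefp 1) P.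
  have AA' : A *m A' = 1%:M.
    by rewrite -map_mxM PP' map_scalar_mx /= /horner_eval hornerXn expr1n.
  have A'A := mulmx1C AA'.
  pose E := A' *m P1; pose f := [the {rmorphism R -> B} of i \o polyC].
  have eP : P = map_mx polyC A *m (1%:M + ('X - 1) *: map_mx polyC E).
    rewrite mulmxDr mulmx1 -scalemxAr -map_mxM mulmxA AA' mul1mx.
    apply/matrixP => x y; rewrite !mxE /= /horner_eval.
    have := sP x y; move: (P x y) => p sp.
    have ep : p = (p`_0)%:P + (p`_1)%:P * 'X.
      apply/polyP => -[|[|k]]; rewrite coefD coefC coefMX coefC /= ?addr0 ?add0r //.
      by rewrite nth_default //; apply: leq_trans sp _.
    rewrite {1}ep; have -> : p.[1] = p`_0 + p`_1 by rewrite {1}ep !hornerE.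
    by rewrite polyCD; ring.
  have [] := @unipotent_split n E (P' *m map_mx polyC A) N.
    have e : map_mx polyC A' *m map_mx polyC A = 1%:M by rewrite -map_mxM A'A map_mx1.
    have : map_mx polyC A' *m (P *m P') *m map_mx polyC A = ('X^N)%:M.
      by rewrite PP' mul_mx_scalar -scalemxAl e scale_scalar_mx mulr1.
    by rewrite {1}eP; set X := 1%:M + _; rewrite !mulmxA e mul1mx => <-.
  move=> a /KG_linear KE; rewrite eP map_mxM; apply: KG_mul.
    have -> : map_mx i (map_mx polyC A) = map_mx f A by apply/matrixP => x y; rewrite !mxE.
    by apply: (@KG_map R B f U V UV); apply: HU AA'.
  rewrite map_mxD map_mx1 map_mxZ rmorphB (rmorph1 i).
  rewrite (_ : map_mx i (map_mx polyC E) = map_mx (i \o polyC) E); first exact: KE.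
  by apply/matrixP => x y; rewrite !mxE.
pose Pd : 'M[{poly R}]_n := map_mx (polyC \o coefp d.+2) P.
(* The two off-diagonal blocks encode the removed term [X^(d+2) Pd] as a product of entries of
   degrees 1 and [d + 1]. *)
pose Z : 'M_(n + n) := block_mx (P - 'X^(d.+2) *: Pd) ('X *: Pd) (- ('X^(d.+1))%:M) 1%:M.
have eZ : block_mx P 0 0 1%:M = block_mx 1%:M (- ('X *: Pd)) 0 1%:M *m Z *m
    block_mx 1%:M 0 ('X^(d.+1))%:M 1%:M.
  rewrite !mulmx_block ?(mulmx1, mul1mx, mul0mx, mulmx0, addr0, add0r).
  rewrite mulNmx mulmxN opprK mul_mx_scalar subrr mul0mx addr0 addNr.
  by rewrite scalerA -exprSr subrK.
apply: (@KG_unstab _ _ n n).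
have eb : map_mx i (block_mx P 0 0 1%:M : 'M_(n + n)) = block_mx (map_mx i P) 0 0 1%:M.
  by rewrite map_block_mx !map_mx0 map_mx1.
rewrite -eb eZ !map_mxM; apply: KG_mul; last first.
  by rewrite map_block_mx map_mx0 !map_mx1; apply: KG_lower.
apply: KG_mul; first by rewrite map_block_mx map_mx0 !map_mx1; apply: KG_upper.
apply: (IH _ _ (block_mx 1%:M 0 ('X^(d.+1))%:M 1%:M *m block_mx P' 0 0 ('X^N)%:M *m
   block_mx 1%:M (- ('X *: Pd)) 0 1%:M) N).
  have -> : Z = block_mx 1%:M ('X *: Pd) 0 1%:M *m block_mx P 0 0 1%:M *m
                block_mx 1%:M 0 (- ('X^(d.+1))%:M) 1%:M.
    rewrite !mulmx_block ?(mulmx1, mul1mx, mul0mx, mulmx0, addr0, add0r).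
    by rewrite mulmxN mul_mx_scalar scalerA -exprSr.
  rewrite -!mulmxA (mulmxA (block_mx 1%:M 0 (- _) _)).
  have -> : block_mx 1%:M 0 (- ('X^(d.+1))%:M) 1%:M *m block_mx 1%:M 0 ('X^(d.+1))%:M 1%:M =
     1%:M :> 'M[{poly R}]_(n + n).
    rewrite mulmx_block ?(mulmx1, mul1mx, mul0mx, mulmx0, addr0, add0r) addNr.
    by rewrite -scalar_mx_block.
  rewrite mul1mx (mulmxA (block_mx P _ _ _)).
  have -> : block_mx P 0 0 (1%:M : 'M_n) *m block_mx P' 0 0 (('X^N)%:M : 'M_n) = ('X^N)%:M.
    by rewrite mulmx_block ?(mulmx1, mul1mx, mul0mx, mulmx0, addr0, add0r) PP' -scalar_mx_block.
  rewrite mul_scalar_mx -scalemxAr mulmx_block ?(mulmx1, mul1mx, mul0mx, mulmx0, addr0, add0r).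
  by rewrite addNr -scalar_mx_block scale_scalar_mx mulr1.
move=> x y; rewrite -(splitK x) -(splitK y); case: (split x) => x'; case: (split y) => y' /=.
- rewrite block_mxEul !mxE /=; apply/leq_sizeP => j; rewrite leq_eqVlt => /orP [/eqP <-|dj].
    by rewrite coefB mulrC coefCM coefXn eqxx mulr1 subrr.
  rewrite coefB mulrC coefCM coefXn gtn_eqF // mulr0 subr0 nth_default //.
  exact: leq_trans (sP _ _) dj.
- rewrite block_mxEur !mxE mulrC; apply: (leq_trans (size_polyMleq _ _)).
  by rewrite size_polyX; have := size_polyC_leq1 ((P x' y')`_d.+2); slia.
- rewrite block_mxEdl !mxE size_polyN; case: eqP => _; last by rewrite mulr0n size_poly0.
  by rewrite mulr1n size_polyXn.
- rewrite block_mxEdr !mxE; case: eqP => _; last by rewrite size_poly0.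
  by rewrite size_poly1.
Qed.

(** Clearing denominators multiplies the matrix by a scalar matrix [t^k], which is diagonal with
    entries in [V] and can be cancelled. *)
Theorem KGall_laurent : KGall V.
Proof.
move=> n M M' MM'.
have [k [P HP]] := clear_mx M; have [k' [P' HP']] := clear_mx M'.
have PP' : P *m P' = ('X^(k + k'))%:M.
  apply/matrixP => x y; apply: i_inj.
  have : map_mx i (P *m P') = map_mx i ('X^(k + k'))%:M.
    rewrite map_mxM -HP -HP' -scalemxAl -scalemxAr MM' map_scalar_mx !scale_scalar_mx mulr1.
    by rewrite rmorphXn exprD.
  by move/matrixP/(_ x y); rewrite !mxE.
have KP : KG V (map_mx i P).
  apply: (KG_poly (d := (\max_x size (P x.1 x.2))%N) PP') => x y.
  have := @leq_bigmax _ (fun x => size (P x.1 x.2)) (x, y); rewrite /=; slia.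
apply: (@KG_cancel _ _ _ ((t ^+ k)%:M)); last by rewrite mul_scalar_mx HP.
apply: (@KG_triangular _ _ V1 _ (fun=> 0%N)) => [x y xy _|x]; first by rewrite mxE (negPf xy).
by rewrite mxE eqxx; elim: k {HP PP'} => // k IH; rewrite exprS; apply: VM.
Qed.

End LaurentExtension.

(** * A construction of the Laurent polynomial ring *)

Section LaurentRing.
Variable R : idomainType.
Local Notation F := {fraction {poly R}}.
Local Notation tofr := (@FracField.tofrac {poly R}).

(** The ring is cut out of a fraction field, so that it inherits integrality and the construction
    can be iterated. *)
Definition lpred : pred F := fun x => `[< exists k p, (tofr 'X) ^+ k * x = tofr p >].

Lemma lpredP x : reflect (exists k p, (tofr 'X) ^+ k * x = tofr p) (lpred x).
Proof. exact: asboolP. Qed.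

Lemma lpred_subring : subring_closed lpred.
Proof.
split.
- by apply/lpredP; exists 0%N, 1; rewrite expr0 mul1r rmorph1.
- move=> x y /lpredP [k [p xp]] /lpredP [m [q yq]]; apply/lpredP.
  exists (k + m)%N, ('X^m * p - 'X^k * q).
  rewrite rmorphB !rmorphM !rmorphXn /= -xp -yq mulrBr exprD; congr (_ - _).
    by rewrite mulrCA mulrA.
  by rewrite mulrA.
- move=> x y /lpredP [k [p xp]] /lpredP [m [q yq]]; apply/lpredP.
  by exists (k + m)%N, (p * q); rewrite rmorphM /= -xp -yq exprD mulrACA.
Qed.

HB.instance Definition _ := GRing.isSubringClosed.Build F lpred lpred_subring.

Record laurent := Laurent { lval : F; lvalP : lval \in lpred }.
HB.instance Definition _ := [isSub for lval].
HB.instance Definition _ := [Choice of laurent by <:].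
HB.instance Definition _ := [SubChoice_isSubComNzRing of laurent by <:].

Definition lunit : pred laurent := fun x => `[< exists y : laurent, y * x = 1 >].
Definition linv (x : laurent) : laurent :=
  if pselect (exists y : laurent, y * x = 1) is left h then sval (cid h) else x.

Fact lmulVr : {in lunit, left_inverse 1 linv *%R}.
Proof. by move=> x /asboolP hx; rewrite /linv; case: pselect => // h; case: cid. Qed.
Fact lunitP (x y : laurent) : y * x = 1 -> lunit x.
Proof. by move=> yx; apply/asboolP; exists y. Qed.
Fact linv_out : {in [predC lunit], linv =1 id}.
Proof. by move=> x; rewrite inE => /asboolPn hx; rewrite /linv; case: pselect. Qed.
HB.instance Definition _ := GRing.ComNzRing_hasMulInverse.Build laurent lmulVr lunitP linv_out.

Fact laurent_integral : GRing.integral_domain_axiom laurent.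
Proof.
move=> x y /(congr1 val); rewrite rmorphM rmorph0 => /eqP.
by rewrite mulf_eq0 -!(inj_eq val_inj) !rmorph0.
Qed.
HB.instance Definition _ := GRing.ComUnitRing_isIntegral.Build laurent laurent_integral.

Fact tolP (p : {poly R}) : tofr p \in lpred.
Proof. by apply/lpredP; exists 0%N, p; rewrite expr0 mul1r. Qed.
Definition tol (p : {poly R}) : laurent := Laurent (tolP p).
Fact tol_zmod : zmod_morphism tol.
Proof. by move=> p q; apply: val_inj; rewrite /= !rmorphB. Qed.
Fact tol_monoid : monoid_morphism tol.
Proof. by split=> [|p q]; apply: val_inj; rewrite /= ?rmorph1 ?rmorphM. Qed.
HB.instance Definition _ := GRing.isZmodMorphism.Build {poly R} laurent tol tol_zmod.
HB.instance Definition _ := GRing.isMonoidMorphism.Build {poly R} laurent tol tol_monoid.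

Fact tolVP : (tofr 'X)^-1 \in lpred.
Proof.
apply/lpredP; exists 1%N, 1; rewrite expr1 rmorph1 mulfV //.
by rewrite tofrac_eq0 polyX_eq0.
Qed.

Lemma tol_inj : injective tol.
Proof. by move=> p q /(congr1 val) /eqP; rewrite /= tofrac_eq => /eqP. Qed.

Lemma tol_clear (b : laurent) : exists k p, tol 'X ^+ k * b = tol p.
Proof.
case: b => b bP; have /lpredP [k [p e]] := bP; exists k, p; apply: val_inj.
by rewrite rmorphM rmorphXn /= e.
Qed.

Lemma tolXV : tol 'X * Laurent tolVP = 1.
Proof. by apply: val_inj; rewrite rmorphM /= mulfV // tofrac_eq0 polyX_eq0. Qed.

End LaurentRing.

(** * Iterated Laurent rings and their monomial units *)

Section Tower.
Variables (K : fieldType) (D : eqType).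

Definition mono (L : comNzRingType) (x : D -> L) (c : seq D) (a : D -> nat) : L :=
  \prod_(k <- c) x k ^+ a k.

Inductive lgen (L : comNzRingType) (kap : K -> L) (x xi : D -> L) (c : seq D) : L -> Prop :=
| lg_c l : lgen kap x xi c (kap l)
| lg_x k : k \in c -> lgen kap x xi c (x k)
| lg_xi k : k \in c -> lgen kap x xi c (xi k)
| lg_D u v : lgen kap x xi c u -> lgen kap x xi c v -> lgen kap x xi c (u + v)
| lg_M u v : lgen kap x xi c u -> lgen kap x xi c v -> lgen kap x xi c (u * v).

(** Numerator and denominator exponents are two functions to [nat]; the operators [x^a y^b] will be
    encoded in the same way. *)
Definition monou (L : comNzRingType) (kap : K -> L) (x xi : D -> L) (c : seq D) (u : L) :=
  exists l a b, l != 0 /\ u = kap l * mono x c a * mono xi c b.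

Lemma monoD (L : comNzRingType) (x : D -> L) c a b :
  mono x c a * mono x c b = mono x c (fun k => (a k + b k)%N).
Proof. by rewrite -big_split; apply: eq_bigr => k _ /=; rewrite exprD. Qed.

Lemma mono0 (L : comNzRingType) (x : D -> L) c : mono x c (fun=> 0%N) = 1.
Proof. by rewrite /mono big1. Qed.

Lemma monoV (L : comNzRingType) (x xi : D -> L) c a : (forall k, x k * xi k = 1) ->
  mono x c a * mono xi c a = 1.
Proof. by move=> h; rewrite -big_split big1 // => k _ /=; rewrite -exprMn h expr1n. Qed.

Lemma eq_mono (L : comNzRingType) (x : D -> L) c a b : {in c, a =1 b} -> mono x c a = mono x c b.
Proof. by move=> ab; apply: eq_big_seq => k kc; rewrite ab. Qed.

Section Monou.
Variables (L : comNzRingType) (kap : {rmorphism K -> L}) (x xi : D -> L) (c : seq D).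
Hypothesis xxi : forall k, x k * xi k = 1.
Lemma monou1 : monou kap x xi c 1.
Proof.
by exists 1, (fun=> 0%N), (fun=> 0%N); rewrite oner_eq0 !mono0 !mulr1 rmorph1.
Qed.
Lemma monouM u v : monou kap x xi c u -> monou kap x xi c v -> monou kap x xi c (u * v).
Proof.
move=> [l [a [b [l0 ->]]]] [l' [a' [b' [l0' ->]]]].
exists (l * l'), (fun k => (a k + a' k)%N), (fun k => (b k + b' k)%N); split.
  by rewrite mulf_neq0.
by rewrite -!monoD rmorphM mulrACA; congr (_ * _); rewrite mulrACA.
Qed.
Lemma monouV u : monou kap x xi c u -> exists2 v, monou kap x xi c v & u * v = 1.
Proof.
move=> [l [a [b [l0 ->]]]]; exists (kap l^-1 * mono x c b * mono xi c a).
  by exists l^-1, b, a; rewrite invr_eq0.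
rewrite mulrACA (mulrACA (kap l)) -rmorphM divff // rmorph1 mul1r.
by rewrite [mono xi c b * _]mulrC mulrACA !monoV // mulr1.
Qed.
End Monou.

(** [tw_indep] is the linear independence of the monomials for unsorted sums, in which exponent
    functions may repeat and count only on [c]. *)
Record tower_spec (c : seq D) (L : idomainType) (kap : {rmorphism K -> L}) (x xi : D -> L) : Prop :=
  TowerSpec {
  tw_inv : forall k, x k * xi k = 1;
  tw_gen : forall a, lgen kap x xi c a;
  tw_indep : forall p : seq (K * (D -> nat)), \sum_(z <- p) kap z.1 * mono x c z.2 = 0 ->
    forall al : D -> nat, \sum_(z <- p | all (fun k => z.2 k == al k) c) z.1 = 0;
  tw_ffr : FFR L;
  tw_KG : KGall (monou kap x xi c) }.

(** Induction on the variables: [FFR] and [KGall] pass together from a ring to its Laurent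
    extension. *)
Theorem laurent_tower (c : seq D) : uniq c ->
  exists (L : idomainType) (kap : {rmorphism K -> L}) (x xi : D -> L), tower_spec c kap x xi.
Proof.
elim: c => [|l c IH] /=.
  move=> _; exists K, [the {rmorphism K -> K} of idfun], (fun=> 1), (fun=> 1); split.
  - by move=> k; rewrite mulr1.
  - by move=> a; apply: (lg_c _ _ _ _ a).
  - move=> p H al; rewrite -[RHS]H; apply: eq_big => // z _.
    by rewrite /mono big_nil mulr1.
  - exact: FFR_field.
  - move=> n M N MN.
    have := KGall_field MN; rewrite -{2}(@map_mx_id _ _ _ idfun _ M) //.
    apply: (KG_map (i := [the {rmorphism K -> K} of idfun])).
    by move=> a a0; exists a, (fun=> 0%N), (fun=> 0%N); rewrite !mono0 !mulr1.
case/andP=> lc uc; have [L [kap [x [xi tw]]]] := IH uc.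
pose B := laurent L; pose iot := [the {rmorphism {poly L} -> B} of @tol L].
pose kap' := [the {rmorphism K -> B} of iot \o (polyC \o kap)].
pose ti : B := Laurent (tolVP L).
pose x' k : B := if k == l then iot 'X else iot (x k)%:P.
pose xi' k : B := if k == l then ti else iot (xi k)%:P.
have mx' a : mono x' (l :: c) a = iot ('X^(a l) * (mono x c a)%:P).
  rewrite /mono big_cons /x' eqxx rmorphM /= rmorphXn; congr (_ * _).
  rewrite (rmorph_prod polyC) rmorph_prod big_seq [RHS]big_seq; apply: eq_bigr => k kc.
  by rewrite (negPf (memPn lc _ kc)) !rmorphXn.
have mxi' a : mono xi' (l :: c) a = ti ^+ a l * iot (mono xi c a)%:P.
  rewrite /mono big_cons /xi' eqxx; congr (_ * _).
  rewrite (rmorph_prod polyC) rmorph_prod big_seq [RHS]big_seq; apply: eq_bigr => k kc.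
  by rewrite (negPf (memPn lc _ kc)) !rmorphXn.
have xxi' k : x' k * xi' k = 1.
  rewrite /x' /xi'; case: eqP => _; first exact: tolXV.
  by rewrite -rmorphM -polyCM (tw_inv tw) rmorph1.
exists B, kap', x', xi'; split=> //.
- have gC a : lgen kap' x' xi' (l :: c) (iot a%:P).
    elim: (tw_gen tw a) => [b|k kc|k kc|u v _ Hu _ Hv|u v _ Hu _ Hv].
    + exact: lg_c.
    + rewrite (_ : iot _ = x' k); first by apply: lg_x; rewrite inE kc orbT.
      by rewrite /x' (negPf (memPn lc _ kc)).
    + rewrite (_ : iot _ = xi' k); first by apply: lg_xi; rewrite inE kc orbT.
      by rewrite /xi' (negPf (memPn lc _ kc)).
    + by rewrite polyCD rmorphD; apply: lg_D.
    + by rewrite polyCM rmorphM; apply: lg_M.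
  have gX : lgen kap' x' xi' (l :: c) (iot 'X).
    by have := lg_x kap' x' xi' (mem_head l c); rewrite /x' eqxx.
  have gti : lgen kap' x' xi' (l :: c) ti.
    by have := lg_xi kap' x' xi' (mem_head l c); rewrite /xi' eqxx.
  have gP p : lgen kap' x' xi' (l :: c) (iot p).
    elim/poly_ind: p => [|p a IHp]; first exact: (gC 0).
    by rewrite rmorphD rmorphM; apply: lg_D => //; apply: lg_M.
  move=> b; have [k [p e]] := tol_clear b.
  have -> : b = ti ^+ k * iot p.
    by rewrite /iot /= -e mulrA -exprMn [ti * _]mulrC tolXV expr1n mul1r.
  apply: lg_M => //; elim: k {e} => [|k IHk]; first by rewrite expr0 -(rmorph1 kap'); apply: lg_c.
  by rewrite exprS; apply: lg_M.
- move=> p H al.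
  have {}H : \sum_(z <- p) (kap z.1 * mono x c z.2)%:P * 'X^(z.2 l) = 0.
    apply: (@tol_inj L); rewrite rmorph0 -[RHS]H rmorph_sum; apply: eq_bigr => z _.
    by rewrite mx' polyCM !rmorphM -mulrA; congr (_ * _); apply: mulrC.
  have {}H : \sum_(z <- [seq z <- p | z.2 l == al l]) kap z.1 * mono x c z.2 = 0.
    have /polyP/(_ (al l)) := H; rewrite coef_sum coef0 => e; rewrite -[RHS]e.
    rewrite big_filter big_mkcond; apply: eq_bigr => z _.
    by rewrite coefCM coefXn eq_sym; case: eqP; rewrite ?mulr1 ?mulr0.
  have := tw_indep tw H al; rewrite big_filter_cond => e; rewrite -[RHS]e.
  by apply: eq_bigl => z.
- apply: (@FFR_loc _ _ iot ti); [exact: tol_inj|exact: tolXV|exact: tol_clear|exact: tw_ffr tw].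
- apply: (@KGall_laurent _ _ iot (@tol_inj L) (@tol_clear L) (monou kap x xi c)).
  + exact: monou1.
  + by move=> ? ?; apply: monouM.
  + exists 1, (fun k => (k == l) : nat), (fun=> 0%N); rewrite oner_eq0 mono0 mulr1 rmorph1 mul1r.
    rewrite mx' eqxx expr1; split=> //.
    rewrite (@eq_mono _ _ _ _ (fun=> 0%N)) ?mono0 ?mulr1 // => k kc.
    by rewrite (negPf (memPn lc _ kc)).
  + move=> _ [u [a [b [u0 ->]]]].
    exists u, (fun k => if k == l then 0%N else a k), (fun k => if k == l then 0%N else b k).
    split=> //; rewrite mx' mxi' eqxx !expr0 !mul1r !polyCM !rmorphM; congr (_ * _ * _).
      by congr (iot (_%:P)); apply: eq_mono => k kc; rewrite (negPf (memPn lc _ kc)).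
    by congr (iot (_%:P)); apply: eq_mono => k kc; rewrite (negPf (memPn lc _ kc)).
  + exact: tw_ffr tw.
  + exact: tw_KG tw.
Qed.

End Tower.

(** * The operator algebra as a ring *)

Section SopRing.
Variables (K : fieldType) (n : nat).

Lemma opP (u v : op K n) : (forall f a, u f a = v f a) -> u = v.
Proof. by move=> uv; apply/funext => f; apply/funext => a. Qed.

Lemma sub_lin (I : pred 'I_n) u : subalg K n I u -> forall c f g a,
  u (fun b => c * f b + g b) a = c * u f a + u g a.
Proof.
elim=> {u} [c|k _|k _|u v _ Hu _ Hv|u v _ Hu _ Hv] d f g a.
- by rewrite /oscal /o1 mulrDr mulrCA.
- by rewrite /Xo; case: ifP => // _; rewrite mulr0 addr0.
- by [].
- by rewrite /oadd Hu Hv mulrDr addrACA.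
- rewrite /omul -Hu; congr (u _ a); apply/funext => b; exact: Hv.
Qed.

(** Bundling is what gives a ring: [u (v + w) = u v + u w] fails for arbitrary functions on [vec]
    and holds on the algebra, whose elements are linear. *)
Record Sop := MkS { sv : op K n; svP : Sn K n sv }.

Lemma Sop_inj (u v : Sop) : sv u = sv v -> u = v.
Proof. by case: u v => u hu [v hv] /= e; subst v; congr MkS; apply: Prop_irrelevance. Qed.

Lemma SopP (u v : Sop) : (forall f a, sv u f a = sv v f a) -> u = v.
Proof. by move=> uv; apply: Sop_inj; apply: opP. Qed.

Lemma sv_lin (u : Sop) c f g a : sv u (fun b => c * f b + g b) a = c * sv u f a + sv u g a.
Proof. exact: sub_lin (svP u) c f g a. Qed.

Lemma svD (u : Sop) f g a : sv u (fun b => f b + g b) a = sv u f a + sv u g a.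
Proof.
have := sv_lin u 1 f g a; rewrite mul1r => <-; congr (sv u _ a).
by apply/funext => b; rewrite mul1r.
Qed.

Lemma sv0 (u : Sop) a : sv u (fun=> 0) a = 0.
Proof.
have := sv_lin u 0 (fun=> 0) (fun=> 0) a; rewrite !mul0r !add0r => e.
by have := svD u (fun=> 0) (fun=> 0) a; rewrite addr0 => /eqP; rewrite -subr_eq subrr eq_sym => /eqP.
Qed.

Fact S0_sub : Sn K n (o0 K n).
Proof.
have -> : o0 K n = oscal K n 0 (o1 K n) by apply: opP => f a; rewrite /oscal mul0r.
exact: sa_scal.
Qed.
Fact S1_sub : Sn K n (o1 K n).
Proof.
have -> : o1 K n = oscal K n 1 (o1 K n) by apply: opP => f a; rewrite /oscal mul1r.
exact: sa_scal.
Qed.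
Lemma sub_opp (I : pred 'I_n) u : subalg K n I u -> subalg K n I (oopp K n u).
Proof.
move=> Iu; have -> : oopp K n u = omul K n (oscal K n (-1) (o1 K n)) u.
  by apply: opP => f a; rewrite /omul /oscal /oopp mulN1r.
by apply: sa_mul => //; apply: sa_scal.
Qed.

Definition Szero := MkS S0_sub.
Definition Sone := MkS S1_sub.
Definition Sadd (u v : Sop) := MkS (sa_add _ _ _ _ _ (svP u) (svP v)).
Definition Sopp (u : Sop) := MkS (sub_opp (svP u)).
Definition Smul (u v : Sop) := MkS (sa_mul _ _ _ _ _ (svP u) (svP v)).

HB.instance Definition _ := gen_eqMixin Sop.
HB.instance Definition _ := gen_choiceMixin Sop.
Fact SaddA : associative Sadd.
Proof. by move=> u v w; apply: SopP => f a; rewrite /= /oadd addrA. Qed.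
Fact SaddC : commutative Sadd.
Proof. by move=> u v; apply: SopP => f a; rewrite /= /oadd addrC. Qed.
Fact Sadd0 : left_id Szero Sadd.
Proof. by move=> u; apply: SopP => f a; rewrite /= /oadd add0r. Qed.
Fact SaddN : left_inverse Szero Sopp Sadd.
Proof. by move=> u; apply: SopP => f a; rewrite /= /oadd /oopp addNr. Qed.
HB.instance Definition _ := GRing.isZmodule.Build Sop SaddA SaddC Sadd0 SaddN.
Fact SmulA : associative Smul.
Proof. by move=> u v w; apply: SopP. Qed.
Fact Smul1 : left_id Sone Smul.
Proof. by move=> u; apply: SopP. Qed.
Fact Smulr1 : right_id Sone Smul.
Proof. by move=> u; apply: SopP. Qed.
Fact SmulDl : left_distributive Smul +%R.
Proof. by move=> u v w; apply: SopP. Qed.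
Fact SmulDr : right_distributive Smul +%R.
Proof. by move=> u v w; apply: SopP => f a; rewrite /= /omul /oadd -svD. Qed.
Fact Sone_neq0 : Sone != 0.
Proof.
apply/eqP => /(congr1 (fun u => sv u (fun=> 1) (fun=> 0%N))) /eqP.
by rewrite /= /o1 oner_eq0.
Qed.
HB.instance Definition _ := GRing.Zmodule_isNzRing.Build Sop SmulA Smul1 Smulr1 SmulDl SmulDr Sone_neq0.

Lemma svDE (u v : Sop) f a : sv (u + v) f a = sv u f a + sv v f a. Proof. by []. Qed.
Lemma svNE (u : Sop) f a : sv (- u) f a = - sv u f a. Proof. by []. Qed.
Lemma svBE (u v : Sop) f a : sv (u - v) f a = sv u f a - sv v f a. Proof. by []. Qed.
Lemma svME (u v : Sop) f : sv (u * v) f = sv u (sv v f). Proof. by []. Qed.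
Lemma sv1E f : sv 1 f = f. Proof. by []. Qed.
Lemma sv0E f a : sv 0 f a = 0. Proof. by []. Qed.
Lemma svsum (T : Type) (r : seq T) (P : pred T) (F : T -> Sop) f a :
  sv (\sum_(i <- r | P i) F i) f a = \sum_(i <- r | P i) sv (F i) f a.
Proof. by elim/big_rec2: _ => [//|i x y _ <-]. Qed.

Definition kS (c : K) : Sop := MkS (sa_scal K n predT c).
Definition X (k : 'I_n) : Sop := MkS (sa_X K n predT k isT).
Definition Y (k : 'I_n) : Sop := MkS (sa_Y K n predT k isT).
Definition Sin (P : pred 'I_n) (u : Sop) := subalg K n P (sv u).

Lemma Sin_ind (P : pred 'I_n) (Q : Sop -> Prop) :
  (forall c, Q (kS c)) -> (forall k, P k -> Q (X k)) -> (forall k, P k -> Q (Y k)) ->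
  (forall u v, Sin P u -> Sin P v -> Q u -> Q v -> Q (u + v)) ->
  (forall u v, Sin P u -> Sin P v -> Q u -> Q v -> Q (u * v)) -> forall u, Sin P u -> Q u.
Proof.
move=> Hc HX HY HD HM [u hu]; rewrite /Sin /= => Pu.
elim: Pu hu => {u} [c|k Pk|k Pk|u v Pu Hu Pv Hv|u v Pu Hu Pv Hv] h.
- by rewrite (_ : MkS h = kS c); [apply: Hc|apply: Sop_inj].
- by rewrite (_ : MkS h = X k); [apply: HX|apply: Sop_inj].
- by rewrite (_ : MkS h = Y k); [apply: HY|apply: Sop_inj].
- have sub w : subalg K n P w -> Sn K n w.
    by elim=> {w} *; [apply: sa_scal|apply: sa_X|apply: sa_Y|apply: sa_add|apply: sa_mul].
  rewrite (_ : MkS h = MkS (sub _ Pu) + MkS (sub _ Pv)); last exact: Sop_inj.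
  by apply: HD.
- have sub w : subalg K n P w -> Sn K n w.
    by elim=> {w} *; [apply: sa_scal|apply: sa_X|apply: sa_Y|apply: sa_add|apply: sa_mul].
  rewrite (_ : MkS h = MkS (sub _ Pu) * MkS (sub _ Pv)); last exact: Sop_inj.
  by apply: HM.
Qed.

Lemma Sin_T u : Sin predT u. Proof. exact: svP. Qed.
Lemma Sin_c P c : Sin P (kS c). Proof. exact: sa_scal. Qed.
Lemma Sin_X (P : pred 'I_n) k : P k -> Sin P (X k). Proof. exact: sa_X. Qed.
Lemma Sin_Y (P : pred 'I_n) k : P k -> Sin P (Y k). Proof. exact: sa_Y. Qed.
Lemma Sin_D P u v : Sin P u -> Sin P v -> Sin P (u + v). Proof. exact: sa_add. Qed.
Lemma Sin_M P u v : Sin P u -> Sin P v -> Sin P (u * v). Proof. exact: sa_mul. Qed.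
Lemma Sin_N P u : Sin P u -> Sin P (- u). Proof. exact: sub_opp. Qed.
Lemma Sin_B P u v : Sin P u -> Sin P v -> Sin P (u - v).
Proof. by move=> ? ?; apply: Sin_D => //; apply: Sin_N. Qed.
Lemma kS0 : kS 0 = 0. Proof. by apply: SopP => f a; rewrite /= /oscal mul0r. Qed.
Lemma kS1 : kS 1 = 1. Proof. by apply: SopP => f a; rewrite /= /oscal mul1r. Qed.
Lemma kSE c f a : sv (kS c) f a = c * f a. Proof. by []. Qed.
Lemma kSM c d : kS c * kS d = kS (c * d).
Proof. by apply: SopP => f a; rewrite svME !kSE mulrA. Qed.
Lemma kSD c d : kS c + kS d = kS (c + d).
Proof. by apply: SopP => f a; rewrite svDE !kSE mulrDl. Qed.
Lemma kSC c u : kS c * u = u * kS c.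
Proof.
apply: SopP => f a; rewrite !svME kSE.
have := sv_lin u c f (fun=> 0) a; rewrite sv0 addr0 => <-; congr (sv u _ a).
by apply/funext => b; rewrite addr0.
Qed.
Lemma Sin_1 P : Sin P 1. Proof. by rewrite -kS1; apply: Sin_c. Qed.
Lemma Sin_0 P : Sin P 0. Proof. by rewrite -kS0; apply: Sin_c. Qed.
Lemma Sin_exp P u m : Sin P u -> Sin P (u ^+ m).
Proof.
by move=> Pu; elim: m => [|m IH]; [rewrite expr0; apply: Sin_1|rewrite exprS; apply: Sin_M].
Qed.
Lemma Sin_sum P (T : Type) (r : seq T) (Q : pred T) (F : T -> Sop) :
  (forall i, Q i -> Sin P (F i)) -> Sin P (\sum_(i <- r | Q i) F i).
Proof. by move=> H; elim/big_ind: _ => //; [apply: Sin_0|apply: Sin_D]. Qed.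
Lemma Sin_prod P (T : eqType) (r : seq T) (F : T -> Sop) :
  (forall i, i \in r -> Sin P (F i)) -> Sin P (\prod_(i <- r) F i).
Proof.
by move=> H; rewrite big_seq; elim/big_ind: _ => //; [apply: Sin_1|apply: Sin_M].
Qed.
Lemma Sin_sub (P Q : pred 'I_n) u : (forall k, P k -> Q k) -> Sin P u -> Sin Q u.
Proof.
move=> PQ; elim/Sin_ind => [c|k /PQ|k /PQ|? ? _ _|? ? _ _]; [exact: Sin_c|exact: Sin_X|exact: Sin_Y|exact: Sin_D|exact: Sin_M].
Qed.

Lemma XE k f a : sv (X k) f a = if (0 < a k)%N then f (fun j => if j == k then (a j).-1 else a j) else 0.
Proof.
rewrite /= /Xo; have -> : posc n k a = (0 < a k)%N.
  apply/existsP/idP => [[j /andP [/eqP jk]]|ak]; first by rewrite (val_inj jk).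
  by exists k; rewrite eqxx.
by case: ifP => // _; congr (f _).
Qed.
Lemma YE k f a : sv (Y k) f a = f (fun j => if j == k then (a j).+1 else a j).
Proof. by []. Qed.

Lemma XnE k m f a : sv (X k ^+ m) f a =
  if (m <= a k)%N then f (fun j => if j == k then (a j - m)%N else a j) else 0.
Proof.
elim: m a => [|m IH] a.
  by rewrite expr0 sv1E leq0n; congr (f _); apply/funext => j; case: eqP; rewrite ?subn0.
rewrite exprS svME XE; case: ltnP => ak; last by rewrite ltnNge (leq_trans ak).
rewrite IH eqxx (_ : (m <= (a k).-1)%N = (m < a k)%N); last lia.
case: ifP => // _; congr (f _); apply/funext => j; case: eqP => // _; lia.
Qed.
Lemma YnE k m f a : sv (Y k ^+ m) f a = f (fun j => if j == k then (a j + m)%N else a j).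
Proof.
elim: m a => [|m IH] a.
  by rewrite expr0 sv1E; congr (f _); apply/funext => j; case: eqP; rewrite ?addn0.
rewrite exprS svME YE IH; congr (f _); apply/funext => j; case: eqP => // _; lia.
Qed.

Definition XX (g : 'I_n -> nat) : Sop := \prod_(k <- enum 'I_n) X k ^+ g k.
Definition YY (g : 'I_n -> nat) : Sop := \prod_(k <- enum 'I_n) Y k ^+ g k.

Lemma XX_E g f a : sv (XX g) f a =
  if [forall k, (g k <= a k)%N] then f (fun k => (a k - g k)%N) else 0.
Proof.
have H s : uniq s -> forall a, sv (\prod_(k <- s) X k ^+ g k) f a =
    if all (fun k => (g k <= a k)%N) s then f (fun k => if k \in s then (a k - g k)%N else a k) else 0.
  elim: s => [_|k s IH /= /andP [ks us]] b; first by rewrite big_nil.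
  rewrite big_cons svME XnE; case: ifP => //= gk; rewrite IH //.
  rewrite (_ : all _ s = all (fun k0 => (g k0 <= b k0)%N) s); last first.
    by apply: eq_in_all => j js; rewrite (negPf (memPn ks _ js)).
  case: ifP => // _; congr (f _); apply/funext => j; rewrite inE.
  by case: (eqVneq j k) => [->|] //=; rewrite (negPf ks).
rewrite H ?enum_uniq //.
rewrite (_ : all _ _ = [forall k, (g k <= a k)%N]); last first.
  by apply/allP/forallP => h k; [apply: h; rewrite mem_enum|rewrite mem_enum => _; apply: h].
by case: ifP => // _; congr (f _); apply/funext => j; rewrite mem_enum.
Qed.
Lemma YY_E g f a : sv (YY g) f a = f (fun k => (a k + g k)%N).
Proof.
have H s : uniq s -> forall a, sv (\prod_(k <- s) Y k ^+ g k) f a =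
    f (fun k => if k \in s then (a k + g k)%N else a k).
  elim: s => [_|k s IH /= /andP [ks us]] b; first by rewrite big_nil.
  rewrite big_cons svME YnE IH //; congr (f _); apply/funext => j; rewrite inE.
  by case: (eqVneq j k) => [->|] //=; rewrite (negPf ks).
by rewrite H ?enum_uniq //; congr (f _); apply/funext => j; rewrite mem_enum.
Qed.

Lemma XX_in (P : pred 'I_n) g : (forall k, ~~ P k -> g k = 0%N) -> Sin P (XX g).
Proof.
move=> g0; apply: Sin_prod => k _; case: (boolP (P k)) => Pk; first by apply/Sin_exp/Sin_X.
by rewrite g0 // expr0; apply: Sin_1.
Qed.
Lemma YY_in (P : pred 'I_n) g : (forall k, ~~ P k -> g k = 0%N) -> Sin P (YY g).
Proof.
move=> g0; apply: Sin_prod => k _; case: (boolP (P k)) => Pk; first by apply/Sin_exp/Sin_Y.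
by rewrite g0 // expr0; apply: Sin_1.
Qed.

Lemma XXD g h : XX g * XX h = XX (fun k => (g k + h k)%N).
Proof.
apply: SopP => f a; rewrite svME !XX_E.
case: (boolP [forall k, (g k <= a k)%N]) => /forallP ga.
  rewrite (_ : [forall k, _] = [forall k, (g k + h k <= a k)%N]).
    by case: ifP => // _; congr (f _); apply/funext => k; rewrite subnDA.
  by apply: eq_forallb => k; have := ga k; lia.
case: ifP => // /forallP gh; case: ga => k; have := gh k; lia.
Qed.
Lemma YYXX g : YY g * XX g = 1.
Proof.
apply: SopP => f a; rewrite svME YY_E XX_E sv1E.
rewrite (_ : [forall k, _] = true); last by apply/forallP => k; lia.
by congr (f _); apply/funext => k; rewrite addnK.
Qed.
Lemma XX0 : XX (fun=> 0%N) = 1.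
Proof. by rewrite /XX big1. Qed.
Lemma YY0 : YY (fun=> 0%N) = 1.
Proof. by rewrite /YY big1. Qed.

Definition del (k j : 'I_n) : nat := (j == k).
Lemma XX_del k : XX (del k) = X k.
Proof.
apply: SopP => f a; rewrite XX_E XE (_ : [forall j, _] = (0 < a k)%N).
  by case: ifP => // _; congr (f _); apply/funext => j; rewrite /del; case: eqP => _ /=; lia.
apply/forallP/idP => [/(_ k)|ak j]; rewrite /del ?eqxx //; case: eqP => // ->; lia.
Qed.
Lemma YY_del k : YY (del k) = Y k.
Proof.
apply: SopP => f a; rewrite YY_E YE; congr (f _); apply/funext => j; rewrite /del.
by case: eqP => _ /=; lia.
Qed.

Lemma eq_XX g h : g =1 h -> XX g = XX h. Proof. by move=> /funext ->. Qed.

Lemma Sin_comm (P Q : pred 'I_n) u v : (forall k, P k -> Q k -> False) ->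
  Sin P u -> Sin Q v -> u * v = v * u.
Proof.
move=> PQ; have XYc k j : P k -> Q j -> [/\ X k * X j = X j * X k, X k * Y j = Y j * X k,
   Y k * X j = X j * Y k & Y k * Y j = Y j * Y k].
  move=> Pk Qj; have jk : j != k by apply/eqP => e; apply: (PQ k); rewrite // -e.
  have kj : k != j by rewrite eq_sym.
  split; apply: SopP => f a; rewrite !svME ?XE ?YE ?XE ?YE ?(negPf jk) ?(negPf kj).
  - case: ifP => ak; case: ifP => aj //; congr (f _); apply/funext => i.
    by case: (eqVneq i j) => [->|]; rewrite ?(negPf jk).
  - case: ifP => // ak; congr (f _); apply/funext => i.
    by case: (eqVneq i j) => [->|]; rewrite ?(negPf jk).
  - case: ifP => // ak; congr (f _); apply/funext => i.
    by case: (eqVneq i j) => [->|]; rewrite ?(negPf jk).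
  - congr (f _); apply/funext => i.
    by case: (eqVneq i j) => [->|]; rewrite ?(negPf jk).
have gen k w : P k -> Sin Q w -> X k * w = w * X k /\ Y k * w = w * Y k.
  move=> Pk; elim/Sin_ind => [c|j Qj|j Qj|w1 w2 _ _ [h1 h2] [h3 h4]|w1 w2 _ _ [h1 h2] [h3 h4]].
  - by rewrite !kSC.
  - by have [] := XYc k j Pk Qj.
  - by have [] := XYc k j Pk Qj.
  - by rewrite !mulrDr !mulrDl h1 h2 h3 h4.
  - by rewrite !mulrA h1 h2 -!mulrA h3 h4.
move=> Pu Qv; elim/Sin_ind: u / Pu => [c|k Pk|k Pk|w1 w2 _ _ h1 h2|w1 w2 _ _ h1 h2].
- exact: kSC.
- by have [] := gen k v Pk Qv.
- by have [] := gen k v Pk Qv.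
- by rewrite mulrDl mulrDr h1 h2.
- by rewrite -mulrA h2 mulrA h1 mulrA.
Qed.

End SopRing.

(** * The ideals [Z A] and the ideals of the theorem *)

Section Ideals.
Variables (K : fieldType) (n : nat).
Local Notation Sop := (Sop K n).
Local Notation X := (X K (n := n)).
Local Notation Y := (Y K (n := n)).
Local Notation XX := (XX K (n := n)).
Local Notation YY := (YY K (n := n)).
Implicit Types (I J A B : {set 'I_n}) (al be ga : 'I_n -> nat) (u v w : Sop).

Lemma sv_exp u m : sv (u ^+ m) = oexp K n (sv u) m.
Proof. by elim: m => [|m IH]; rewrite ?expr0 // exprS /= -IH. Qed.

Lemma sv_prod (T : Type) (s : seq T) (F : T -> Sop) :
  sv (\prod_(k <- s) F k) = oprod K n [seq sv (F k) | k <- s].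
Proof. by elim: s => [|k s IH]; rewrite ?big_nil // big_cons /= -IH. Qed.

Definition E1 (s t : nat) (k : 'I_n) : Sop := X k ^+ s * Y k ^+ t - X k ^+ s.+1 * Y k ^+ t.+1.
Definition EE al be I : Sop := \prod_(k <- enum I) E1 (al k) (be k) k.
Definition e_ I : Sop := EE (fun=> 0%N) (fun=> 0%N) I.

Lemma sv_E1 s t k : sv (E1 s t k) = Est K n s t k.
Proof. by rewrite /Est -[Xo K n k]/(sv (X k)) -[Yo K n k]/(sv (Y k)) -!sv_exp. Qed.
Lemma sv_EE al be I : sv (EE al be I) = EI K n al be I.
Proof. by rewrite sv_prod /EI; congr oprod; apply: eq_map => k; rewrite sv_E1. Qed.
Lemma sv_e I : sv (e_ I) = eI K n I.
Proof. by rewrite sv_EE. Qed.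

Lemma E1E s t k f a : sv (E1 s t k) f a =
  if a k == s then f (fun j => if j == k then t else a j) else 0.
Proof.
rewrite svBE !svME !XnE !YnE.
case: (ltngtP (a k) s) => as_; first by rewrite subrr.
  apply/eqP; rewrite subr_eq0; apply/eqP; congr (f _); apply/funext => j.
  by case: (eqVneq j k) => // ->; lia.
by rewrite subr0; congr (f _); apply/funext => j; case: (eqVneq j k) => // ->; lia.
Qed.

Lemma EEE al be I f a : sv (EE al be I) f a =
  if [forall k in I, a k == al k] then f (fun k => if k \in I then be k else a k) else 0.
Proof.
have H s : uniq s -> forall a, sv (\prod_(k <- s) E1 (al k) (be k) k) f a =
    if all (fun k => a k == al k) s then f (fun k => if k \in s then be k else a k) else 0.
  elim: s => [_|k s IH /= /andP [ks us]] b; first by rewrite big_nil.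
  rewrite big_cons svME E1E; case: ifP => //= bk; rewrite IH //.
  rewrite (_ : all _ s = all (fun k0 => b k0 == al k0) s); last first.
    by apply: eq_in_all => j js; rewrite (negPf (memPn ks _ js)).
  case: ifP => // _; congr (f _); apply/funext => j; rewrite inE.
  by case: (eqVneq j k) => [->|] //=; rewrite (negPf ks).
rewrite H ?enum_uniq //.
rewrite (_ : all _ _ = [forall k in I, a k == al k]); last first.
  apply/allP/forall_inP => h k; [by move=> kI; apply: h; rewrite mem_enum|by rewrite mem_enum; apply: h].
by case: ifP => // _; congr (f _); apply/funext => j; rewrite mem_enum.
Qed.

Lemma E1_in (P : pred 'I_n) s t k : P k -> Sin P (E1 s t k).
Proof.
by move=> Pk; apply: Sin_B; apply: Sin_M; apply: Sin_exp; [apply: Sin_X|apply: Sin_Y|apply: Sin_X|apply: Sin_Y].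
Qed.
Lemma EE_in al be I : Sin (fun k => k \in I) (EE al be I).
Proof. by apply: Sin_prod => k; rewrite mem_enum; apply: E1_in. Qed.

Lemma EE_comm al be I u : Sin (fun k => k \notin I) u -> u * EE al be I = EE al be I * u.
Proof. by move=> hu; apply: Sin_comm hu (EE_in al be I) => k /negP. Qed.

Lemma EEM al be ga de I : EE al be I * EE ga de I =
  if [forall k in I, be k == ga k] then EE al de I else 0.
Proof.
apply: SopP => f a; rewrite svME EEE.
case: (boolP [forall k in I, a k == al k]) => ha; last first.
  by case: ifP => _; rewrite ?EEE ?(negPf ha).
rewrite EEE (_ : [forall k in I, _] = [forall k in I, be k == ga k]); last first.
  by apply: eq_forallb => k; case: (boolP (k \in I)).
case: ifP => _ //; rewrite EEE ha; congr (f _); apply/funext => k.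
by case: (k \in I).
Qed.

Lemma e_id I : e_ I * e_ I = e_ I.
Proof. by rewrite EEM; case: ifP => // /negbT /forall_inPn [k _]; rewrite eqxx. Qed.

Lemma e_E I f a : sv (e_ I) f a =
  if [forall k in I, a k == 0%N] then f a else 0.
Proof.
rewrite EEE; case: ifP => // /forall_inP h; congr (f _); apply/funext => k.
by case: ifP => // /h /eqP.
Qed.

Lemma e_U I J : e_ I * e_ J = e_ (I :|: J).
Proof.
apply: SopP => f a; rewrite svME !e_E.
have -> : [forall k in I :|: J, a k == 0%N] =
   [forall k in I, a k == 0%N] && [forall k in J, a k == 0%N].
  apply/forall_inP/andP => [h|[/forall_inP h1 /forall_inP h2] k].
    by split; apply/forall_inP => k kI; apply: h; rewrite inE kI ?orbT.
  by rewrite inE => /orP []; [apply: h1|apply: h2].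
by case: [forall k in I, _].
Qed.

Definition cst A (N : nat) : 'I_n -> nat := fun k => if k \in A then 0%N else N.
(** The kernel of making [x_k] invertible for all [k] outside [A]. For the full set the monomial is
    1, so that [Z setT v] means [v = 0]. *)
Definition Z A v := exists N, v * XX (cst A N) = 0.

Lemma XX_sub g h : (forall k, (g k <= h k)%N) -> XX h = XX g * XX (fun k => (h k - g k)%N).
Proof. by move=> gh; rewrite XXD; apply: eq_XX => k; rewrite subnKC. Qed.

Lemma Z_up A N M v : v * XX (cst A N) = 0 -> (N <= M)%N -> v * XX (cst A M) = 0.
Proof.
move=> h NM; rewrite (@XX_sub (cst A N)); first by rewrite mulrA h mul0r.
by move=> k; rewrite /cst; case: ifP.
Qed.

Lemma Z0 A : Z A 0. Proof. by exists 0%N; rewrite mul0r. Qed.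
Lemma ZD A u v : Z A u -> Z A v -> Z A (u + v).
Proof.
move=> [N hu] [M hv]; exists (maxn N M).
by rewrite mulrDl (Z_up hu) ?leq_maxl // (Z_up hv) ?leq_maxr // addr0.
Qed.
Lemma ZN A u : Z A u -> Z A (- u).
Proof. by move=> [N hu]; exists N; rewrite mulNr hu oppr0. Qed.
Lemma ZB A u v : Z A u -> Z A v -> Z A (u - v).
Proof. by move=> ? ?; apply: ZD => //; apply: ZN. Qed.
Lemma ZMl A u v : Z A v -> Z A (u * v).
Proof. by move=> [N hv]; exists N; rewrite -mulrA hv mulr0. Qed.

Lemma Y_XX k g : (0 < g k)%N -> Y k * XX g = XX (fun j => (g j - del k j)%N).
Proof.
move=> gk; rewrite (@XX_sub (del k) g).
  by rewrite mulrA -YY_del YYXX mul1r.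
by move=> j; rewrite /del; case: eqP => // ->.
Qed.

(** An Ore condition, which makes [Z A] two-sided: moving [u] past a power of the [x_k] costs at
    most a larger power, and among the generators only [Y k] with [k] outside [A] needs one. *)
Lemma Z_shift A u N : exists M u', u * XX (cst A M) = XX (cst A N) * u'.
Proof.
move: N; elim/Sin_ind: u / (Sin_T u) => [c|k _|k _|u v _ _ hu hv|u v _ _ hu hv] N.
- by exists N, (kS n c); rewrite kSC.
- by exists N, (X k); rewrite -XX_del !XXD; apply: eq_XX => j; rewrite addnC.
- case: (boolP (k \in A)) => kA.
    exists N, (Y k); apply: (@Sin_comm _ _ (fun j => j \in A) (fun j => j \notin A)).
    + by move=> j jA /negP.
    + exact: Sin_Y.
    + by apply: XX_in => j; rewrite negbK /cst => ->.
  exists N.+1, (XX (fun j => (cst A 1 j - del k j)%N)).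
  rewrite Y_XX ?XXD; last by rewrite /cst (negPf kA).
  apply: eq_XX => j; rewrite /cst /del; case: (boolP (j \in A)) => jA //.
  by case: eqP => _ /=; lia.
- have [M [u' hu']] := hu N; have [M' [v' hv']] := hv N.
  exists (maxn M M'), (u' * XX (fun k => (cst A (maxn M M') k - cst A M k)%N) +
     v' * XX (fun k => (cst A (maxn M M') k - cst A M' k)%N)).
  rewrite mulrDr !mulrA -hu' -hv' -!mulrA -!XX_sub -?mulrDl //.
    by move=> k; rewrite /cst; case: ifP => // _; rewrite leq_maxr.
  by move=> k; rewrite /cst; case: ifP => // _; rewrite leq_maxl.
- have [M [u' hu']] := hu N; have [M' [v' hv']] := hv M.
  by exists M', (u' * v'); rewrite -mulrA hv' mulrA hu' mulrA.
Qed.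

Lemma ZMr A u v : Z A u -> Z A (u * v).
Proof.
move=> [N hu]; have [M [v' hv]] := Z_shift A v N.
by exists M; rewrite -mulrA hv mulrA hu mul0r.
Qed.

Lemma Zsum A (T : Type) (r : seq T) (Q : pred T) (F : T -> Sop) :
  (forall i, Q i -> Z A (F i)) -> Z A (\sum_(i <- r | Q i) F i).
Proof. by move=> H; elim/big_ind: _ => //; [apply: Z0|apply: ZD]. Qed.

Lemma Z_sub A B v : A \subset B -> Z B v -> Z A v.
Proof.
move=> AB [N hv]; exists N; rewrite (@XX_sub (cst B N)); first by rewrite mulrA hv mul0r.
by move=> k; rewrite /cst; case: (boolP (k \in A)) => [/(subsetP AB) ->|_] //; case: ifP.
Qed.

Lemma Z_EE A al be I : ~~ (I \subset A) -> Z A (EE al be I).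
Proof.
case/subsetPn => k kI kA; exists (be k).+1; apply: SopP => f a.
rewrite svME EEE; case: ifP => // _; rewrite XX_E; case: forallP => // /(_ k).
by rewrite /cst (negPf kA) kI ltnn.
Qed.

Definition ep A N : Sop := \prod_(k <- enum A) (1 - X k ^+ N * Y k ^+ N).
Definition pp A N : Sop := XX (cst A N) * YY (cst A N).

Lemma epE A N f a : sv (ep A N) f a = if [forall k in A, (a k < N)%N] then f a else 0.
Proof.
have H s : sv (\prod_(k <- s) (1 - X k ^+ N * Y k ^+ N)) f a =
    if all (fun k => (a k < N)%N) s then f a else 0.
  elim: s => [|k s IH /=]; first by rewrite big_nil.
  rewrite big_cons svME svBE svME XnE YnE sv1E /= IH ltnNge; case: (leqP N (a k)) => Na /=; last by rewrite subr0.
  rewrite (_ : (fun j => _) = a) ?IH ?subrr //; apply/funext => j; case: eqP => // ->.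
  by rewrite subnK.
rewrite H (_ : all _ _ = [forall k in A, (a k < N)%N]) //.
apply/allP/forall_inP => h k; [by move=> kI; apply: h; rewrite mem_enum|by rewrite mem_enum; apply: h].
Qed.

Lemma ppE A N f a : sv (pp A N) f a = if [forall k, (k \in A) || (N <= a k)%N] then f a else 0.
Proof.
rewrite svME XX_E YY_E.
rewrite (_ : [forall k, (cst A N k <= a k)%N] = [forall k, (k \in A) || (N <= a k)%N]); last first.
  by apply: eq_forallb => k; rewrite /cst; case: ifP.
case: ifP => // /forallP h; congr (f _); apply/funext => k.
by have := h k; rewrite /cst; case: ifP => //= _; lia.
Qed.

(** A partition of [N^n] by the set [A] of the coordinates below [N]: [ep A N] imposes the condition
    inside [A], and [pp A N] imposes it outside. *)
Lemma region_sum N : 1 = \sum_(A : {set 'I_n}) pp A N * ep A N :> Sop.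
Proof.
apply: SopP => f a; rewrite svsum sv1E.
rewrite (bigD1 [set k | (a k < N)%N]) // svME ppE epE.
rewrite (_ : [forall k, _] = true); last by apply/forallP => k; rewrite inE; lia.
rewrite (_ : [forall k in _, _] = true); last by apply/forall_inP => k; rewrite inE.
rewrite big1 => [|A /andP [_ nA]]; first by rewrite /= addr0.
rewrite svME ppE epE.
case: forallP => // h1; case: forall_inP => // h2; case/eqP: nA; apply/setP => k.
rewrite inE; case: (boolP (k \in A)) => kA; first by rewrite h2.
by have := h1 k; rewrite (negPf kA) /= leqNgt => /negPf ->.
Qed.

Lemma Zunif w : exists N, forall A, Z A w -> w * XX (cst A N) = 0.
Proof.
have H A : exists N, Z A w -> w * XX (cst A N) = 0.
  by have [[N hN]|nz] := pselect (Z A w); [exists N|exists 0%N].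
have [N hN] := @choice _ _ _ H; exists (\max_A N A)%N => A ZA.
exact: Z_up (hN A ZA) (leq_bigmax A).
Qed.

(** For large [N] the terms of [region_sum] with [Z A w] are killed by [w]. An intersection of
    ideals [Z A] is thus compared with a given ideal on the projections [ep A N] alone. *)
Lemma expand_Z (Q : Sop -> Prop) w : Q 0 -> (forall u v, Q u -> Q v -> Q (u + v)) ->
  (forall A N u, ~ Z A w -> Q (u * ep A N)) -> Q w.
Proof.
move=> Q0 QD QA; have [N hN] := Zunif w.
rewrite -[w]mulr1 (region_sum N) mulr_sumr; apply: big_ind => // A _.
have [ZA|nz] := pselect (Z A w); last by rewrite mulrA; apply: QA.
by rewrite /pp !mulrA hN // !mul0r.
Qed.

Lemma ep_split A B N : A \subset B -> ep B N = ep A N * ep (B :\: A) N.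
Proof.
move=> AB; apply: SopP => f a; rewrite svME !epE.
have -> : [forall k in B, (a k < N)%N] =
   [forall k in A, (a k < N)%N] && [forall k in B :\: A, (a k < N)%N].
  apply/forall_inP/andP => [h|[/forall_inP h1 /forall_inP h2] k kB].
    split; apply/forall_inP => k; first by move/(subsetP AB)/h.
    by rewrite inE => /andP [_ /h].
  by case: (boolP (k \in A)) => kA; [apply: h1|apply: h2; rewrite inE kA].
by case: [forall k in A, _].
Qed.

(** A telescoping sum with terms [x^N e y^N]. *)
Lemma unit_ideal_gen (k : 'I_n) N : pid K n k (sv (1 - X k ^+ N * Y k ^+ N)).
Proof.
elim: N => [|N IH]; first by rewrite !expr0 mulr1 subrr; apply: ig0.
have -> : 1 - X k ^+ N.+1 * Y k ^+ N.+1 = (1 - X k ^+ N * Y k ^+ N) + X k ^+ N * (E1 0 0 k * Y k ^+ N).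
  rewrite /E1 !expr0 !expr1 mulr1 mulrBl mulrBr mul1r addrA subrK.
  by rewrite exprSr exprS !mulrA.
apply: igadd => //; apply: igg; [exact: svP|by rewrite sv_E1|exact: svP].
Qed.

Lemma ep_pI A N : pI K n A (sv (ep A N)).
Proof.
rewrite /pI /ep; elim: (enum A) => [|k s IH]; first by rewrite big_nil; apply: svP.
rewrite big_cons.
have -> : sv ((1 - X k ^+ N * Y k ^+ N) * \prod_(j <- s) (1 - X j ^+ N * Y j ^+ N)) =
   omul K n (o1 K n) (omul K n (sv ((1 - X k ^+ N * Y k ^+ N) * \prod_(j <- s) (1 - X j ^+ N * Y j ^+ N))) (o1 K n)) by [].
apply: igg; [exact: S1_sub| |exact: S1_sub].
by do 2 eexists; split; [exact: unit_ideal_gen|split; [exact: IH|]].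
Qed.

(** [Z A] for bare operators, because the ideals of the statement are predicates on [op]. *)
Definition ZO A (v : op K n) := exists2 w : Sop, sv w = v & Z A w.

Lemma SnO (v : op K n) : Sn K n v -> exists w : Sop, sv w = v.
Proof. by move=> h; exists (MkS h). Qed.

Lemma ideal_ZO (P G : op K n -> Prop) A (v : op K n) : (forall a, P a -> Sn K n a) ->
  (forall g, G g -> ZO A g) -> idealgen K n P G v -> ZO A v.
Proof.
move=> PS GZ; elim=> {v} [|a g b /PS /SnO [a' <-] /GZ [g' <- Zg] /PS /SnO [b' <-]|u v _ [u' <- Zu] _ [v' <- Zv]].
- by exists 0 => //; apply: Z0.
- by exists (a' * (g' * b')) => //; apply/ZMl/ZMr.
- by exists (u' + v') => //; apply: ZD.
Qed.

Lemma ZO_Sn A (v : op K n) : ZO A v -> Sn K n v. Proof. by case=> w <- _; apply: svP. Qed.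

Lemma pid_ZO A (k : 'I_n) (v : op K n) : k \notin A -> pid K n k v -> ZO A v.
Proof.
move=> kA; apply: ideal_ZO => // _ ->; exists (E1 0 0 k); first by rewrite sv_E1.
have := @Z_EE A (fun=> 0%N) (fun=> 0%N) [set k]; rewrite /EE enum_set1 big_seq1; apply.
by rewrite sub1set.
Qed.

Lemma pid_Sn (k : 'I_n) (v : op K n) : pid K n k v -> Sn K n v.
Proof. by move/(@pid_ZO set0); rewrite inE => /(_ isT) /ZO_Sn. Qed.

Lemma idealmul_ZO A (P Q : op K n -> Prop) (v : op K n) :
  (forall a, P a -> Sn K n a) -> (forall b, Q b -> Sn K n b) ->
  (forall a, P a -> ZO A a) \/ (forall b, Q b -> ZO A b) -> idealmul K n P Q v -> ZO A v.
Proof.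
move=> PS QS H; apply: ideal_ZO => // g [a [b [Pa [Qb ->]]]].
case: H => H; [have [a' ea Za] := H _ Pa; have [b' eb] := SnO (QS _ Qb)
             | have [b' eb Zb] := H _ Qb; have [a' ea] := SnO (PS _ Pa)];
  exists (a' * b'); rewrite /= ?ea ?eb //; [exact: ZMr|exact: ZMl].
Qed.

Lemma ideal_Sn (P G : op K n -> Prop) (v : op K n) : (forall a, P a -> Sn K n a) ->
  (forall g, G g -> Sn K n g) -> idealgen K n P G v -> Sn K n v.
Proof.
move=> PS GS; elim=> {v} [|a g b /PS ha /GS hg /PS hb|u v _ hu _ hv]; first exact: S0_sub.
  by do 2!apply: sa_mul => //.
exact: sa_add.
Qed.

Lemma pI_ZO A I (v : op K n) : ~~ (I \subset A) -> pI K n I v -> ZO A v.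
Proof.
case/subsetPn => k; rewrite -mem_enum /pI => kI kA.
have Ss (s : seq 'I_n) (v' : op K n) : foldr (idealmul K n) (Sn K n) [seq pid K n (nat_of_ord k) | k <- s] v' -> Sn K n v'.
  elim: s v' => [|j s IH] v' //=; apply: ideal_Sn => // g [a [b [ha [hb ->]]]].
  by apply: sa_mul; [apply: pid_Sn ha|apply: IH].
elim: (enum I) kI v => [|j s IH] //; rewrite inE => /orP [/eqP <-|ks] v /=.
  apply: idealmul_ZO; [exact: pid_Sn|exact: Ss|by left => a; apply: pid_ZO].
by apply: idealmul_ZO; [exact: pid_Sn|exact: Ss|right; apply: IH].
Qed.

Lemma ZO_Z A w : ZO A (sv w) -> Z A w.
Proof. by case=> w' /Sop_inj ->. Qed.

(** If [Z A w] fails, then [A] contains some [I] of size [s], and [ep A N] has the factor [ep I N],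
    which lies in [p_I]. *)
Lemma ansP s w : ans K n s (sv w) <-> forall A, (#|A| < s)%N -> Z A w.
Proof.
split=> [H A As|H].
  apply: ZO_Z; apply: ideal_ZO H => // g [I [Is /pI_ZO]]; apply.
  by apply: contraL As => /subset_leq_card; rewrite Is -leqNgt.
apply: (@expand_Z (fun u => ans K n s (sv u)) w) => [|u v|A N u nZ]; first exact: ig0.
  exact: igadd.
have sA : (s <= #|A|)%N by rewrite leqNgt; apply/negP => /H.
have [I IA Is] : exists2 I : {set 'I_n}, I \subset A & #|I| = s.
  have /subsetP sub : [set k in take s (enum A)] \subset A.
    by apply/subsetP => k; rewrite inE => /mem_take; rewrite mem_enum.
  exists [set k in take s (enum A)]; first exact/subsetP.
  rewrite cardsE (card_uniqP _) ?take_uniq ?enum_uniq // size_take -cardE.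
  by case: ltngtP sA => // -> _.
rewrite (ep_split N IA); apply: igg; [exact: svP| |exact: svP].
by exists I; split=> //; apply: ep_pI.
Qed.

End Ideals.

Section Abelian.
Variable V : zmodType.
Implicit Types a b p q : V.
Lemma abel1 a b p q : a + b + (p - (q + b)) - a = p - q.
Proof. by rewrite addrAC [a + b]addrC addrK opprD addrC addrA subrK. Qed.
Lemma abel3 a b p q : a + b + (p + q) - a = p + b + q.
Proof. by rewrite addrAC [a + b]addrC addrK addrA [b + p]addrC. Qed.
Lemma abel4 a b p q : a = a + b + (p + q) -> p + b + q = 0.
Proof.
move=> e; apply: (addrI a); rewrite addr0 [RHS]e -!addrA; congr (_ + _).
by rewrite addrCA.
Qed.
End Abelian.

(** * Symbols modulo [Z I]: from operators to matrices over a Laurent ring *)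

Section Symbol.
Variables (K : fieldType) (n : nat) (I : {set 'I_n}).
Local Notation Sop := (Sop K n).
Local Notation X := (X K (n := n)).
Local Notation Y := (Y K (n := n)).
Local Notation XX := (XX K (n := n)).
Local Notation YY := (YY K (n := n)).
Local Notation EE := (EE K (n := n)).
Local Notation e_ := (e_ K (n := n)).
Local Notation SC := (Sin (fun k => k \notin I)).
Local Notation c := (enum (~: I)).
Variables (L : idomainType) (kap : {rmorphism K -> L}) (x xi : 'I_n -> L).
Hypothesis tw : tower_spec c kap x xi.

Lemma mem_c k : (k \in c) = (k \notin I).
Proof. by rewrite mem_enum inE. Qed.

Definition rs (g : 'I_n -> nat) : 'I_n -> nat := fun k => if k \in I then 0%N else g k.

(** Operator and symbol are built by the same expression. A map would require knowing its kernel
    beforehand; [Rel_zero] supplies afterwards that the symbol is unique and that the kernel is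
    [Z I]. *)
Inductive Rel : Sop -> L -> Prop :=
| Rel_c l : Rel (kS n l) (kap l)
| Rel_x k : k \notin I -> Rel (X k) (x k)
| Rel_y k : k \notin I -> Rel (Y k) (xi k)
| Rel_D u a v b : Rel u a -> Rel v b -> Rel (u + v) (a + b)
| Rel_M u a v b : Rel u a -> Rel v b -> Rel (u * v) (a * b).

Lemma Rel_0 : Rel 0 0. Proof. by rewrite -(rmorph0 kap) -(kS0 K n); apply: Rel_c. Qed.
Lemma Rel_1 : Rel 1 1. Proof. by rewrite -(rmorph1 kap) -(kS1 K n); apply: Rel_c. Qed.
Lemma Rel_N u a : Rel u a -> Rel (- u) (- a).
Proof.
move=> h; have -> : - u = kS n (-1) * u by apply: SopP => f b; rewrite svME kSE mulN1r.
have -> : - a = kap (-1) * a by rewrite rmorphN1 mulN1r.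
by apply: Rel_M => //; apply: Rel_c.
Qed.
Lemma Rel_SC u a : Rel u a -> SC u.
Proof.
by elim=> *; [apply: Sin_c|apply: Sin_X|apply: Sin_Y|apply: Sin_D|apply: Sin_M].
Qed.
Lemma Rel_totr a : exists u, Rel u a.
Proof.
elim: (tw_gen tw a) => [l|k|k|b d _ [u hu] _ [v hv]|b d _ [u hu] _ [v hv]]; rewrite ?mem_c.
- by eexists; apply: Rel_c.
- by eexists; apply: Rel_x.
- by eexists; apply: Rel_y.
- by eexists; apply: Rel_D; [exact: hu|exact: hv].
- by eexists; apply: Rel_M; [exact: hu|exact: hv].
Qed.

Definition evS (p : seq (K * ('I_n -> nat))) : Sop := \sum_(z <- p) kS n z.1 * XX (rs z.2).
Definition evL (p : seq (K * ('I_n -> nat))) : L := \sum_(z <- p) kap z.1 * mono x c z.2.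
(** Both sides come from one polynomial in the [x_k], where operators and Laurent polynomials have
    independent monomials. *)
Definition PR s b := exists2 p, s = evS p & b = evL p.

Lemma PR_0 : PR 0 0. Proof. by exists [::]; rewrite /evS /evL big_nil. Qed.
Lemma PR_D s b s' b' : PR s b -> PR s' b' -> PR (s + s') (b + b').
Proof. by move=> [p -> ->] [q -> ->]; exists (p ++ q); rewrite /evS /evL big_cat. Qed.
Lemma PR_Z l s b : PR s b -> PR (kS n l * s) (kap l * b).
Proof.
move=> [p -> ->]; exists [seq (l * z.1, z.2) | z <- p]; rewrite /evS /evL big_map mulr_sumr.
  by apply: eq_bigr => z _ /=; rewrite mulrA kSM.
by apply: eq_bigr => z _ /=; rewrite rmorphM mulrA.
Qed.
Lemma PR_XX g : PR (XX (rs g)) (mono x c g).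
Proof. by exists [:: (1, g)]; rewrite /evS /evL big_seq1 /= ?kS1 ?rmorph1 mul1r. Qed.
Lemma PR_sum (T : Type) (r : seq T) F G : (forall z, PR (F z) (G z)) ->
  PR (\sum_(z <- r) F z) (\sum_(z <- r) G z).
Proof. by move=> H; elim/big_rec2: _ => [|z a b _ hb]; [exact: PR_0|exact: PR_D]. Qed.

Lemma mono_sub g h : (forall k, k \notin I -> (g k <= h k)%N) ->
  mono x c h = mono x c g * mono x c (fun k => (h k - g k)%N).
Proof. by move=> gh; rewrite monoD; apply: eq_mono => k; rewrite mem_c => kI; rewrite subnKC ?gh. Qed.

Lemma mono_del k : k \notin I -> mono x c (del k) = x k.
Proof.
move=> kI; rewrite /mono (bigD1_seq k) /= ?mem_c ?enum_uniq // /del eqxx expr1.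
by rewrite big1 ?mulr1 // => j /negPf ->.
Qed.

(** A high power of the [x_k] absorbs every [y_k] on its left, just as it clears negative exponents
    in the symbol. *)
Lemma Rel_poly u a : Rel u a -> exists N, forall g,
  (forall k, k \notin I -> (N <= g k)%N) -> PR (u * XX (rs g)) (a * mono x c g).
Proof.
have rsD g h : XX (rs g) * XX (rs h) = XX (rs (fun k => (g k + h k)%N)).
  by rewrite XXD; apply: eq_XX => k; rewrite /rs; case: ifP.
elim=> {u a} [l|k kI|k kI|u a v b _ [N hN] _ [M hM]|u a v b _ [N hN] _ [M hM]].
- by exists 0%N => g _; apply/PR_Z/PR_XX.
- exists 0%N => g _; have -> : X k = XX (rs (del k)).
    rewrite -XX_del; apply: eq_XX => j; rewrite /rs /del.
    by case: (eqVneq j k) => [->|_]; rewrite ?(negPf kI) ?if_same.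
  by rewrite rsD -mono_del // monoD; apply: PR_XX.
- exists 1%N => g hg; rewrite Y_XX; last by rewrite /rs (negPf kI) hg.
  rewrite (@mono_sub (del k)) ?mono_del // => [|j jI]; last first.
    by rewrite /del; case: (eqVneq j k) => [->|_] //; apply: hg.
  rewrite mulrA (mulrC (xi k)) (tw_inv tw) mul1r.
  rewrite (_ : XX _ = XX (rs (fun j => (g j - del k j)%N))); first exact: PR_XX.
  by apply: eq_XX => j; rewrite /rs; case: ifP.
- exists (maxn N M) => g hg; rewrite !mulrDl; apply: PR_D.
    by apply: hN => k /hg; lia.
  by apply: hM => k /hg; lia.
(* The part [h] of the exponent, at least [M], clears [v]; the reserve [N] then multiplies each
   resulting monomial and suffices for [u]. *)
- exists (N + M)%N => g hg; pose h k := (g k - N)%N.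
  have [|p ep eb] := hM h; first by move=> k /hg; rewrite /h; lia.
  have -> : u * v * XX (rs g) = \sum_(z <- p) kS n z.1 * (u * XX (rs (fun k => (z.2 k + N)%N))).
    have -> : XX (rs g) = XX (rs h) * XX (rs (fun=> N)).
      rewrite rsD; apply: eq_XX => k; rewrite /rs; case: (boolP (k \in I)) => // /hg; rewrite /h; lia.
    rewrite -mulrA (mulrA v) ep mulr_suml mulr_sumr; apply: eq_bigr => z _.
    by rewrite -(mulrA (kS n _)) rsD !mulrA kSC.
  have -> : a * b * mono x c g = \sum_(z <- p) kap z.1 * (a * mono x c (fun k => (z.2 k + N)%N)).
    have -> : mono x c g = mono x c h * mono x c (fun=> N).
      by rewrite monoD; apply: eq_mono => k; rewrite mem_c /h => /hg; lia.
    rewrite -mulrA (mulrA b) eb mulr_suml mulr_sumr; apply: eq_bigr => z _.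
    by rewrite -(mulrA (kap _)) monoD mulrCA.
  by apply: PR_sum => z; apply: PR_Z; apply: hN => k _; lia.
Qed.

Local Notation agree := (fun g h : 'I_n -> nat => all (fun k => g k == h k) c).

(** Collects an unsorted sum by the exponents restricted to [c], removing one class of agreeing
    exponents at a time. *)
Lemma group_sum (V : zmodType) (H : K -> ('I_n -> nat) -> V) (p : seq (K * ('I_n -> nat))) :
  (forall l l' g, H (l + l') g = H l g + H l' g) ->
  (forall l g h, agree g h -> H l g = H l h) ->
  (forall h, \sum_(z <- p | agree z.2 h) z.1 = 0) -> \sum_(z <- p) H z.1 z.2 = 0.
Proof.
move=> HD Hag; have H0 g : H 0 g = 0.
  by apply: (addrI (H 0 g)); rewrite -HD !addr0.
have Hs (q : seq (K * ('I_n -> nat))) (Q : pred _) g :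
    H (\sum_(z <- q | Q z) z.1) g = \sum_(z <- q | Q z) H z.1 g.
  by apply: (big_morph (fun l => H l g)).
have agP g h : agree g h -> forall k, k \in c -> g k = h k by move/allP => e k /e /eqP.
have agI g h : (forall k, k \in c -> g k = h k) -> agree g h.
  by move=> e; apply/allP => k /e ->.
move: {2}(size p) (leqnn (size p)) => m; elim: m p => [|m IH] p.
  by rewrite leqn0 size_eq0 => /eqP -> _; rewrite big_nil.
case: p => [|z0 p] sp Hp; first by rewrite big_nil.
rewrite (bigID (fun z => agree z.2 z0.2)) /= [X in X + _](_ : _ = 0) ?add0r.
  rewrite -big_filter; apply: IH => [|h].
    rewrite /= (agI z0.2 z0.2) //=; move: sp; rewrite /= ltnS; apply: leq_trans.
    by rewrite size_filter count_size.
  rewrite big_filter_cond; have [zh|nzh] := boolP (agree z0.2 h).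
    rewrite big_pred0 // => z; apply/negP => /andP [/negP a1 a2]; apply: a1.
    by apply: agI => k kc; rewrite (agP _ _ a2) // (agP _ _ zh).
  rewrite -[RHS](Hp h); apply: eq_bigl => z; rewrite andb_idl // => a2.
  apply/negP => a1; case/negP: nzh; apply: agI => k kc.
  by rewrite -(agP _ _ a1) // (agP _ _ a2).
rewrite (eq_bigr (fun z => H z.1 z0.2)) => [|z /Hag -> //].
by rewrite -Hs Hp H0.
Qed.

Lemma PR_zero s b : PR s b -> (b = 0 <-> s = 0).
Proof.
case=> p -> ->; have kD (l l' : K) : kS n (l + l') = kS n l + kS n l' by rewrite kSD.
split=> e.
  apply: (@group_sum _ (fun l g => kS n l * XX (rs g))) => [l l' g|l g h|h].
  - by rewrite kD mulrDl.
  - move/allP => gh; congr (_ * _); apply: eq_XX => k; rewrite /rs.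
    by case: (boolP (k \in I)) => // kI; apply/eqP/gh; rewrite mem_c.
  - exact: (tw_indep tw e).
apply: (@group_sum _ (fun l g => kap l * mono x c g)) => [l l' g|l g h|h].
- by rewrite rmorphD mulrDl.
- by move/allP => gh; congr (_ * _); apply: eq_mono => k /gh /eqP.
(* Applied to the delta function at the origin, [x^g] gives the delta function at [g], so evaluating
   at [rs h] reads off one coefficient. *)
pose f0 (a : 'I_n -> nat) : K := if [forall k, a k == 0%N] then 1 else 0.
have := congr1 (fun u => sv u f0 (rs h)) e; rewrite sv0E svsum => e0; rewrite -[RHS]e0 big_mkcond.
apply: eq_bigr => z _; rewrite svME kSE XX_E.
case: ifP => [/allP ag|/negbT /allPn [k]].
  rewrite (_ : [forall k, _] = true); last first.
    apply/forallP => k; rewrite /rs; case: (boolP (k \in I)) => // kI.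
    by rewrite (eqP (ag k _)) ?mem_c.
  rewrite /f0 (_ : [forall k, _] = true) ?mulr1 //; apply/forallP => k; rewrite /rs.
  by case: (boolP (k \in I)) => // kI; rewrite (eqP (ag k _)) ?mem_c // subnn.
rewrite mem_c => kI zk; case: forallP => [le|_]; last by rewrite mulr0.
rewrite /f0; case: forallP => [eq0|_]; last by rewrite mulr0.
have := le k; have := eq0 k; rewrite /rs (negPf kI); move: zk; case: eqP => //; lia.
Qed.

Lemma mono_unit g b : b * mono x c g = 0 -> b = 0.
Proof. by move=> e; rewrite -[b]mulr1 -(monoV c g (tw_inv tw)) mulrA e mul0r. Qed.

Lemma Rel_zero u a : Rel u a -> (a = 0 <-> Z I u).
Proof.
case/Rel_poly => N hN; split=> [a0|[M hM]].
  exists N; have := PR_zero (hN (fun=> N) (fun _ _ => leqnn N)).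
  by rewrite a0 mul0r => -[h _]; apply: h.
have := PR_zero (hN (fun=> maxn N M) (fun _ _ => leq_maxl N M)).
by rewrite (Z_up hM (leq_maxr N M)) => -[_ h]; apply: (mono_unit (h erefl)).
Qed.

(** Powers of the [y_k] with [k] in [I] commute with [u] and move any point to one whose coordinates
    in [I] are zero, where [e_I] acts as the identity. *)
Lemma SC_e0 u : SC u -> u * e_ I = 0 -> u = 0.
Proof.
move=> hu ue; apply: SopP => f a.
pose g k := if k \in I then a k else 0%N.
have gY : Sin (fun k => k \in I) (YY g) by apply: YY_in => k /negPf; rewrite /g => ->.
pose b k := if k \in I then 0%N else a k.
have -> : sv u f a = sv (YY g * u) f b.
  rewrite svME YY_E; congr (sv u f _); apply/funext => k; rewrite /b /g; case: ifP; lia.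
rewrite -(@Sin_comm _ _ (fun k => k \notin I) (fun k => k \in I) u) //; last by move=> k /negP.
have := congr1 (fun u => sv u (sv (YY g) f) b) ue; rewrite EE_comm // svME sv0E e_E.
by case: forall_inP => // -[] k kI; rewrite /b kI.
Qed.

Lemma Z_e u : SC u -> Z I (u * e_ I) -> Z I u.
Proof.
move=> hu [N hN]; exists N.
have hX : SC (XX (cst I N)) by apply: XX_in => k; rewrite negbK /cst => ->.
apply: SC_e0; first exact: Sin_M.
by rewrite -mulrA EE_comm // mulrA.
Qed.

(** A copy of [N^I]; vanishing off [I] makes equality of labels an equality of functions. *)
Definition W := {w : 'I_n -> nat | forall k, k \notin I -> w k = 0%N}.
Local Notation EW a b := (EE (sval a) (sval b) I).

Lemma W_eq (a b : W) : (forall k, k \in I -> sval a k = sval b k) -> a = b.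
Proof.
case: a b => a ha [b hb] /= ab; have e : a = b.
  by apply/funext => k; case: (boolP (k \in I)) => kI; [apply: ab|rewrite ha ?hb].
by subst b; congr exist; apply: Prop_irrelevance.
Qed.

Lemma EWM (a b a' b' : W) : EW a b * EW a' b' = if `[< b = a' >] then EW a b' else 0.
Proof.
rewrite EEM; case: asboolP => [->|nb].
  by case: ifP => // /negbT /forall_inPn [k _]; rewrite eqxx.
case: forall_inP => // h; case: nb; apply: W_eq => k kI; exact/eqP/h.
Qed.

Definition W0 : W := exist _ (fun=> 0%N) (fun _ _ => erefl).
Lemma EW00 : EW W0 W0 = e_ I. Proof. by []. Qed.

(** A finitary matrix over [S_CI] paired with its symbol, acting on functions over [W]. It is again
    a relation, made faithful by [AR_Z]. *)
Inductive AR : Sop -> wop L W -> Prop :=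
| AR0 : AR 0 (fun _ _ => 0)
| ARs u a al be h tau : Rel u a -> AR h tau ->
    AR (u * EW al be + h) (fun v w => (if `[< w = al >] then a * v be else 0) + tau v w).

Lemma AR_eq h tau h' tau' : AR h tau -> h = h' -> tau = tau' -> AR h' tau'.
Proof. by move=> H <- <-. Qed.

Lemma AR_1 u a al be : Rel u a -> AR (u * EW al be) (fun v w => if `[< w = al >] then a * v be else 0).
Proof.
move=> h; apply: (AR_eq (ARs al be h AR0)); first by rewrite addr0.
by apply/funext => v; apply/funext => w; rewrite addr0.
Qed.

Lemma AR_D h tau h' tau' : AR h tau -> AR h' tau' -> AR (h + h') (fun v w => tau v w + tau' v w).
Proof.
elim=> {h tau} [|u a al be h tau hu _ IH] H'.
  by apply: (AR_eq H'); [rewrite add0r|apply/funext => v; apply/funext => w; rewrite add0r].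
apply: (AR_eq (ARs al be hu (IH H'))); first by rewrite addrA.
by apply/funext => v; apply/funext => w; rewrite addrA.
Qed.

Lemma AR_Zr h tau u a : AR h tau -> Rel u a -> AR (h * u) (fun v w => tau v w * a).
Proof.
elim=> {h tau} [|u' a' al be h tau hu' _ IH] hu.
  by apply: (AR_eq AR0); [rewrite mul0r|apply/funext => v; apply/funext => w; rewrite mul0r].
apply: (AR_eq (ARs al be (Rel_M hu' hu) (IH hu))).
  by rewrite mulrDl -mulrA EE_comm ?mulrA //; apply: Rel_SC hu.
apply/funext => v; apply/funext => w; rewrite mulrDl; congr (_ + _).
by case: ifP; rewrite ?mul0r // mulrAC.
Qed.

Lemma AR_N h tau : AR h tau -> AR (- h) (fun v w => - tau v w).
Proof.
move=> H; apply: (AR_eq (AR_Zr H (Rel_N Rel_1))); first by rewrite mulrN1.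
by apply/funext => v; apply/funext => w; rewrite mulrN1.
Qed.

Lemma AR_El h tau u a al be : AR h tau -> Rel u a ->
  AR (u * EW al be * h) (fun v w => if `[< w = al >] then a * tau v be else 0).
Proof.
elim=> {h tau} [|u' a' al' be' h tau hu' _ IH] hu.
  apply: (AR_eq AR0); first by rewrite mulr0.
  by apply/funext => v; apply/funext => w; rewrite mulr0 if_same.
have e : u * EW al be * (u' * EW al' be') = u * u' * (EW al be * EW al' be').
  by rewrite !mulrA -(mulrA u) -EE_comm ?mulrA //; apply: Rel_SC hu'.
have {}IH := IH hu; rewrite mulrDr e EWM; case: asboolP => _.
  apply: (AR_eq (ARs al be' (Rel_M hu hu') IH)) => //.
  apply/funext => v; apply/funext => w.
  by case: ifP => _; rewrite ?mulrDr ?mulrA // add0r.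
apply: (AR_eq IH); first by rewrite mulr0 add0r.
by apply/funext => v; apply/funext => w; rewrite add0r.
Qed.

Lemma AR_M h tau h' tau' : AR h tau -> AR h' tau' -> AR (h * h') (fun v => tau (tau' v)).
Proof.
elim=> {h tau} [|u a al be h tau hu _ IH] H'; first by apply: (AR_eq AR0); rewrite ?mul0r.
by apply: (AR_eq (AR_D (AR_El al be H' hu) (IH H'))); rewrite ?mulrDl.
Qed.

Lemma AR_add h tau v v' w : AR h tau -> tau (fun b => v b + v' b) w = tau v w + tau v' w.
Proof.
elim=> {h tau} [|u a al be h tau hu _ IH]; first by rewrite addr0.
by rewrite IH addrACA; congr (_ + _); case: ifP; rewrite ?addr0 // mulrDr.
Qed.

Lemma AR_sum (T : Type) (r : seq T) (Q : pred T) (F : T -> Sop) :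
  (forall i, Q i -> exists tau, AR (F i) tau) -> exists tau, AR (\sum_(i <- r | Q i) F i) tau.
Proof.
move=> H; elim/big_ind: _ => [|u v [t ht] [t' ht']|//]; first by eexists; apply: AR0.
by eexists; apply: AR_D; [exact: ht|exact: ht'].
Qed.

Lemma X_EE k al be : k \in I -> X k * EE al be I = EE (fun j => (al j + del k j)%N) be I.
Proof.
move=> kI; apply: SopP => f a; rewrite svME XE !EEE.
have -> : [forall j in I, a j == (al j + del k j)%N] =
    (0 < a k)%N && [forall j in I, (if j == k then (a j).-1 else a j) == al j].
  apply/forall_inP/andP => [h|[ak /forall_inP h] j jI].
    split; first by have := h k kI; rewrite /del eqxx; lia.
    by apply/forall_inP => j jI; have := h j jI; rewrite /del; case: (eqVneq j k) => [->|_] /=; lia.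
  by have := h j jI; rewrite /del; case: (eqVneq j k) => [->|_] /=; lia.
case: (0 < a k)%N => //=; case: ifP => // _; congr (f _); apply/funext => j.
by case: (eqVneq j k) => [->|_] //; rewrite kI.
Qed.

Lemma Y_EE k al be : k \in I -> Y k * EE al be I =
  if (0 < al k)%N then EE (fun j => (al j - del k j)%N) be I else 0.
Proof.
move=> kI; case: ifP => [ak|ak].
  have -> : EE al be I = X k * EE (fun j => (al j - del k j)%N) be I.
    rewrite X_EE //; congr EE; apply/funext => j; rewrite /del; case: (eqVneq j k) => [->|_] /=; lia.
  by rewrite mulrA -YY_del -XX_del YYXX mul1r.
apply: SopP => f a; rewrite svME YE EEE sv0E; case: forall_inP => // /(_ k kI).
by rewrite eqxx; lia.
Qed.

(** Finitary elements form a left ideal of the whole algebra, since [x_k] and [y_k] with [k] in [I]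
    only shift a row label or kill the matrix unit. *)
Lemma AR_left u h tau : AR h tau -> exists tau', AR (u * h) tau'.
Proof.
have H : forall al be : W, exists tau', AR (u * EW al be) tau'.
  elim/Sin_ind: u / (Sin_T u) => [l|k _|k _|u v _ _ hu hv|u v _ _ hu hv] al be.
  - by eexists; apply: AR_1; apply: Rel_c.
  - case: (boolP (k \in I)) => kI; last by eexists; apply: AR_1; apply: Rel_x.
    have P j : j \notin I -> (sval al j + del k j)%N = 0%N.
      by move=> jI; rewrite (svalP al) // /del; case: eqP jI => // ->; rewrite kI.
    rewrite X_EE //; eexists; apply: (AR_eq (AR_1 (exist _ _ P) be Rel_1)) => //.
    by rewrite mul1r.
  - case: (boolP (k \in I)) => kI; last by eexists; apply: AR_1; apply: Rel_y.
    rewrite Y_EE //; case: ifP => _; last by eexists; apply: AR0.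
    have P j : j \notin I -> (sval al j - del k j)%N = 0%N by move=> jI; rewrite (svalP al).
    eexists; apply: (AR_eq (AR_1 (exist _ _ P) be Rel_1)) => //.
    by rewrite mul1r.
  - have [t ht] := hu al be; have [t' ht'] := hv al be; rewrite mulrDl.
    by eexists; apply: AR_D; [exact: ht|exact: ht'].
  - have [t ht] := hv al be; rewrite -mulrA; elim: ht => [|w a al' be' h' t' hw _ [t2 ht2]].
      by rewrite mulr0; eexists; apply: AR0.
    rewrite mulrDr EE_comm ?mulrA; last exact: Rel_SC hw.
    have [t3 ht3] := hu al' be'.
    by eexists; apply: AR_D ht2; apply: AR_Zr hw; exact: ht3.
elim=> {h tau} [|w a al be h tau hw _ [t2 ht2]]; first by rewrite mulr0; eexists; apply: AR0.
rewrite mulrDr EE_comm ?mulrA; last exact: Rel_SC hw.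
have [t3 ht3] := H al be.
by eexists; apply: AR_D ht2; apply: AR_Zr hw; exact: ht3.
Qed.

(** Any labels that cover a finite list will do, so that two finitary elements can be written as
    matrices over a common family. *)
Lemma AR_mat h tau : AR h tau -> exists ls : seq W, forall r (f : 'I_r -> W), injective f ->
  (forall w, List.In w ls -> exists i, w = f i) ->
  exists (cf : 'I_r -> 'I_r -> Sop) (A : 'M[L]_r),
   [/\ forall i j, Rel (cf i j) (A i j), h = \sum_i \sum_j cf i j * EW (f i) (f j) &
       tau = fun v w => \sum_i if `[< w = f i >] then \sum_j A i j * v (f j) else 0].
Proof.
elim=> {h tau} [|u a al be h tau hu _ [ls IH]].
  exists [::] => r f _ _; exists (fun _ _ => 0), 0; split.
  - by move=> i j; rewrite mxE; apply: Rel_0.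
  - by rewrite big1 // => i _; rewrite big1 // => j _; rewrite mul0r.
  - apply/funext => v; apply/funext => w; rewrite big1 // => i _; case: ifP => // _.
    by rewrite big1 // => j _; rewrite mxE mul0r.
exists [:: al, be & ls] => r f fi cov.
have [|cf [A [hR hh ht]]] := IH r f fi; first by move=> w hw; apply: cov; do 2 right.
have [i0 ei] := cov al (or_introl erefl); have [j0 ej] := cov be (or_intror (or_introl erefl)).
have dsum (V : zmodType) (F : 'I_r -> 'I_r -> V) :
   \sum_i \sum_j (if (i == i0) && (j == j0) then F i j else 0) = F i0 j0.
  rewrite (bigD1 i0) //= (bigD1 j0) //= !eqxx /= !big1 ?addr0 //.
    by move=> i /negPf ii; rewrite big1 // => j _; rewrite ii.
  by move=> j /negPf ->.
exists (fun i j => (if (i == i0) && (j == j0) then u else 0) + cf i j),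
  (\matrix_(i, j) ((if (i == i0) && (j == j0) then a else 0) + A i j)); split.
- by move=> i j; rewrite mxE; apply: Rel_D => //; case: ifP => // _; apply: Rel_0.
- have -> : u * EW al be = \sum_i \sum_j (if (i == i0) && (j == j0) then u * EW (f i) (f j) else 0).
    by rewrite dsum ei ej.
  rewrite hh -big_split; apply: eq_bigr => i _; rewrite -big_split; apply: eq_bigr => j _ /=.
  by rewrite mulrDl; case: ifP; rewrite ?mul0r.
- apply/funext => v; apply/funext => w; rewrite ht.
  have -> : (if `[< w = al >] then a * v be else 0) =
     \sum_i if `[< w = f i >] then \sum_j (if (i == i0) && (j == j0) then a * v (f j) else 0) else 0.
    rewrite (bigD1 i0) //= -ei [X in _ + X]big1 ?addr0 => [|i /negPf ii]; last first.
      by case: ifP => // _; rewrite big1 // => j _; rewrite ii.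
    by case: ifP => // _; rewrite (bigD1 j0) //= !eqxx /= -ej big1 ?addr0 // => j /negPf ->.
  rewrite -big_split; apply: eq_bigr => i _ /=; case: ifP => _; last by rewrite addr0.
  rewrite -big_split; apply: eq_bigr => j _ /=; rewrite mxE mulrDl.
  by case: ifP; rewrite ?mul0r.
Qed.

Lemma label_cover (ls : seq W) : exists r (f : 'I_r -> W),
  injective f /\ forall w, List.In w ls -> exists i, w = f i.
Proof.
elim: ls => [|w ls [r [f [fi cov]]]].
  by exists 0%N, (fun i : 'I_0 => W0); split=> [[]|].
have [[i ei]|nw] := pselect (exists i, w = f i).
  by exists r, f; split=> // w' [<-|/cov //]; exists i.
exists r.+1, (fun i => if unlift ord0 i is Some j then f j else w); split.
  move=> i j; case: unliftP => [i' ->|->]; case: unliftP => [j' ->|->] //.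
  - by move/fi => ->.
  - by move=> e; case: nw; exists i'.
  - by move=> e; case: nw; exists j'.
move=> w' [<-|/cov [i ->]]; first by exists ord0; rewrite unlift_none.
by exists (lift ord0 i); rewrite liftK.
Qed.

Lemma AR_entry r (f : 'I_r -> W) (cf : 'I_r -> 'I_r -> Sop) i j : injective f ->
  (forall i j, SC (cf i j)) ->
  EW W0 (f i) * (\sum_i \sum_j cf i j * EW (f i) (f j)) * EW (f j) W0 = cf i j * e_ I.
Proof.
move=> fi hc; rewrite -EW00; move: W0 => z0; rewrite mulr_sumr mulr_suml (bigD1 i) //= [X in _ + X]big1 ?addr0.
  rewrite mulr_sumr mulr_suml (bigD1 j) //= big1 ?addr0.
    by rewrite mulrA -EE_comm // -!mulrA EWM asT // EWM asT.
  by move=> j' /eqP jj; rewrite -!mulrA EWM asF ?mulr0 // => /fi.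
move=> i' /eqP ii; rewrite mulr_sumr big1 ?mul0r // => j' _.
by rewrite mulrA -EE_comm // -!mulrA EWM asF ?mulr0 // => /fi /esym.
Qed.

(** Matrix units isolate the entries and reduce the claim to [Rel_zero]. *)
Lemma AR_Z h tau : AR h tau -> (Z I h <-> tau = fun _ _ => 0).
Proof.
move=> H; have [ls hls] := AR_mat H; have [r [f [fi cov]]] := label_cover ls.
have [cf [A [hR hh ht]]] := hls r f fi cov.
have hc i j : SC (cf i j) := Rel_SC (hR i j).
split=> [Zh|t0].
  rewrite ht; apply/funext => v; apply/funext => w; rewrite big1 // => i _; case: ifP => // _.
  rewrite big1 // => j _; rewrite (proj2 (Rel_zero (hR i j))) ?mul0r //.
  apply: Z_e => //; rewrite -(AR_entry i j fi hc) -hh.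
  by apply: ZMr; apply: ZMl.
rewrite hh; apply: Zsum => i _; apply: Zsum => j _; apply: ZMr.
apply/(Rel_zero (hR i j)).
have := congr1 (fun t : wop L W => t (fun w => if `[< w = f j >] then 1 else 0) (f i)) t0.
rewrite ht /= (bigD1 i) //= asT // [X in _ + X]big1 ?addr0; last by move=> k /eqP ik; rewrite asF // => /fi /esym.
rewrite (bigD1 j) //= asT // mulr1 big1 ?addr0 // => k /eqP kj.
by rewrite asF ?mulr0 // => /fi.
Qed.

Local Notation ep := (ep K (n := n)).
Local Notation pp := (pp K (n := n)).

Lemma ep_AR N : exists tau, AR (ep I N.+1) tau.
Proof.
have -> : ep I N.+1 = \sum_(b : {ffun 'I_n -> 'I_N.+1} | [forall k, (k \notin I) ==> (b k == ord0)])
    EE (fun k => nat_of_ord (b k)) (fun k => nat_of_ord (b k)) I.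
  apply: SopP => f a; rewrite svsum epE.
  case: (boolP [forall k in I, (a k < N.+1)%N]) => ha; last first.
    rewrite big1 // => b _; rewrite EEE; case: forall_inP => // h; case/negP: ha.
    by apply/forall_inP => k kI; rewrite (eqP (h k kI)) ltn_ord.
  pose b0 : {ffun 'I_n -> 'I_N.+1} := [ffun k => if k \in I then inord (a k) else ord0].
  have b0E k : k \in I -> nat_of_ord (b0 k) = a k.
    by move=> kI; rewrite ffunE kI inordK // (forall_inP ha).
  have Pb0 : [forall k, (k \notin I) ==> (b0 k == ord0)].
    by apply/forallP => k; apply/implyP => kI; rewrite ffunE (negPf kI).
  rewrite (bigD1 b0 Pb0) EEE (_ : [forall k in I, _] = true); last first.
    by apply/forall_inP => k kI; rewrite b0E.
  rewrite big1 => [|b /andP [/forallP hb nb]].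
    rewrite /= addr0; congr (f _); apply/funext => k; case: ifP => // kI; by rewrite b0E.
  rewrite EEE; case: forall_inP => // h; case/eqP: nb; apply/ffunP => k.
  case: (boolP (k \in I)) => kI; first by apply: val_inj; rewrite /= b0E // (eqP (h k kI)).
  by have := hb k; rewrite kI ffunE (negPf kI) => /eqP.
apply: AR_sum => b /forallP hb.
have P k : k \notin I -> nat_of_ord (b k) = 0%N by move=> kI; have := hb k; rewrite kI => /eqP ->.
eexists; apply: (AR_eq (AR_1 (exist _ (fun k => nat_of_ord (b k)) P) (exist _ (fun k => nat_of_ord (b k)) P) Rel_1)) => //.
by rewrite mul1r.
Qed.

Lemma XX_far k N (G : Sop) : k \in I -> (forall f b, (b k < N)%N -> sv G f b = 0) ->
  XX (cst I N) * G = XX (cst (I :\ k) N) * (YY (fun j => (N * del k j)%N) * G).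
Proof.
move=> kI hG; apply: SopP => f a; rewrite !svME !XX_E.
case: (boolP [forall j, (cst (I :\ k) N j <= a j)%N]) => h.
  have h' : [forall j, (cst I N j <= a j)%N].
    apply/forallP => j; have := forallP h j; rewrite /cst !inE.
    by case: (eqVneq j k) => [->|_] //=; rewrite kI.
  rewrite h' YY_E; congr (sv G f _); apply/funext => j; have := forallP h j.
  rewrite /cst /del !inE; case: (eqVneq j k) => [->|_] /=; rewrite ?kI; first by lia.
  by case: (j \in I); lia.
case: (boolP [forall j, (cst I N j <= a j)%N]) => // h'.
apply: hG; rewrite /cst kI subn0 ltnNge; apply: contra h => Na.
apply/forallP => j; have := forallP h' j; rewrite /cst !inE.
by case: (eqVneq j k) => [->|_].
Qed.

Lemma ep_in (A : {set 'I_n}) N : Sin (fun k => k \in A) (ep A N).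
Proof.
apply: Sin_prod => k; rewrite mem_enum => kI; apply: Sin_B; first exact: Sin_1.
by apply: Sin_M; apply: Sin_exp; [apply: Sin_X|apply: Sin_Y].
Qed.

(** The finitary part is [v ep I N]. The remainder only involves regions where some coordinate [k]
    in [I] is at least [N]; there a power [x_k^N] is available for free ([XX_far]), and the
    hypothesis for [I \ k] applies. *)
Lemma AR_finite v : (forall k, k \in I -> Z (I :\ k) v) -> exists h tau, AR h tau /\ Z I (v - h).
Proof.
move=> hv; have [N0 hN0] := Zunif v; pose N := N0.+1.
have hN k : k \in I -> v * XX (cst (I :\ k) N) = 0.
  by move=> kI; apply: Z_up (hN0 _ (hv k kI)) (leqnSn _).
have [t ht] := ep_AR N0; have [t' ht'] := AR_left v ht.
exists (v * ep I N), t'; split=> //; exists N.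
have -> : v - v * ep I N = v * (1 - ep I N) by rewrite mulrBr mulr1.
have eX : (1 - ep I N) * XX (cst I N) = XX (cst I N) * (1 - ep I N).
  apply/esym; apply: (@Sin_comm _ _ (fun k => k \notin I) (fun k => k \in I)) => [k /negP //| |].
    by apply: XX_in => k; rewrite negbK /cst => ->.
  by apply: Sin_B; [exact: Sin_1|exact: ep_in].
rewrite -mulrA eX.
have -> : XX (cst I N) * (1 - ep I N) =
   \sum_(A : {set 'I_n}) XX (cst I N) * ((1 - ep I N) * (pp A N * ep A N)).
  by rewrite -mulr_sumr -mulr_sumr -region_sum mulr1.
rewrite mulr_sumr big1 // => A _; case: (boolP (I \subset A)) => IA.
  have -> : (1 - ep I N) * (pp A N * ep A N) = 0.
    apply: SopP => f a; rewrite svME svBE sv1E epE sv0E; case: ifP => h; first by rewrite subrr.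
    rewrite subr0 svME ppE epE; case: ifP => // _; case: ifP => // /forall_inP hA.
    move/negbT/negP: h; case; apply/forall_inP => k /(subsetP IA); exact: hA.
  by rewrite !mulr0.
case/subsetPn: IA => k kI kA; rewrite (@XX_far k N) //; first by rewrite mulrA hN // mul0r.
move=> f b bk.
have z : sv (pp A N * ep A N) f b = 0.
  by rewrite svME ppE; case: forallP => // /(_ k); rewrite (negPf kA) /= leqNgt bk.
by rewrite svME svBE sv1E epE z if_same subrr.
Qed.

Lemma ext_inj r (f : 'I_r -> W) (M N : 'M[L]_r) : injective f -> ext f M = ext f N -> M = N.
Proof.
move=> fi e; apply/matrixP => i j.
have val (P : 'M[L]_r) : ext f P (fun w => if `[< w = f j >] then 1 else 0) (f i) = P i j.
  rewrite extE // (bigD1 j) //= asT // mulr1 big1 ?addr0 // => k /eqP kj.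
  by rewrite asF ?mulr0 // => /fi.
by rewrite -(val M) e val.
Qed.

Lemma AR_pair h t h' t' : AR h t -> AR h' t' -> Z I ((1 + h) * (1 + h') - 1) ->
  exists r (f : 'I_r -> W) (A A' : 'M[L]_r),
  [/\ injective f, (fun v w => v w + t v w) = ext f (1%:M + A),
      (fun v w => v w + t' v w) = ext f (1%:M + A') & (1%:M + A) *m (1%:M + A') = 1%:M].
Proof.
move=> H H' Zhh; have [ls hls] := AR_mat H; have [ls' hls'] := AR_mat H'.
have [r [f [fi cov]]] := label_cover (ls ++ ls').
have [|cf [A [_ _ ht]]] := hls r f fi; first by move=> w hw; apply: cov; apply: List.in_or_app; left.
have [|cf' [A' [_ _ ht']]] := hls' r f fi; first by move=> w hw; apply: cov; apply: List.in_or_app; right.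
have ex (B : 'M[L]_r) : (fun v w => v w + \sum_i (if `[< w = f i >] then \sum_j B i j * v (f j) else 0)) =
    ext f (1%:M + B).
  apply/funext => v; apply/funext => w; rewrite /ext; congr (_ + _); apply: eq_bigr => i _.
  by rewrite addrAC subrr add0r.
have e1 : (fun v w => v w + t v w) = ext f (1%:M + A) by rewrite -ex ht.
have e2 : (fun v w => v w + t' v w) = ext f (1%:M + A') by rewrite -ex ht'.
exists r, f, A, A'; split=> //; apply: (ext_inj fi); rewrite ext_mul // ext1 -e1 -e2.
have Hs := AR_D (AR_D H H') (AR_M H H').
have es : (1 + h) * (1 + h') - 1 = h + h' + h * h'.
  by rewrite mulrDl mul1r mulrDr mulr1 abel3.
rewrite es in Zhh; have t0 := proj1 (AR_Z Hs) Zhh.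
apply/funext => v; apply/funext => w /=; rewrite (AR_add v (t' v) w H).
have := congr1 (fun tt : wop L W => tt v w) t0; rewrite /= => e.
by rewrite -addrA [X in _ + X]addrA [t' v w + t v w]addrC e addr0.
Qed.

(** Over a commutative ring a right inverse of a square matrix is a left inverse. *)
Lemma AR_pairC h t h' t' : AR h t -> AR h' t' -> Z I ((1 + h) * (1 + h') - 1) ->
  Z I ((1 + h') * (1 + h) - 1).
Proof.
move=> H H' Zhh; have [r [f [A [A' [fi e1 e2 AA']]]]] := AR_pair H H' Zhh.
have A'A := mulmx1C AA'.
have Hs := AR_D (AR_D H' H) (AR_M H' H).
have -> : (1 + h') * (1 + h) - 1 = h' + h + h' * h.
  by rewrite mulrDl mul1r mulrDr mulr1 abel3.
apply/(AR_Z Hs); apply/funext => v; apply/funext => w.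
have := congr1 (fun tt : wop L W => tt v w) (ext_mul (1%:M + A') (1%:M + A) fi).
rewrite A'A ext1 -e1 -e2 /= (AR_add v (t v) w H'); exact: abel4.
Qed.

(** Here [v] need not be finitary. Compressing it by [ez], the identity of the labels of [h], gives
    [w], a finitary perturbation of 1 and again a right inverse; the matrix argument makes [w] a
    left inverse, hence congruent to [v]. *)
Lemma AR_side h tau v : AR h tau -> Z I ((1 + h) * v - 1) -> Z I (v * (1 + h) - 1).
Proof.
move=> H Zv; have [ls hls] := AR_mat H; have [r [f [fi cov]]] := label_cover ls.
have [cf [A [hR hh ht]]] := hls r f fi cov.
pose ez : Sop := \sum_i EW (f i) (f i).
have ezr i (w : W) : ez * EW (f i) w = EW (f i) w.
  rewrite mulr_suml (bigD1 i) // EWM asT // big1 => [|k /andP [_ /eqP ki]]; first by rewrite /= addr0.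
  by rewrite EWM asF // => /fi.
have ezl i (w : W) : EW w (f i) * ez = EW w (f i).
  rewrite mulr_sumr (bigD1 i) // EWM asT // big1 => [|k /andP [_ /eqP ki]]; first by rewrite /= addr0.
  by rewrite EWM asF // => /fi /esym.
have ezc i j : cf i j * ez = ez * cf i j.
  rewrite mulr_sumr mulr_suml; apply: eq_bigr => k _; apply: EE_comm; exact: Rel_SC (hR i j).
have he : h * ez = h.
  rewrite hh mulr_suml; apply: eq_bigr => i _; rewrite mulr_suml; apply: eq_bigr => j _.
  by rewrite -mulrA ezl.
have eh : ez * h = h.
  rewrite hh mulr_sumr; apply: eq_bigr => i _; rewrite mulr_sumr; apply: eq_bigr => j _.
  by rewrite mulrA -ezc -mulrA ezr.
have ee : ez * ez = ez by rewrite {2 3}/ez mulr_sumr; apply: eq_bigr => i _; apply: ezr.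
have [te hte] : exists te, AR ez te.
  apply: AR_sum => i _; eexists; apply: (AR_eq (AR_1 (f i) (f i) Rel_1)) => //.
  by rewrite mul1r.
have [tv' htv] := AR_left v hte.
have Hw := AR_D (AR_M hte htv) (AR_N hte).
have e1 : (1 + h) * ez = ez + h by rewrite mulrDl mul1r he.
have e2 : ez * (1 + h) = ez + h by rewrite mulrDr mulr1 eh.
have Zw : Z I ((1 + h) * (1 + (ez * (v * ez) - ez)) - 1).
  have -> : (1 + h) * (1 + (ez * (v * ez) - ez)) - 1 = ez * ((1 + h) * v - 1) * ez.
    rewrite mulrDr mulr1 mulrBr [(1 + h) * (ez * _)]mulrA e1 abel1.
    by rewrite mulrBr mulr1 mulrBl !mulrA e2 ee.
  by apply: ZMr; apply: ZMl.
have Zw' := AR_pairC H Hw Zw.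
set w := 1 + (ez * (v * ez) - ez) in Zw Zw'.
have -> : v * (1 + h) - 1 = (w * ((1 + h) * v - 1) - (w * (1 + h) - 1) * v) * (1 + h) + (w * (1 + h) - 1).
  have -> : w * ((1 + h) * v - 1) - (w * (1 + h) - 1) * v = v - w.
    by rewrite mulrBr mulr1 mulrBl mul1r mulrA opprB addrC addrA subrK.
  by rewrite mulrBl addrA subrK.
by apply: ZD => //; apply: ZMr; apply: ZB; [apply: ZMl|apply: ZMr].
Qed.

Definition mm a b : Sop := XX (rs a) * YY (rs b).
(** Lift of a diagonal matrix with the single entry [l x^a / x^b] at label 0. For [l] nonzero it is
    a unit modulo [Z I], but in general not in the algebra. *)
Definition Dd l a b : Sop := 1 + (kS n l * mm a b - 1) * e_ I.

Lemma Rel_exp u a m : Rel u a -> Rel (u ^+ m) (a ^+ m).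
Proof. by move=> h; elim: m => [|m IH]; rewrite ?expr0 ?exprS; [exact: Rel_1|exact: Rel_M]. Qed.

Lemma Rel_mm a b : Rel (mm a b) (mono x c a * mono xi c b).
Proof.
have P (F : 'I_n -> Sop) (G : 'I_n -> L) g : (forall k, k \notin I -> Rel (F k) (G k)) ->
    Rel (\prod_(k <- enum 'I_n) F k ^+ rs g k) (mono G c g).
  move=> FG; have -> : mono G c g = \prod_(k <- enum 'I_n) (if k \in I then 1 else G k ^+ g k).
    rewrite /mono big_enum [RHS]big_enum /= [RHS](bigID (fun k => k \in I)) /= [X in X * _]big1 ?mul1r.
      by apply: eq_big => k; rewrite ?inE // => /negPf ->.
    by move=> k ->.
  elim/big_rec2: _ => [|k y1 y2 _ IH]; first exact: Rel_1.
  apply: Rel_M => //; rewrite /rs; case: (boolP (k \in I)) => kI; first by rewrite expr0; apply: Rel_1.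
  by apply: Rel_exp; apply: FG.
by apply: Rel_M; apply: P => k kI; [apply: Rel_x|apply: Rel_y].
Qed.

Lemma AR_comp1 p tp h th : AR p tp -> AR h th -> exists s ts, [/\ AR s ts, (1 + p) * (1 + h) = 1 + s &
  forall v, (fun w => v w + ts v w) = (fun w => v w + th v w + tp (fun w => v w + th v w) w)].
Proof.
move=> Hp Hh; eexists; eexists; split; first exact: (AR_D Hp (AR_D Hh (AR_M Hp Hh))).
  by rewrite mulrDl mul1r mulrDr mulr1 -addrA; congr (_ + _); rewrite addrCA.
move=> v; apply/funext => w; rewrite (AR_add v (th v) w Hp) -addrA; congr (_ + _).
by rewrite addrCA.
Qed.

(** A transvection lifts to a generator of [E_oo(S_CI)] by choosing any operator whose symbol is its
    entry. *)
Lemma ET_lift e : ET e -> exists g h t, [/\ Einf K n I (sv g), AR h t, g = 1 + h &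
  e = fun v w => v w + t v w].
Proof.
elim=> {e} [|i j a e ij _ [g [h [t [Eg H eg ->]]]]].
  exists 1, 0, (fun _ _ => 0); split; [exact: gg1|exact: AR0|by rewrite addr0|].
  by apply/funext => v; apply/funext => w; rewrite addr0.
have [u hu] := Rel_totr a; have Hp := AR_1 i j hu.
have [s [ts [Hs es ets]]] := AR_comp1 Hp H.
exists ((1 + u * EW i j) * g), s, ts; split=> //.
- apply: (ggl K n (Egen K n I) (sv (1 + u * EW i j)) (sv g)) => //.
  exists (sv u), (sval i), (sval j); split; first exact: Rel_SC hu.
  split; last by rewrite /= -sv_EE.
  apply: contrapT => nk; apply: ij; apply: W_eq => k kI; apply: contrapT => ne.
  by apply: nk; exists k.
- by rewrite eg.
- by apply/funext => v; rewrite ets.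
Qed.

Lemma W_infinite : I != set0 -> forall r (f : 'I_r -> W), exists w, forall i, w <> f i.
Proof.
case/set0Pn => k0 k0I r f; pose M := (\max_i sval (f i) k0).+1.
have P k : k \notin I -> (if k == k0 then M else 0%N) = 0%N by case: eqP => // ->; rewrite k0I.
exists (exist _ (fun k => if k == k0 then M else 0%N) P) => i /(congr1 (fun w : W => sval w k0)) /=.
rewrite eqxx => e; have := @leq_bigmax _ (fun i => sval (f i) k0) i.
by rewrite -e ltnn.
Qed.

(** The round trip: [u] becomes an invertible matrix over the Laurent ring, splits there into a
    monomial unit and transvections, and these are lifted back. *)
Lemma level_tower u u' : I != set0 -> u * u' = 1 -> u' * u = 1 ->
  (forall k, k \in I -> Z (I :\ k) (u - 1)) ->
  exists l a b g, [/\ l != 0, Einf K n I (sv g) & Z I (u - Dd l a b * g)].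
Proof.
move=> I0 uu' u'u hu.
have hu' k : k \in I -> Z (I :\ k) (u' - 1).
  move=> kI; have -> : u' - 1 = - (u' * (u - 1)) by rewrite mulrBr u'u mulr1 opprB.
  by apply: ZN; apply: ZMl; apply: hu.
have [h [t [H Zh]]] := AR_finite hu; have [h' [t' [H' Zh']]] := AR_finite hu'.
have Zhh : Z I ((1 + h) * (1 + h') - 1).
  have -> : (1 + h) * (1 + h') - 1 = - ((u - 1 - h) * (1 + h')) - u * (u' - 1 - h').
    have -> : u - 1 - h = u - (1 + h) by rewrite opprD addrA.
    have -> : u' - 1 - h' = u' - (1 + h') by rewrite opprD addrA.
    by rewrite mulrBl mulrBr uu' !opprB addrA subrK.
  by apply: ZB; [apply: ZN; apply: ZMr|apply: ZMl].
have [r [f [A [A' [fi e1 _ AA']]]]] := AR_pair H H' Zhh.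
have D := KG_sound (@monouV _ _ _ kap x xi c (tw_inv tw)) (W_infinite I0) (tw_KG tw AA') fi.
have [c0 [e [[l [a [b [l0 ec]]]] Ee] eD]] :=
  DE_normal (monou1 kap x xi c) (@monouM _ _ _ kap x xi c) (@monouV _ _ _ kap x xi c (tw_inv tw)) W0 D.
have [g [hg [tg [Eg Hg eg etg]]]] := ET_lift Ee.
have Hc : Rel (kS n l * mm a b - 1) (c0 - 1).
  apply: Rel_D; last exact: Rel_N Rel_1.
  by rewrite ec -mulrA; apply: Rel_M; [exact: Rel_c|exact: Rel_mm].
have [s [ts [Hs es ets]]] := AR_comp1 (AR_1 W0 W0 Hc) Hg.
exists l, a, b, g; split=> //.
have tts : t = ts.
  apply/funext => v; apply/funext => w; apply: (addrI (v w)).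
  have := congr1 (fun T : wop L W => T v w) e1; rewrite /= => ->.
  have := congr1 (fun T : W -> L => T w) (ets v); rewrite /= => ->.
  rewrite eD etg /= /dg; case: asboolP => [->|_]; last by rewrite addr0.
  by move: (_ + tg _ _) => y; rewrite mulrBl mul1r addrC subrK.
have Zs : Z I (h - s).
  apply/(AR_Z (AR_D H (AR_N Hs))); apply/funext => v; apply/funext => w.
  by rewrite tts subrr.
have -> : u - Dd l a b * g = (u - 1 - h) + (h - s).
  by rewrite addrA subrK eg /Dd -EW00 es opprD addrA.
exact: ZD.
Qed.

(** Direct finiteness modulo [Z I], which takes the place of a Fredholm index. *)
Lemma fin_side_tower (w v : Sop) : (forall k, k \in I -> Z (I :\ k) (w - 1)) ->
  Z I (w * v - 1) -> Z I (v * w - 1).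
Proof.
move=> hw Zv; have [h [t [H Zh]]] := AR_finite hw.
have eh : w - 1 - h = w - (1 + h) by rewrite opprD addrA.
rewrite eh in Zh.
have Z1 : Z I ((1 + h) * v - 1).
  have -> : (1 + h) * v - 1 = (w * v - 1) - (w - (1 + h)) * v.
    by rewrite mulrBl opprB [RHS]addrC addrA subrK.
  by apply: ZB => //; apply: ZMr.
have -> : v * w - 1 = (v * (1 + h) - 1) + v * (w - (1 + h)).
  by rewrite mulrBr [RHS]addrC addrA subrK.
by apply: ZD; [apply: AR_side Z1; exact: H|apply: ZMl].
Qed.

End Symbol.

Lemma level (K : fieldType) n (I : {set 'I_n}) (u u' : Sop K n) : I != set0 ->
  u * u' = 1 -> u' * u = 1 -> (forall k, k \in I -> Z (I :\ k) (u - 1)) ->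
  exists l a b g, [/\ l != 0, Einf K n I (sv g) & Z I (u - Dd I l a b * g)].
Proof.
have [L [kap [x [xi tw]]]] := laurent_tower K (enum_uniq (~: I)).
by move=> I0 h1 h2 h3; have := level_tower tw I0 h1 h2 h3.
Qed.

Lemma fin_side (K : fieldType) n (I : {set 'I_n}) (w v : Sop K n) :
  (forall k, k \in I -> Z (I :\ k) (w - 1)) -> Z I (w * v - 1) -> Z I (v * w - 1).
Proof.
have [L [kap [x [xi tw]]]] := laurent_tower K (enum_uniq (~: I)).
by move=> h1 h2; have := fin_side_tower tw h1 h2.
Qed.

(** * Congruences, face exponents and the elements [theta] *)

Section Congruences.
Variables (K : fieldType) (n : nat).
Local Notation Sop := (Sop K n).
Local Notation X := (X K (n := n)).
Local Notation Y := (Y K (n := n)).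
Local Notation XX := (XX K (n := n)).
Local Notation YY := (YY K (n := n)).
Local Notation e_ := (e_ K (n := n)).
Local Notation mm := (mm K (n := n)).
Implicit Types (I J A : {set 'I_n}) (u v w p q : Sop) (a b : 'I_n -> nat).

Definition cg A u v := Z A (u - v).

Lemma cgR A u : cg A u u. Proof. by rewrite /cg subrr; apply: Z0. Qed.
Lemma cgS A u v : cg A u v -> cg A v u.
Proof. by rewrite /cg => h; rewrite -opprB; apply: ZN. Qed.
Lemma cgT A u v w : cg A u v -> cg A v w -> cg A u w.
Proof. by rewrite /cg => h1 h2; rewrite -[u](subrK v) -addrA; apply: ZD. Qed.
Lemma cgM A u u' v v' : cg A u u' -> cg A v v' -> cg A (u * v) (u' * v').
Proof.
rewrite /cg => h1 h2; have -> : u * v - u' * v' = (u - u') * v + u' * (v - v').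
  by rewrite mulrBl mulrBr addrA subrK.
by apply: ZD; [apply: ZMr|apply: ZMl].
Qed.
Lemma cgMl A u v v' : cg A v v' -> cg A (u * v) (u * v').
Proof. by move=> h; apply: cgM h; apply: cgR. Qed.
Lemma cgMr A u u' v : cg A u u' -> cg A (u * v) (u' * v).
Proof. by move=> h; apply: (cgM h); apply: cgR. Qed.
Lemma cg_sub A (B : {set 'I_n}) u v : A \subset B -> cg B u v -> cg A u v.
Proof. exact: Z_sub. Qed.
Lemma cg_inv A u u' v v' : cg A (u' * u) 1 -> cg A (v * v') 1 -> cg A u v -> cg A u' v'.
Proof.
move=> h1 h2 h; apply: (@cgT _ _ (u' * (v * v'))); first by rewrite -{1}[u']mulr1; apply/cgMl/cgS.
rewrite mulrA -{2}[v']mul1r; apply: cgMr; apply: cgT h1; apply: cgMl; exact: cgS.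
Qed.

Definition oe p I : Sop := 1 + (p - 1) * e_ I.

Lemma oe_mul p q I : q * e_ I = e_ I * q -> oe p I * oe q I = oe (p * q) I.
Proof.
move=> qe; rewrite /oe mulrDl mul1r mulrDr mulr1.
have -> : (p - 1) * e_ I * ((q - 1) * e_ I) = (p - 1) * (q - 1) * e_ I.
  rewrite -!mulrA; congr (_ * _); rewrite [e_ I * _]mulrA.
  have -> : e_ I * (q - 1) = (q - 1) * e_ I by rewrite mulrBr mulrBl qe mulr1 mul1r.
  by rewrite -mulrA e_id.
rewrite -addrA; congr (_ + _); rewrite -mulrDl -mulrDl; congr (_ * _).
by rewrite [(p - 1) * (q - 1)]mulrBr mulr1 [p - 1 + _]addrC subrK mulrBl mul1r addrC addrA subrK.
Qed.

Lemma oe_cg1 p I A : ~~ (I \subset A) -> cg A (oe p I) 1.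
Proof. by move=> IA; rewrite /cg /oe addrAC subrr add0r; apply: ZMl; apply: Z_EE. Qed.

Lemma oe_cg p q I A : cg A p q -> cg A (oe p I) (oe q I).
Proof.
move=> h; rewrite /cg /oe opprD addrACA subrr add0r -mulrBl opprB addrA subrK.
exact: ZMr.
Qed.

Lemma oe1 I : oe 1 I = 1. Proof. by rewrite /oe subrr mul0r addr0. Qed.

Lemma YY_XX g h : (forall k, (g k <= h k)%N) -> YY g * XX h = XX (fun k => (h k - g k)%N).
Proof. by move=> gh; rewrite (XX_sub K gh) mulrA YYXX mul1r. Qed.

Lemma XXmm I a b (N : nat) : (forall k, (b k <= N)%N) ->
  mm I a b * XX (cst I N) = XX (fun k => (rs I a k + (cst I N k - rs I b k))%N).
Proof.
move=> bN; rewrite /mm -mulrA YY_XX ?XXD // => k.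
by rewrite /rs /cst; case: ifP.
Qed.

(** Modulo [Z I] each [y_k] with [k] outside [I] is inverse to [x_k], so only the differences
    [a - b] off [I] matter. *)
Lemma mm_cg I a b a' b' : (forall k, k \notin I -> (a k + b' k = a' k + b k)%N) ->
  cg I (mm I a b) (mm I a' b').
Proof.
move=> h; exists (\max_k (b k + b' k))%N.
have bN k : (b k + b' k <= \max_k (b k + b' k))%N by apply: (leq_bigmax k).
rewrite mulrBl !XXmm; try by move=> k; have := bN k; lia.
rewrite (_ : XX _ = XX (fun k => (rs I a' k + (cst I (\max_k (b k + b' k)) k - rs I b' k))%N)) ?subrr //.
apply: eq_XX => k; rewrite /rs /cst; case: (boolP (k \in I)) => // /h; have := bN k; lia.
Qed.

Lemma mm_in I a b : Sin (fun k => k \notin I) (mm I a b).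
Proof. by apply: Sin_M; [apply: XX_in|apply: YY_in] => k; rewrite negbK /rs => ->. Qed.

Lemma mmM I a b a' b' : cg I (mm I a b * mm I a' b')
  (mm I (fun k => (a k + a' k)%N) (fun k => (b k + b' k)%N)).
Proof.
exists (\max_k (b k + b' k))%N.
have bN k : (b k + b' k <= \max_k (b k + b' k))%N by apply: (leq_bigmax k).
rewrite mulrBl -mulrA !XXmm; try by move=> k; have := bN k; lia.
rewrite /mm -mulrA YY_XX ?XXD; last first.
  by move=> k; have := bN k; rewrite /rs /cst; case: ifP => // _; lia.
rewrite (_ : XX _ = XX (fun k => (rs I (fun k => (a k + a' k)%N) k +
  (cst I (\max_k (b k + b' k)) k - rs I (fun k => (b k + b' k)%N) k))%N)) ?subrr //.
by apply: eq_XX => k; have := bN k; rewrite /rs /cst; case: ifP => // _; lia.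
Qed.

Lemma mm_e I J a b : I \subset J -> mm J a b * e_ I = e_ I * mm J a b.
Proof.
move=> IJ; apply: EE_comm; apply: Sin_sub (mm_in J a b) => k.
by apply: contra; apply: (subsetP IJ).
Qed.

Lemma rs0 I : rs I (fun=> 0%N) = (fun=> 0%N).
Proof. by apply/funext => k; rewrite /rs if_same. Qed.

Lemma mm0 I : mm I (fun=> 0%N) (fun=> 0%N) = 1.
Proof.
by rewrite /mm rs0 XX0 YY0 mulr1.
Qed.

Lemma DdE I l a b : Dd I l a b = oe (kS n l * mm I a b) I. Proof. by []. Qed.

Lemma DdM I l a b l' a' b' : cg I (Dd I l a b * Dd I l' a' b')
  (Dd I (l * l') (fun k => (a k + a' k)%N) (fun k => (b k + b' k)%N)).
Proof.
rewrite !DdE oe_mul; last by rewrite -mulrA mm_e // !mulrA kSC.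
apply: oe_cg.
have -> : kS n l * mm I a b * (kS n l' * mm I a' b') = kS n (l * l') * (mm I a b * mm I a' b').
  move: (mm I a b) (mm I a' b') => y z.
  by rewrite -kSM -!mulrA; congr (_ * _); rewrite mulrA -kSC -mulrA.
exact/cgMl/mmM.
Qed.

Lemma Dd_cg I l a b a' b' : (forall k, k \notin I -> (a k + b' k = a' k + b k)%N) ->
  cg I (Dd I l a b) (Dd I l a' b').
Proof. by move=> h; rewrite !DdE; apply/oe_cg/cgMl/mm_cg. Qed.

Lemma Dd1 I : Dd I 1 (fun=> 0%N) (fun=> 0%N) = 1 :> Sop.
Proof. by rewrite DdE mm0 mulr1 kS1 oe1. Qed.

Lemma Dd_eq1 I a b : (forall k, k \notin I -> a k = b k) -> cg I (Dd I 1 a b) 1.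
Proof. by move=> h; rewrite -(Dd1 I); apply: Dd_cg => k /h ->; lia. Qed.

Lemma Dd_inv I a b : cg I (Dd I 1 a b * Dd I 1 b a) 1.
Proof. by apply: cgT (DdM _ _ _ _ _ _ _) _; rewrite mulr1; apply: Dd_eq1 => k _; rewrite addnC. Qed.

Lemma cg_prod (T : eqType) (s : seq T) (F : T -> Sop) k0 A : uniq s ->
  (forall k, k \in s -> k != k0 -> cg A (F k) 1) ->
  cg A (\prod_(k <- s) F k) (if k0 \in s then F k0 else 1).
Proof.
elim: s => [|k s IH] /=; first by rewrite big_nil => _ _; apply: cgR.
case/andP=> ks us h; rewrite big_cons inE.
have {}IH := IH us (fun j js => h j (mem_behead (s := k :: s) js)).
case: (eqVneq k0 k) => [e|ne] /=.
  rewrite e (negPf ks) in IH *; rewrite -[X in cg _ _ X]mulr1; exact: cgMl.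
rewrite -[X in cg _ _ X]mul1r; apply: cgM IH; apply: h; rewrite ?mem_head // eq_sym //.
Qed.

Lemma cg_prod_unit (T : eqType) (s : seq T) (F G : T -> Sop) A :
  (forall k, k \in s -> cg A (F k * G k) 1 /\ cg A (G k * F k) 1) ->
  exists P', cg A ((\prod_(k <- s) F k) * P') 1 /\ cg A (P' * \prod_(k <- s) F k) 1.
Proof.
elim: s => [|k s IH] h; first by exists 1; rewrite big_nil mulr1; split; apply: cgR.
have [|P' [h1 h2]] := IH; first by move=> j js; apply: h; rewrite inE js orbT.
have [g1 g2] := h k (mem_head k s); rewrite big_cons; exists (P' * G k); split.
  rewrite -mulrA (mulrA _ P'); apply: cgT g1; rewrite -{2}[G k]mul1r.
  by apply: cgMl; apply: cgMr.
rewrite -mulrA (mulrA (G k)); apply: cgT h2; rewrite -{2}[\prod_(_ <- _) _]mul1r.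
by apply: cgMl; apply: cgMr.
Qed.

Lemma e_notZ J : ~ Z J (e_ J).
Proof.
move=> h; have : Z J (1 : Sop) by apply: Z_e; [exact: Sin_1|rewrite mul1r].
case=> N; rewrite mul1r => e; have := YYXX K (cst J N); rewrite e mulr0 => /eqP.
by rewrite eq_sym oner_eq0.
Qed.

Lemma Yn_e J m d : m \in J -> (0 < d)%N -> Y m ^+ d * e_ J = 0.
Proof. by move=> mJ; case: d => // d _; rewrite exprSr -mulrA Y_EE // mulr0. Qed.

(** If the exponent of [x_m] on [J \ m] were [d > 0], left factors, among them [W'] containing
    [y_m^d], would turn [u] into a finitary perturbation of 1 modulo [Z J] with a right inverse.
    Then [fin_side] makes it invertible and forces [W W'] to be 1 modulo [Z J], although
    [W' e_J = 0]. This covers the case of the index formula in which all other faces have exponent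
    zero. *)
Lemma index_le u u' J m (a b : 'I_n -> 'I_n -> nat) : u * u' = 1 -> u' * u = 1 -> m \in J ->
  (forall k, k \in J -> cg (J :\ k) u (Dd (J :\ k) 1 (a k) (b k))) ->
  (forall k, k \in J -> k != m -> a k k = b k k) -> (a m m <= b m m)%N.
Proof.
move=> uu' u'u mJ hu hab; rewrite leqNgt; apply/negP => ba.
pose d := (a m m - b m m)%N; have d0 : (0 < d)%N by rewrite /d; lia.
pose Jm k := J :\ k; pose pk k := mm J (a k) (b k); pose qk k := mm J (b k) (a k).
have qp k A : A \subset J -> cg A (qk k * pk k) 1.
  move=> AJ; apply: (cg_sub AJ); apply: cgT (mmM _ _ _ _ _) _.
  by rewrite -(mm0 J); apply: mm_cg => j _; lia.
have pq k A : A \subset J -> cg A (pk k * qk k) 1.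
  move=> AJ; apply: (cg_sub AJ); apply: cgT (mmM _ _ _ _ _) _.
  by rewrite -(mm0 J); apply: mm_cg => j _; lia.
have JmJ k : Jm k \subset J by apply: subsetDl.
have Jn k k' : k \in J -> k' \in J -> k' != k -> ~~ (Jm k \subset Jm k').
  by move=> kJ k'J kk; apply/subsetPn; exists k'; rewrite !inE ?kk ?k'J ?eqxx.
(* [Pi] undoes [u] on the faces other than [J \ m]. Monomials in the variables outside [J] suffice,
   since there the exponent of [x_k] on [J \ k] is zero. *)
pose Pi := \prod_(k <- enum (J :\ m)) oe (qk k) (Jm k).
have [Pi' [PP' P'P]] : exists P', cg J (Pi * P') 1 /\ cg J (P' * Pi) 1.
  apply: (@cg_prod_unit _ _ _ (fun k => oe (pk k) (Jm k))) => k _.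
  rewrite !oe_mul; try exact: mm_e.
  by split; rewrite -(oe1 (Jm k)); apply: oe_cg; [apply: qp|apply: pq].
(* [W] represents [u] on [J \ m]. Since [y_m^d x_m^d = 1], the product [W' W] is 1 modulo [Z J]; the
   other order is what must fail. *)
pose W := oe (X m ^+ d * pk m) (Jm m); pose W' := oe (qk m * Y m ^+ d) (Jm m).
have Yd : Y m ^+ d * X m ^+ d = 1.
  elim: d {d0 W W'} => [|d IH]; first by rewrite !expr0 mulr1.
  by rewrite exprSr exprS mulrA -(mulrA (Y m ^+ d)) -YY_del -XX_del YYXX mulr1 YY_del XX_del IH.
have Xin : Sin (fun k => k \notin Jm m) (X m ^+ d * pk m).
  apply: Sin_M; first by apply: Sin_exp; apply: Sin_X; rewrite !inE eqxx.
  by apply: Sin_sub (mm_in J _ _) => k; rewrite !inE => /negPf ->; rewrite andbF.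
have W'W : cg J (W' * W) 1.
  rewrite oe_mul; last exact: EE_comm.
  by rewrite mulrA -(mulrA (qk m)) Yd mulr1 -(oe1 (Jm m)); apply: oe_cg; apply: qp.
have W'e : W' * e_ J = 0.
  rewrite /W' /oe mulrDl mul1r -mulrA e_U.
  have -> : Jm m :|: J = J by apply/setUidPr.
  by rewrite mulrBl mul1r -mulrA Yn_e // mulr0 sub0r subrr.
pose u3 := Pi * u.
have Wm : cg (Jm m) u W.
  apply: cgT (hu m mJ) _; rewrite DdE kS1 mul1r; apply: oe_cg.
  pose a2 k := if k == m then d else a m k; pose b2 k := if k == m then 0%N else b m k.
  have -> : X m ^+ d * pk m = mm (Jm m) a2 b2.
    rewrite /pk /mm mulrA; congr (_ * _); last first.
      congr YY; apply/funext => k; rewrite /rs /b2 !inE; case: (eqVneq k m) => [->|] //=.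
      by rewrite mJ.
    have -> : X m ^+ d = XX (fun k => (d * del m k)%N).
      apply: SopP => f c; rewrite XnE XX_E.
      have -> : [forall k, (d * del m k <= c k)%N] = (d <= c m)%N.
        apply/forallP/idP => [/(_ m)|h k]; rewrite /del ?eqxx ?muln1 //.
        by case: eqP => [->|_]; rewrite ?muln1 ?muln0.
      case: ifP => // _; congr (f _); apply/funext => k; rewrite /del.
      by case: eqP => _; rewrite ?muln1 ?muln0 ?subn0.
    rewrite XXD; apply: eq_XX => k; rewrite /rs /a2 /del !inE.
    by case: (eqVneq k m) => [->|] //=; rewrite ?mJ ?muln1 ?muln0 ?addn0.
  apply: mm_cg => k; rewrite /a2 /b2 !inE; case: (eqVneq k m) => [->|_] /= _; last by lia.
  by rewrite /d; lia.
have Z3 k : k \in J -> cg (Jm k) (W' * u3) 1.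
  move=> kJ; case: (eqVneq k m) => [->|km].
    apply: cgT (cg_sub (JmJ m) W'W); apply: cgMl; rewrite /u3 -[X in cg _ _ X]mul1r; apply: cgM => //.
    have := @cg_prod _ (enum (J :\ m)) (fun k => oe (qk k) (Jm k)) m (Jm m) (enum_uniq _).
    rewrite mem_enum !inE eqxx; apply => j; rewrite mem_enum !inE => /andP [jm jJ] _.
    by apply: oe_cg1; apply: Jn => //; rewrite eq_sym.
  rewrite -[X in cg _ _ X]mul1r; apply: cgM.
    by apply: oe_cg1; apply: Jn.
  apply: (@cgT _ _ (oe (qk k) (Jm k) * oe (pk k) (Jm k))).
    apply: cgM.
      have := @cg_prod _ (enum (J :\ m)) (fun k => oe (qk k) (Jm k)) k (Jm k) (enum_uniq _).
      rewrite mem_enum !inE km kJ; apply => j; rewrite mem_enum !inE => /andP [jm jJ] jk.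
      by apply: oe_cg1; apply: Jn => //; rewrite eq_sym.
    apply: cgT (hu k kJ) _; rewrite DdE kS1 mul1r; apply: oe_cg.
    pose a2 j := if j == k then 0%N else a k j; pose b2 j := if j == k then 0%N else b k j.
    have -> : pk k = mm (Jm k) a2 b2.
      rewrite /pk /mm; congr (XX _ * YY _); apply/funext => j; rewrite /rs /a2 /b2 !inE;
        by case: (eqVneq j k) => [->|] //=; rewrite kJ.
    apply: mm_cg => j; rewrite /a2 /b2 !inE; case: (eqVneq j k) => [->|_] /= _; last by lia.
    by rewrite hab // addn0.
  rewrite oe_mul; last exact: mm_e.
  by rewrite -(oe1 (Jm k)); apply: oe_cg; apply: qp.
pose v := u' * Pi' * W.
have wv : cg J (W' * u3 * v) 1.
  have -> : W' * u3 * v = W' * (Pi * (u * u') * Pi') * W by rewrite /u3 /v !mulrA.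
  rewrite uu' mulr1; apply: cgT W'W; rewrite -{2}[W']mulr1.
  by apply: cgMr; apply: cgMl.
have vw := fin_side Z3 wv.
have WW' : cg J (W * W') 1.
  apply: (@cgT _ _ (Pi * u * (v * (W' * u3)) * (u' * Pi'))).
    have -> : Pi * u * (v * (W' * u3)) * (u' * Pi') = Pi * (u * u') * Pi' * (W * W') * (Pi * (u * u') * Pi').
      by rewrite /v /u3 !mulrA.
    rewrite uu' mulr1 -{1}[W * W']mulr1 -{1}[W * W']mul1r.
    by apply: cgM; [apply: cgM; [exact: cgS|exact: cgR]|exact: cgS].
  apply: (@cgT _ _ (Pi * u * 1 * (u' * Pi'))); first by apply: cgMr; apply: cgMl.
  by rewrite mulr1 mulrA -(mulrA Pi) uu' mulr1.
apply: (@e_notZ J).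
have := cgMr (e_ J) WW'; rewrite -mulrA W'e mulr0 mul1r => /cgS.
by rewrite /cg subr0.
Qed.

(** The reverse inequality is [index_le] for the inverse of [u], whose exponents are
    interchanged. *)
Lemma index_eq u u' J m (a b : 'I_n -> 'I_n -> nat) : u * u' = 1 -> u' * u = 1 -> m \in J ->
  (forall k, k \in J -> cg (J :\ k) u (Dd (J :\ k) 1 (a k) (b k))) ->
  (forall k, k \in J -> k != m -> a k k = b k k) -> a m m = b m m.
Proof.
move=> uu' u'u mJ hu hab; apply/eqP; rewrite eqn_leq (index_le uu' u'u mJ hu hab) /=.
apply: (index_le u'u uu' mJ (a := b) (b := a)) => [k kJ|k kJ km]; last by rewrite hab.
apply: cg_inv (hu k kJ); last exact: Dd_inv.
by rewrite u'u; apply: cgR.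
Qed.

Definition th (i j : 'I_n) J : Sop := oe (Y i) (J :\ i) * oe (X j) (J :\ j).

Lemma sv_th i j J : sv (th i j J) = theta K n i j J.
Proof.
have eJ (k : 'I_n) : [set l in J | nat_of_ord l != k] = J :\ k.
  by apply/setP => l; rewrite !inE andbC.
by rewrite /theta !eJ -!sv_e.
Qed.

(** The inner product is [oe (x_j y_j) (J \ j) = 1 - e_J], and its defect [e_J] is annihilated by
    the outer factor because [y_i e_J = 0]. *)
Lemma th_inv i j J : i \in J -> j \in J -> i != j -> th i j J * th j i J = 1.
Proof.
move=> iJ jJ ij; rewrite /th -mulrA (mulrA (oe (X j) _)).
have cX (k : 'I_n) : X k * e_ (J :\ k) = e_ (J :\ k) * X k.
  by apply: EE_comm; apply: Sin_X; rewrite !inE eqxx.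
have cY (k : 'I_n) : Y k * e_ (J :\ k) = e_ (J :\ k) * Y k.
  by apply: EE_comm; apply: Sin_Y; rewrite !inE eqxx.
rewrite oe_mul //.
have -> : oe (X j * Y j) (J :\ j) = 1 - e_ J.
  rewrite /oe; congr (1 + _).
  have -> : X j * Y j - 1 = - e_ [set j].
    by rewrite /e_ /EE enum_set1 big_seq1 /E1 !expr0 !expr1 mulr1 opprB.
  by rewrite mulNr e_U setD1K.
have Ye : oe (Y i) (J :\ i) * e_ J = 0.
  rewrite /oe mulrDl mul1r -mulrA e_U.
  have -> : J :\ i :|: J = J by apply/setUidPr; apply: subsetDl.
  by rewrite mulrBl mul1r -[Y i]expr1 Yn_e // sub0r subrr.
rewrite mulrBl mul1r mulrBr mulrA Ye mul0r subr0 oe_mul //.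
by rewrite -YY_del -XX_del YYXX oe1.
Qed.

Lemma th_cg1 i j J A : ~~ (J :\ i \subset A) -> ~~ (J :\ j \subset A) -> cg A (th i j J) 1.
Proof. by move=> hi hj; rewrite -[X in cg _ _ X]mulr1; apply: cgM; apply: oe_cg1. Qed.

(** With [th_cgj] and [th_cg1]: [theta] moves one unit of exponent from [x_i] on the face [J \ i] to
    [x_j] on the face [J \ j] and is trivial on the other faces. *)
Lemma th_cgi i j J : i \in J -> j \in J -> i != j ->
  cg (J :\ i) (th i j J) (Dd (J :\ i) 1 (fun=> 0%N) (del i)).
Proof.
move=> iJ jJ ij; rewrite -[X in cg _ _ X]mulr1; apply: cgM; last first.
  by apply: oe_cg1; apply/subsetPn; exists i; rewrite !inE ?ij ?iJ ?eqxx.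
rewrite DdE kS1 mul1r; apply: oe_cg.
rewrite (_ : mm _ _ _ = Y i); first exact: cgR.
rewrite /mm rs0 XX0 mul1r -YY_del; congr YY; apply/funext => k; rewrite /rs /del !inE.
by case: (eqVneq k i) => //= _; rewrite if_same.
Qed.

Lemma th_cgj i j J : i \in J -> j \in J -> i != j ->
  cg (J :\ j) (th i j J) (Dd (J :\ j) 1 (del j) (fun=> 0%N)).
Proof.
move=> iJ jJ ij; rewrite -[X in cg _ _ X]mul1r; apply: cgM.
  by apply: oe_cg1; apply/subsetPn; exists j; rewrite !inE ?jJ ?eqxx // eq_sym ij.
rewrite DdE kS1 mul1r; apply: oe_cg.
rewrite (_ : mm _ _ _ = X j); first exact: cgR.
rewrite /mm rs0 YY0 mulr1 -XX_del; apply: eq_XX => k; rewrite /rs /del !inE.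
by case: (eqVneq k j) => //= _; rewrite if_same.
Qed.

Lemma cg_exp I u a b m : cg I u (Dd I 1 a b) ->
  cg I (u ^+ m) (Dd I 1 (fun k => (m * a k)%N) (fun k => (m * b k)%N)).
Proof.
move=> h; elim: m => [|m IH].
  by rewrite expr0 -(Dd1 I); apply: Dd_cg => k _; lia.
rewrite exprS; apply: cgT (cgM h IH) _; apply: cgT (DdM _ _ _ _ _ _ _) _; rewrite mulr1.
by apply: Dd_cg => k _; rewrite !mulSn; lia.
Qed.

End Congruences.

(** * The factors as units, and the top level *)

Section Units.
Variables (K : fieldType) (n : nat).
Local Notation Sop := (Sop K n).
Local Notation X := (X K (n := n)).
Local Notation Y := (Y K (n := n)).
Local Notation EE := (EE K (n := n)).
Local Notation e_ := (e_ K (n := n)).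
Local Notation ep := (ep K (n := n)).
Local Notation E1 := (E1 K (n := n)).
Implicit Types (I J A : {set 'I_n}) (Q : {set 'I_n} -> bool).

(** The common form of all the unit groups in the theorem, each given by its own family [Q] of
    sets. *)
Definition UG Q (u : op K n) :=
  exists g g' : Sop, [/\ sv g = u, g * g' = 1, g' * g = 1 & forall A, Q A -> cg A g 1].

Lemma UG_sub Q Q' u : (forall A, Q A -> Q' A) -> UG Q' u -> UG Q u.
Proof. by move=> QQ [g [g' [e h1 h2 h]]]; exists g, g'; split=> // A /QQ; apply: h. Qed.

Lemma UG_1 Q : UG Q (o1 K n).
Proof. by exists 1, 1; rewrite mulr1; split=> // A _; apply: cgR. Qed.

Lemma UG_mul Q u v : UG Q u -> UG Q v -> UG Q (omul K n u v).
Proof.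
move=> [g [g' [<- h1 h2 h]]] [k [k' [<- h3 h4 h5]]]; exists (g * k), (k' * g'); split=> //.
- by rewrite mulrA -(mulrA g) h3 mulr1.
- by rewrite mulrA -(mulrA k') h2 mulr1.
- by move=> A QA; rewrite -[1]mulr1; apply: cgM; [apply: h|apply: h5].
Qed.

Lemma op_inv_uniq (g g' : Sop) (v : op K n) : g * g' = 1 -> omul K n v (sv g) = o1 K n -> v = sv g'.
Proof.
move=> gg' vg; have e : omul K n v (omul K n (sv g) (sv g')) = v.
  by have := congr1 (fun w => omul K n v (sv w)) gg'.
by rewrite -e (_ : omul K n v _ = omul K n (omul K n v (sv g)) (sv g')) // vg.
Qed.

Lemma UG_inv Q u v : UG Q u -> omul K n v u = o1 K n -> UG Q v.
Proof.
move=> [g [g' [<- h1 h2 h]]] /(op_inv_uniq h1) ->; exists g', g; split=> // A QA.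
apply: (@cg_inv _ _ A g g' 1 1); [by rewrite h2; apply: cgR|by rewrite mulr1; apply: cgR|exact: h].
Qed.

Lemma UG_exp Q u m : UG Q u -> UG Q (oexp K n u m).
Proof. by move=> h; elim: m => [|m IH]; [apply: UG_1|apply: UG_mul]. Qed.

Lemma UG_powers Q u v : UG Q u -> powers K n u v -> UG Q v.
Proof.
move=> h [m [->|[w [_ [wu ->]]]]]; first exact: UG_exp.
by apply: UG_exp; apply: UG_inv h wu.
Qed.

Lemma UG_setprod Q s u : (forall B, List.In B s -> forall v, B v -> UG Q v) ->
  setprod K n s u -> UG Q u.
Proof.
elim: s u => [|B s IH] u h /=; first by move=> ->; apply: UG_1.
case=> a [b [Ba [hb ->]]]; apply: UG_mul; first by apply: (h B) => //; left.
by apply: IH => // B' hB'; apply: h; right.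
Qed.

Lemma EE_sq0 al be I (a : Sop) : Sin (fun k => k \notin I) a -> (exists k, k \in I /\ al k <> be k) ->
  (a * EE al be I) * (a * EE al be I) = 0.
Proof.
move=> ha [k [kI ne]]; rewrite mulrA -(mulrA a) -EE_comm // mulrA -mulrA EEM.
by case: forall_inP => [/(_ k kI) /eqP e|]; [case: ne|rewrite mulr0].
Qed.

(** The coefficient commutes with the off-diagonal matrix unit, so [p] has square zero and [1 - p]
    is the inverse of [1 + p]. *)
Lemma Egen_lift I u : Egen K n I u -> exists g g' : Sop,
  [/\ sv g = u, g * g' = 1, g' * g = 1, Egen K n I (sv g') & forall A, ~~ (I \subset A) -> cg A g 1].
Proof.
case=> a [al [be [Sa [ne ->]]]].
have sub w : subalg K n (fun k => k \notin I) w -> Sn K n w.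
  by elim=> {w} *; [apply: sa_scal|apply: sa_X|apply: sa_Y|apply: sa_add|apply: sa_mul].
pose a' := MkS (sub _ Sa); have ha : Sin (fun k => k \notin I) a' by [].
have z := EE_sq0 ha ne; set p := a' * EE al be I in z.
exists (1 + p), (1 - p); split.
- by rewrite /= -sv_EE.
- by rewrite mulrBr mulr1 mulrDl mul1r z addr0 addrK.
- by rewrite mulrBl mul1r mulrDr mulr1 z addr0 addrK.
- exists (sv (- a')), al, be; split; first exact: Sin_N ha.
  by split=> //; rewrite -sv_EE (_ : 1 - p = 1 + (- a') * EE al be I) // mulNr.
- by move=> A IA; rewrite /cg addrAC subrr add0r; apply: ZMl; apply: Z_EE.
Qed.

Lemma Einf_mul I u v : Einf K n I u -> Einf K n I v -> Einf K n I (omul K n u v).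
Proof.
elim=> {u} [//|g h Gg _ IH|g w h Gg gw wg _ IH] Ev.
  exact: (ggl _ _ _ g (omul K n h v) Gg (IH Ev)).
exact: (ggi _ _ _ g w (omul K n h v) Gg gw wg (IH Ev)).
Qed.

Lemma Einf_gen I u : Egen K n I u -> Einf K n I u.
Proof. by move=> h; apply: (ggl _ _ _ u (o1 K n) h); apply: gg1. Qed.

Lemma Einf_lift I u : Einf K n I u -> exists g g' : Sop,
  [/\ sv g = u, g * g' = 1, g' * g = 1, Einf K n I (sv g') & forall A, ~~ (I \subset A) -> cg A g 1].
Proof.
elim=> {u} [|g h Gg _ [k [k' [<- h1 h2 h3 h4]]]|g w h Gg gw wg _ [k [k' [<- h1 h2 h3 h4]]]].
- by exists 1, 1; rewrite mulr1; split=> //; [apply: gg1|move=> A _; apply: cgR].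
- have [g1 [g2 [e1 e2 e3 e4 e5]]] := Egen_lift Gg; subst g.
  exists (g1 * k), (k' * g2); split=> //.
  + by rewrite mulrA -(mulrA g1) h1 mulr1.
  + by rewrite mulrA -(mulrA k') e3 mulr1.
  + by apply: Einf_mul => //; apply: Einf_gen.
  + by move=> A IA; rewrite -[1]mulr1; apply: cgM; [apply: e5|apply: h4].
- have [g1 [g2 [e1 e2 e3 e4 e5]]] := Egen_lift Gg; subst g.
  have ew := op_inv_uniq e2 wg; subst w.
  exists (g2 * k), (k' * g1); split=> //.
  + by rewrite mulrA -(mulrA g2) h1 mulr1.
  + by rewrite mulrA -(mulrA k') e2 mulr1.
  + by apply: Einf_mul => //; apply: Einf_gen.
  + move=> A IA; rewrite -[1]mulr1; apply: cgM; last exact: h4.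
    apply: (@cg_inv _ _ A g1 g2 1 1); [by rewrite e3; apply: cgR|by rewrite mulr1; apply: cgR|exact: e5].
Qed.

Lemma sv_mu I l : sv (Dd I l (fun=> 0%N) (fun=> 0%N)) = mu K n I l.
Proof.
rewrite DdE mm0 mulr1 /oe; apply: opP => f a.
rewrite svDE sv1E svME svBE sv1E kSE sv_e /mu /oadd /oscal /osub /oadd /oopp /o1.
by rewrite addrCA.
Qed.

Lemma mu_unit I (l : K) : l != 0 ->
  Dd I l (fun=> 0%N) (fun=> 0%N) * Dd I l^-1 (fun=> 0%N) (fun=> 0%N) = 1 :> Sop.
Proof.
by move=> l0; rewrite !DdE !mm0 !mulr1 oe_mul; [rewrite kSM divff // kS1 oe1|exact: kSC].
Qed.

Lemma UE_lift I u : UE K n I u -> UG (fun A => ~~ (I \subset A)) u.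
Proof.
case=> l [g [l0 [Eg ->]]]; apply: UG_mul; last first.
  by have [k [k' [e1 e2 e3 _ e5]]] := Einf_lift Eg; exists k, k'.
exists (Dd I l (fun=> 0%N) (fun=> 0%N)), (Dd I l^-1 (fun=> 0%N) (fun=> 0%N)); split.
- exact: sv_mu.
- exact: mu_unit.
- by have := @mu_unit I l^-1; rewrite invrK invr_eq0; apply.
- by move=> A IA; apply: oe_cg1.
Qed.

Lemma Einf_Dd_setT l a b g : l != 0 -> Einf K n setT (sv g) ->
  Dd setT l a b * g = Dd setT l (fun=> 0%N) (fun=> 0%N) * g :> Sop.
Proof.
move=> _ _; rewrite !DdE /mm; do 3 f_equal.
have -> : rs setT a = (fun=> 0%N) by apply/funext => k; rewrite /rs inE.
have -> : rs setT b = (fun=> 0%N) by apply/funext => k; rewrite /rs inE.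
by rewrite rs0.
Qed.

Lemma EE_cons (k : 'I_n) al be : EE al be setT = E1 (al k) (be k) k * EE al be (~: [set k]).
Proof.
apply: SopP => f a; rewrite svME E1E !EEE.
have -> : [forall j in setT, a j == al j] = (a k == al k) &&
    [forall j in ~: [set k], (if j == k then be k else a j) == al j].
  apply/forall_inP/andP => [h|[h1 /forall_inP h2] j _].
    by split; [apply: h|apply/forall_inP => j; rewrite !inE => /negPf ->; apply: h].
  by case: (eqVneq j k) => [-> //|jk]; have := h2 j; rewrite !inE jk (negPf jk); apply.
case: eqP => //= _; case: ifP => // _; congr (f _); apply/funext => j; rewrite !inE.
by case: (eqVneq j k) => [->|].
Qed.

Lemma Sin_empty (u : Sop) : Sin (fun k => k \notin [set: 'I_n]) u -> exists c, u = kS n c.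
Proof.
elim/Sin_ind => [c|k|k|u1 u2 _ _ [c ->] [d ->]|u1 u2 _ _ [c ->] [d ->]]; rewrite ?inE //.
- by exists c.
- by exists (c + d); rewrite kSD.
- by exists (c * d); rewrite kSM.
Qed.

Lemma Einf_mulS I (a b : Sop) : Einf K n I (sv a) -> Einf K n I (sv b) -> Einf K n I (sv (a * b)).
Proof. exact: Einf_mul. Qed.

Lemma commutator_id (P Q : Sop) : Q * P = 0 -> P * P = 0 -> Q * Q = 0 ->
  1 + P * Q = (1 + P) * ((1 + Q) * ((1 - P) * (1 - Q))).
Proof.
move=> qp pp qq.
have ex : (1 - P) * (1 - Q) = 1 - Q - (P - P * Q) by rewrite mulrBl mul1r mulrBr mulr1.
have qx : Q * (1 - Q - (P - P * Q)) = Q.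
  by rewrite !mulrBr mulr1 qq qp mulrA qp mul0r !subr0.
have e2 : (1 + Q) * (1 - Q - (P - P * Q)) = 1 - (P - P * Q).
  by rewrite [LHS]mulrDl mul1r qx addrAC subrK.
have px : P * (1 - (P - P * Q)) = P by rewrite !mulrBr mulr1 mulrA pp mul0r !subr0.
by rewrite ex e2 mulrDl mul1r px opprB -addrA subrK.
Qed.

Lemma corner_mul (r t t' : Sop) : r * r = r -> r * t' = 0 -> t * r = 0 ->
  (r + t) * (r + t') = r + t * t'.
Proof. by move=> rr rt tr; rewrite mulrDl !mulrDr rr rt tr addr0 add0r. Qed.

Lemma oe_identity (x y k1 k2 : Sop) : k1 * k2 = 1 -> k2 * x = x * k2 ->
  k1 * (1 + x * ((k2 - 1) * y)) - 1 = (k1 - 1) * (1 - x * y).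
Proof.
move=> k12 kx; have -> : x * ((k2 - 1) * y) = k2 * (x * y) - x * y.
  by rewrite mulrBl mul1r mulrBr (mulrA x k2) -kx -mulrA.
rewrite mulrDr mulr1 mulrBr (mulrA k1 k2) k12 mul1r.
by rewrite [RHS]mulrBr mulr1 [X in _ = _ - X]mulrBl mul1r opprB addrAC.
Qed.

Lemma abel8 (V : zmodType) (A B C D E F G H : V) :
  A + B + (C + D) + (E + F) + (G + H) = A + C + (B + D) + (E + G) + (F + H).
Proof. by rewrite (addrACA A B C D) -(addrA _ (E + F)) (addrACA E F G H) addrA. Qed.

Section LastLevel.
Variables (k j0 : 'I_n).
Hypothesis jk : j0 != k.
Local Notation I := (~: [set k]).
Local Notation EI := (Einf K n I).

Lemma j0I : j0 \in I. Proof. by rewrite !inE. Qed.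

(** The factor of the full matrix unit at [k] is absorbed in the coefficient, which may involve
    [x_k] and [y_k]. *)
Lemma full_gen al be c : (exists j, j \in I /\ al j <> be j) ->
  EI (sv (1 + kS n c * EE al be setT)).
Proof.
move=> ne; apply: Einf_gen; exists (sv (kS n c * E1 (al k) (be k) k)), al, be; split.
  by apply: Sin_M; [apply: Sin_c|apply: E1_in; rewrite !inE eqxx].
by split=> //; rewrite -sv_EE (EE_cons k) mulrA.
Qed.

(** If [al] and [be] differ only at [k], an intermediate index [ga], shifted at [j0], writes the
    matrix unit as a product of two others that differ on [I], and the element is a commutator of
    generators. *)
Lemma full_gen' al be c : (exists j, al j <> be j) -> EI (sv (1 + kS n c * EE al be setT)).
Proof.
move=> ne; have [h|h] := pselect (exists j, j \in I /\ al j <> be j); first exact: full_gen.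
have ab j : j \in I -> al j = be j.
  by move=> jI; apply: contrapT => e; apply: h; exists j.
pose ga j := (al j + del j0 j)%N.
have gj : ga j0 <> al j0 by rewrite /ga /del eqxx /=; lia.
pose p := kS n c * EE al ga setT; pose q := EE ga be setT : Sop.
have qp : q * p = 0.
  rewrite /q /p mulrA -kSC -mulrA EEM; case: forall_inP => [e|]; last by rewrite mulr0.
  by case: ne => j; case; apply/esym/eqP/e; rewrite inE.
have pp0 : p * p = 0.
  by apply: EE_sq0; [exact: Sin_c|exists j0; split=> //; exact: not_eq_sym].
have qq0 : q * q = 0.
  rewrite -[q]mul1r; apply: EE_sq0; first exact: Sin_1.
  by exists j0; rewrite inE; split=> //; rewrite -ab ?j0I.
have pq : p * q = kS n c * EE al be setT.
  by rewrite /p /q -mulrA EEM; case: forall_inP => // -[] j _.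
rewrite -pq (commutator_id qp pp0 qq0).
have EN al' be' c' : (exists j, j \in I /\ al' j <> be' j) -> EI (sv (1 - kS n c' * EE al' be' setT)).
  move=> h'; rewrite (_ : 1 - _ = 1 + kS n (- c') * EE al' be' setT); first exact: full_gen.
  by congr (1 + _); apply: SopP => f a; rewrite svNE !svME !kSE mulNr.
have n1 : exists j, j \in I /\ al j <> ga j by exists j0; split; [exact: j0I|exact: not_eq_sym].
have n2 : exists j, j \in I /\ ga j <> be j by exists j0; split; [exact: j0I|rewrite -ab ?j0I].
have q1 : q = kS n 1 * q by rewrite kS1 mul1r.
apply: Einf_mulS; first exact: full_gen.
apply: Einf_mulS; first by rewrite q1; exact: full_gen.
by apply: Einf_mulS; [exact: EN|rewrite q1; exact: EN].
Qed.

Lemma Einf_setT u : Einf K n setT u -> EI u.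
Proof.
have G g : Egen K n setT g -> EI g.
  case=> a [al [be [Sa [[j [_ ne]] ->]]]].
  have sub w : subalg K n (fun k => k \notin [set: 'I_n]) w -> Sn K n w.
    by elim=> {w} *; [apply: sa_scal|apply: sa_X|apply: sa_Y|apply: sa_add|apply: sa_mul].
  have [c ec] := @Sin_empty (MkS (sub _ Sa)) Sa.
  have := @full_gen' al be c (ex_intro _ j ne).
  by rewrite -ec -sv_EE => h; exact: h.
elim=> {u} [|g h Gg _ IH|g v h Gg gv vg _ IH]; first exact: gg1.
  by apply: Einf_mul => //; apply: G.
apply: Einf_mul => //; have [g1 [g2 [e1 e2 e3 e4 _]]] := Egen_lift Gg; subst g.
by rewrite (op_inv_uniq e2 vg); apply: G.
Qed.

Definition lb (i : nat) : 'I_n -> nat := fun j => (i * del j0 j)%N.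
Local Notation u_ i j := (EE (lb i) (lb j) I).

Lemma u_M i j i' j' : u_ i j * u_ i' j' = if j == i' then u_ i j' else 0.
Proof.
rewrite EEM; case: eqP => [->|ne].
  by case: forall_inP => // -[] l _; rewrite eqxx.
case: forall_inP => // /(_ j0 j0I); rewrite /lb /del eqxx /= !muln1 => /eqP //.
Qed.

(** The 2 x 2 matrix with entries [a b c d] at the labels 0 and 1 of the variable [j0], the identity
    on all other labels. *)
Definition M2 (a b c d : Sop) : Sop :=
  1 - u_ 0 0 - u_ 1 1 + a * u_ 0 0 + b * u_ 0 1 + c * u_ 1 0 + d * u_ 1 1.

Local Notation SC := (Sin (fun l => l \notin I)).

Lemma M2M a b c d a' b' c' d' : SC a' -> SC b' -> SC c' -> SC d' ->
  M2 a b c d * M2 a' b' c' d' =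
  M2 (a * a' + b * c') (a * b' + b * d') (c * a' + d * c') (c * b' + d * d').
Proof.
move=> ha hb hc hd; pose r : Sop := 1 - u_ 0 0 - u_ 1 1.
have rl i j : (i < 2)%N -> r * u_ i j = 0.
  move=> i2; rewrite /r !mulrBl mul1r !u_M.
  by case: i i2 => [|[|//]] _; rewrite /= ?subr0 subrr.
have rr i j : (j < 2)%N -> u_ i j * r = 0.
  move=> j2; rewrite /r !mulrBr mulr1 !u_M.
  by case: j j2 => [|[|//]] _; rewrite /= ?subr0 subrr.
have r2 : r * r = r.
  by rewrite {2}/r !mulrBr mulr1 !rl // !subr0.
have rc x : SC x -> r * x = x * r.
  by move=> hx; rewrite /r !mulrBl !mulrBr mul1r mulr1 !EE_comm.
have uu x y i j i' j' : SC y -> (x * u_ i j) * (y * u_ i' j') = x * y * (u_ i j * u_ i' j').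
  by move=> hy; rewrite mulrA -(mulrA x) -EE_comm // !mulrA.
have ru x i j : SC x -> (i < 2)%N -> r * (x * u_ i j) = 0.
  by move=> hx i2; rewrite mulrA rc // -mulrA rl // mulr0.
have ur x i j : (j < 2)%N -> (x * u_ i j) * r = 0 by move=> j2; rewrite -mulrA rr // mulr0.
pose T (x y z t : Sop) : Sop := x * u_ 0 0 + y * u_ 0 1 + z * u_ 1 0 + t * u_ 1 1.
have M2T x y z t : M2 x y z t = r + T x y z t by rewrite /M2 /T !addrA.
have h0 x i : x * u_ i 0 * T a' b' c' d' = x * a' * u_ i 0 + x * b' * u_ i 1.
  by rewrite /T !mulrDr !uu // !u_M /= !mulr0 !addr0.
have h1 x i : x * u_ i 1 * T a' b' c' d' = x * c' * u_ i 0 + x * d' * u_ i 1.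
  by rewrite /T !mulrDr !uu // !u_M /= !mulr0 !add0r.
have rT : r * T a' b' c' d' = 0 by rewrite /T !mulrDr !ru // !addr0.
have Tr : T a b c d * r = 0 by rewrite /T !mulrDl !ur // !addr0.
rewrite !M2T (corner_mul r2 rT Tr); congr (_ + _).
rewrite {1}/T !mulrDl !h0 !h1 /T !mulrDl.
exact: abel8.
Qed.

Lemma abel5 (V : zmodType) (p q s t : V) : p - q - s + q + t + s = p + t.
Proof. by rewrite (addrAC (p - q)) subrK addrAC subrK. Qed.

Lemma U_E s : M2 1 s 0 1 = 1 + s * u_ 0 1.
Proof. by rewrite /M2 !mul1r mul0r addr0 abel5. Qed.
Lemma L_E s : M2 1 0 s 1 = 1 + s * u_ 1 0.
Proof. by rewrite /M2 !mul1r mul0r addr0 abel5. Qed.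

Lemma U_in s : SC s -> EI (sv (M2 1 s 0 1)).
Proof.
move=> hs; rewrite U_E; apply: Einf_gen; exists (sv s), (lb 0), (lb 1); split=> //; split.
  by exists j0; split; [exact: j0I|rewrite /lb /del eqxx].
by rewrite -sv_EE.
Qed.
Lemma L_in s : SC s -> EI (sv (M2 1 0 s 1)).
Proof.
move=> hs; rewrite L_E; apply: Einf_gen; exists (sv s), (lb 1), (lb 0); split=> //; split.
  by exists j0; split; [exact: j0I|rewrite /lb /del eqxx].
by rewrite -sv_EE.
Qed.

Lemma w_E s t : SC s -> SC t -> s * t = 1 -> t * s = 1 ->
  M2 1 s 0 1 * (M2 1 0 (- t) 1 * M2 1 s 0 1) = M2 0 s (- t) 0.
Proof.
move=> hs ht st ts; have h1 := Sin_1 K (fun l => l \notin I); have h0 := Sin_0 K (fun l => l \notin I).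
have hN := Sin_N ht.
rewrite (M2M _ _ _ _ h1 hs h0 h1) ?mul1r ?mulr1 ?mul0r ?mulr0 ?addr0 ?add0r mulNr ts addNr.
by rewrite M2M // ?mul1r ?mulr1 ?mul0r ?mulr0 ?addr0 ?add0r mulrN st subrr.
Qed.

Lemma w_in s t : SC s -> SC t -> s * t = 1 -> t * s = 1 -> EI (sv (M2 0 s (- t) 0)).
Proof.
move=> hs ht st ts; rewrite -(w_E hs ht st ts).
apply: Einf_mulS; first exact: U_in.
by apply: Einf_mulS; [apply: L_in; exact: Sin_N|exact: U_in].
Qed.

(** Up to elementary factors [1 + x b] can be traded for [1 + b x]. Here the latter is [k2], the
    inverse of [k1], and [diag (k1, k2)] is elementary by Whitehead. *)
Lemma M2_diag_in (x b k1 k2 : Sop) : SC x -> SC b -> SC k1 -> SC k2 ->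
  k1 * k2 = 1 -> k2 * k1 = 1 -> b * x = k2 - 1 -> k1 * b = b * k1 ->
  EI (sv (M2 (k1 * (1 + x * b)) 0 0 1)).
Proof.
move=> hx hb hk1 hk2 k12 k21 bx kb.
have h1 := Sin_1 K (fun l => l \notin I); have h0 := Sin_0 K (fun l => l \notin I).
have hm1 := Sin_N h1; have hmm := Sin_N hm1.
have hNx := Sin_N hx; have hNb := Sin_N hb.
have hkx : SC (k1 * x) by apply: Sin_M. have hkb : SC (k2 * b) by apply: Sin_M.
have hNkx := Sin_N hkx; have hNkb := Sin_N hkb.
have hxb : SC (1 + x * b) by apply: Sin_D => //; apply: Sin_M.
have hP : SC (k1 * (1 + x * b)) by apply: Sin_M.
have kc z : k2 * b * (k1 * z) = b * z by rewrite mulrA -(mulrA k2) -kb mulrA k21 mul1r.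
have p0 : k2 * b * (k1 * (1 + x * b)) = k2 * b.
  by rewrite kc mulrDr mulr1 mulrA bx mulrBl mul1r addrC subrK.
have p1 : k2 * b * (k1 * x) = k2 - 1 by rewrite kc bx.
have eD : M2 0 k1 (- k2) 0 * M2 0 (-1) (- -1) 0 = M2 k1 0 0 k2.
  by rewrite (M2M _ _ _ _ h0 hm1 hmm h0) !(mul0r, mulr0, mul1r, mulr1, addr0, add0r, mulrN, mulNr, opprK, oppr0).
have e1 : M2 1 (- x) 0 1 * M2 1 0 (- b) 1 = M2 (1 + x * b) (- x) (- b) 1.
  by rewrite (M2M _ _ _ _ h1 h0 hNb h1) !(mul0r, mulr0, mul1r, mulr1, addr0, add0r, mulrN, mulNr, opprK, oppr0).
have e2 : M2 k1 0 0 k2 * M2 (1 + x * b) (- x) (- b) 1 =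
    M2 (k1 * (1 + x * b)) (- (k1 * x)) (- (k2 * b)) k2.
  by rewrite (M2M _ _ _ _ hxb hNx hNb h1) !(mul0r, mulr0, mul1r, mulr1, addr0, add0r, mulrN, mulNr, opprK, oppr0).
have e3 : M2 1 0 (k2 * b) 1 * M2 (k1 * (1 + x * b)) (- (k1 * x)) (- (k2 * b)) k2 =
    M2 (k1 * (1 + x * b)) (- (k1 * x)) 0 1.
  rewrite (M2M _ _ _ _ hP hNkx hNkb hk2) !(mul0r, mul1r, addr0, mulrN).
  by rewrite p0 p1 subrr opprB subrK.
have e4 : M2 1 (k1 * x) 0 1 * M2 (k1 * (1 + x * b)) (- (k1 * x)) 0 1 =
    M2 (k1 * (1 + x * b)) 0 0 1.
  by rewrite (M2M _ _ _ _ hP hNkx h0 h1) !(mul0r, mulr0, mul1r, mulr1, addr0, add0r, oppr0) addNr.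
rewrite -e4 -e3 -e2 -e1 -eD.
apply: Einf_mulS; first exact: U_in.
apply: Einf_mulS; first exact: L_in.
apply: Einf_mulS; last by apply: Einf_mulS; [exact: U_in|exact: L_in].
apply: Einf_mulS; first exact: w_in.
by apply: w_in; rewrite ?mulrNN ?mulr1.
Qed.

Lemma abel6 (V : zmodType) (p q s t : V) : p - q - s + t + s = p + (t - q).
Proof. by rewrite addrAC subrK -addrA [- q + t]addrC. Qed.

(** Take [x = x_k] and [b = (1/l - 1) y_k]: then [1 + b x = 1/l] because [y_k x_k = 1], while
    [l (1 + x b) = 1 + (l - 1)(1 - x_k y_k)] is the entry that [mu] of the full set has at label
    0. *)
Lemma mu_Einf (l : K) : l != 0 -> EI (sv (Dd setT l (fun=> 0%N) (fun=> 0%N))).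
Proof.
move=> l0; have kI : k \notin I by rewrite !inE eqxx.
have hx : SC (X k) by apply: Sin_X. have hy : SC (Y k) by apply: Sin_Y.
have hk1 : SC (kS n l) by apply: Sin_c. have hk2 : SC (kS n l^-1) by apply: Sin_c.
have k12 : kS n l * kS n l^-1 = 1 by rewrite kSM divff // kS1.
have k21 : kS n l^-1 * kS n l = 1 by rewrite kSM mulVf // kS1.
have yx : Y k * X k = 1 by rewrite -YY_del -XX_del YYXX.
have hb : SC ((kS n l^-1 - 1) * Y k).
  by apply: Sin_M => //; apply: Sin_B => //; exact: Sin_1.
have e5 : Dd setT l (fun=> 0%N) (fun=> 0%N) =
    M2 (kS n l * (1 + X k * ((kS n l^-1 - 1) * Y k))) 0 0 1.
  have lb0 : lb 0 = (fun=> 0%N) by apply/funext => j; rewrite /lb mul0n.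
  have eT : e_ setT = (1 - X k * Y k) * e_ I.
    by rewrite {1}/e_ (EE_cons k) /E1 !expr0 !expr1 mulr1.
  have -> : Dd setT l (fun=> 0%N) (fun=> 0%N) =
      1 + (kS n l * (1 + X k * ((kS n l^-1 - 1) * Y k)) - 1) * e_ I.
    by rewrite (oe_identity (Y k) k12 (kSC l^-1 (X k))) -mulrA -eT DdE mm0 mulr1.
  by rewrite /M2 !mul0r !addr0 mul1r abel6 mulrBl mul1r lb0.
rewrite e5; apply: M2_diag_in hx hb hk1 hk2 k12 k21 _ _; last exact: kSC.
by rewrite -mulrA yx mulr1.
Qed.

End LastLevel.
End Units.

(** * Factorisation level by level *)

Section Assembly.
Variables (K : fieldType) (n : nat) (Hn : (3 <= n)%N) (S : {set 'I_n}).
Hypothesis HS0 : S != set0.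
Hypothesis HSn : forall k, k \in S -> nat_of_ord k != n.-1.
Local Notation Sop := (Sop K n).
Local Notation ep := (ep K (n := n)).
Implicit Types (I J A : {set 'I_n}).
Local Notation z0 := (fun=> 0%N).

Lemma last_lt : (n.-1 < n)%N. Proof. by lia. Qed.
Definition lo : 'I_n := Ordinal last_lt.
Lemma lastbE k : lastb n k = (k == lo). Proof. by []. Qed.
Lemma JpE A : Jp n S A = (lo \in A) && (A :&: S != set0).
Proof.
rewrite /Jp; congr (_ && _); apply/exists_inP/idP => [[k kA]|lA]; last by exists lo; rewrite ?lastbE.
by rewrite lastbE => /eqP <-.
Qed.
Lemma loS : lo \notin S. Proof. by apply/negP => /HSn /=; rewrite eqxx. Qed.
Lemma Jp_sub A (B : {set 'I_n}) : A \subset B -> Jp n S A -> Jp n S B.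
Proof.
move=> AB; rewrite !JpE => /andP [/(subsetP AB) -> /set0Pn [i]]; rewrite inE => /andP [iA iS].
by apply/set0Pn; exists i; rewrite inE iS (subsetP AB).
Qed.

(** If [Z A w] fails, [A] contains [n] and some [i] in [S], so [ep A N] has a factor in
    [p_i p_n]. *)
Lemma ppnP (w : Sop) : ppn K n S (sv w) <-> forall A, ~~ Jp n S A -> Z A w.
Proof.
split=> [H A nJ|H].
  apply: ZO_Z; apply: ideal_ZO H => // g [i [iS]].
  rewrite (_ : pid K n n.-1 = pid K n lo) //; apply: idealmul_ZO; try exact: pid_Sn.
  case: (boolP (i \in A)) => iA; last by left => a; apply: pid_ZO.
  right => b; apply: pid_ZO; apply: contra nJ => lA; rewrite JpE lA /=.
  by apply/set0Pn; exists i; rewrite inE iA.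
apply: (@expand_Z _ _ (fun u => ppn K n S (sv u)) w) => [|u v|A N u nZ]; first exact: ig0.
  exact: igadd.
have : Jp n S A by apply: contrapT => /negP /H.
rewrite JpE => /andP [lA /set0Pn [i]]; rewrite inE => /andP [iA iS].
have il : lo != i by apply: contraTneq iS => <-; apply: loS.
have eA : ep A N = ep [set i] N * ep [set lo] N * ep (A :\: [set i] :\: [set lo]) N.
  by rewrite -mulrA -!ep_split ?sub1set // !inE il.
rewrite eA; apply: igg; [exact: svP| |exact: svP]; exists i; split=> //.
have ep1 (j : 'I_n) : pid K n j (sv (ep [set j] N)).
  by rewrite /ep enum_set1 big_seq1; apply: unit_ideal_gen.
have -> : sv (ep [set i] N * ep [set lo] N) = omul K n (o1 K n)
  (omul K n (sv (ep [set i] N * ep [set lo] N)) (o1 K n)) by [].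
apply: igg; [exact: S1_sub| |exact: S1_sub].
exists (sv (ep [set i] N)), (sv (ep [set lo] N)); split; first exact: ep1.
by split=> //; apply: (ep1 lo).
Qed.

Lemma ideal_left G (u : Sop) (v : op K n) : idealgen K n (Sn K n) G v ->
  idealgen K n (Sn K n) G (omul K n (sv u) v).
Proof.
elim=> {v} [|a g b Sa Gg Sb|v w _ IHv _ IHw].
- have -> : omul K n (sv u) (o0 K n) = o0 K n by apply: opP => f a; rewrite /omul sv0.
  exact: ig0.
- exact: (igg _ _ _ _ (omul K n (sv u) a) g b (sa_mul _ _ _ _ _ (svP u) Sa) Gg Sb).
- have -> : omul K n (sv u) (oadd K n v w) = oadd K n (omul K n (sv u) v) (omul K n (sv u) w).
    by apply: opP => f a; rewrite /omul /oadd svD.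
  exact: igadd.
Qed.

Lemma FnP (w : Sop) : Fn K n (sv w) <-> forall A, A != setT -> Z A w.
Proof.
split=> [H A nT|H]; first by apply: ZO_Z; apply: pI_ZO H; rewrite subTset.
have [N hN] := Zunif w.
have -> : w = w * pp K setT N * ep setT N.
  rewrite -{1}[w]mulr1 (region_sum K n N) mulr_sumr (bigD1 setT) // big1 => [|A /andP [_ nT]].
    by rewrite /= addr0 mulrA.
  by rewrite /pp !mulrA hN ?mul0r //; apply: H.
have := @ep_pI K n setT N; rewrite /Fn /pI.
move: (w * pp K setT N) (ep setT N) => p q.
case: (enum setT) => [|k s] h; first exact: (svP (p * q)).
exact: (@ideal_left _ p (sv q) h).
Qed.

Lemma onePlusP (P : op K n -> Prop) (Q : {set 'I_n} -> bool) u :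
  (forall w : Sop, P (sv w) <-> forall A, Q A -> Z A w) -> onePlus K n P u <-> UG Q u.
Proof.
move=> H; split=> [[[Su [v [Sv [uv vu]]]] Pu]|[g [g' [<- h1 h2 h]]]].
  exists (MkS Su), (MkS Sv); split=> //; try exact: Sop_inj.
  by apply/H.
split; first split; [exact: svP| |by apply/(H (g - 1))].
exists (sv g'); split; first exact: svP.
by split; [have := congr1 (@sv K n) h1|have := congr1 (@sv K n) h2].
Qed.

Definition Qs s A := ~~ Jp n S A || (#|A| < s)%N.

Lemma onePlus_sP s u : onePlus_s K n S s u <-> UG (Qs s) u.
Proof.
have H1 := onePlusP u ppnP; have H2 := onePlusP u (ansP (K := K) (n := n) s).
split=> [[/H1 [g [g' [eg h1 h2 h]]] /H2 [k [k' [ek _ _ h3]]]]|[g [g' [eg h1 h2 h]]]].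
  have {}ek : k = g by apply: Sop_inj; rewrite ek eg.
  by exists g, g'; split=> // A /orP [/h //|/h3]; rewrite ek.
by split; [apply/H1|apply/H2]; exists g, g'; split=> // A hA; apply: h; rewrite /Qs hA ?orbT.
Qed.

Lemma Qs_big s I A : Jp n S I -> (s <= #|I|)%N -> Qs s A -> ~~ (I \subset A).
Proof.
move=> JI sI QA; apply/negP => IA; case/orP: QA; first by rewrite (Jp_sub IA JI).
by rewrite ltnNge (leq_trans sI (subset_leq_card IA)).
Qed.

Definition mval J := if #|J :&: S| == 1%N then mJ' n S J else mJ n J.

(** Both faces still meet [S]: either the only element of [J] in [S] is neither [m] nor [j], or [J]
    has at least two elements in [S]. *)
Lemma thidx_facts s J j : thidx n S s J j -> exists m : 'I_n,
  [/\ nat_of_ord m = mval J, m \in J, j \in J, m != j & thgen K n S J j = theta K n m j J] /\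
  [/\ Jp n S (J :\ m), Jp n S (J :\ j), #|J :\ m| = s & #|J :\ j| = s].
Proof.
case/and4P => /eqP cJ /exists_inP [o' o'J]; rewrite lastbE => /eqP eo JS; subst o'.
have key (m : 'I_n) : m \in J -> j \in J -> m != lo -> j != lo -> m != j ->
   (forall y, y \in [:: m; j] -> exists2 i, i \in J :&: S & i != y) ->
   [/\ Jp n S (J :\ m), Jp n S (J :\ j), #|J :\ m| = s & #|J :\ j| = s].
  move=> memJ jJ ml jl mj hy.
  have jp y : y \in [:: m; j] -> y != lo -> Jp n S (J :\ y).
    move=> /hy [i iJS iy] yl; rewrite JpE !inE eq_sym yl o'J /=; apply/set0Pn; exists i.
    by move: iJS; rewrite !inE iy => /andP [-> ->].
  split; [by apply: jp; rewrite ?inE ?eqxx|by apply: jp; rewrite ?inE ?eqxx ?orbT| |].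
    by have := cardsD1 m J; rewrite memJ cJ => -[].
  by have := cardsD1 j J; rewrite jJ cJ => -[].
have mxP A : j \in A -> exists2 m, m \in A & nat_of_ord m = mx n A.
  move=> jA; have [|m mA e] := @eq_bigmax_cond _ (mem A) (fun k => nat_of_ord k).
    by rewrite card_gt0; apply/set0Pn; exists j.
  by exists m.
rewrite /thgen /mval; case: ifP => c1.
  case/and4P=> jJ jl jS jm; have [|m] := mxP [set k in J | ~~ lastb n k & k \notin S].
    by rewrite !inE jJ jl.
  rewrite !inE => /and3P [memJ ml mS] em; have mj : m != j.
    by apply: contra jm => /eqP <-; rewrite em.
  have em' : nat_of_ord m = mJ' n S J := em; have ml' : m != lo := ml; have jl' : j != lo := jl.
  exists m; split; first by split=> //; rewrite em'.
  apply: key => // y; rewrite !inE => hy; case/set0Pn: JS => i iJS; exists i => //.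
  have iS : i \in S by move: iJS; rewrite inE => /andP [].
  by apply: contraTneq iS => ->; case/orP: hy => /eqP ->.
case/and3P=> jJ jl jm; have [|m] := mxP [set k in J | ~~ lastb n k]; first by rewrite !inE jJ.
rewrite !inE => /andP [memJ ml] em; have mj : m != j.
  by apply: contra jm => /eqP <-; rewrite em.
have em' : nat_of_ord m = mJ n J := em; have ml' : m != lo := ml; have jl' : j != lo := jl.
exists m; split; first by split=> //; rewrite em'.
apply: key => // y _; have c2 : (1 < #|J :&: S|)%N by move: JS c1; rewrite -card_gt0; case: #|_| => [|[]].
have : (0 < #|(J :&: S) :\ y|)%N.
  by move: c2; rewrite (cardsD1 y (J :&: S)); case: (y \in _) => /=; rewrite ?add1n ?add0n //; exact: ltnW.
by rewrite card_gt0 => /set0Pn [i]; rewrite !inE => /andP [iy iJS]; exists i; rewrite ?inE.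
Qed.

(** Every exponent on a face in [J(p)], except the one at [mval], has a prescribed [theta] that
    corrects it. *)
Lemma thidx_Jp s I l : Jp n S I -> #|I| = s -> l \notin I -> nat_of_ord l <> mval (l |: I) ->
  thidx n S s (l |: I) l.
Proof.
rewrite JpE => /andP [lI /set0Pn [i]]; rewrite inE => /andP [iI iS] cI lnI nm.
have ll : ~~ lastb n l by rewrite lastbE; apply: contraNneq lnI => ->.
apply/and4P; split; first by rewrite cardsU1 lnI cI.
- by apply/exists_inP; exists lo; rewrite ?lastbE // !inE lI orbT.
- by apply/set0Pn; exists i; rewrite !inE iI iS orbT.
move: nm; rewrite /mval; case: ifP => c1 nm; last by rewrite setU11 ll; apply/eqP.
rewrite setU11 ll /=; apply/andP; split; last exact/eqP.
apply/negP => lS; move/cards1P: c1 => [y ey].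
have : i \in [set y] by rewrite -ey !inE iI iS orbT.
have : l \in [set y] by rewrite -ey !inE eqxx lS.
by rewrite !inE => /eqP el /eqP ei; rewrite el -ei iI in lnI.
Qed.

Lemma UG_thgen s J j : thidx n S s J j -> UG (Qs s) (thgen K n S J j).
Proof.
case/thidx_facts => m [[_ mJ jJ mj ->] [J1 J2 c1 c2]].
have jm : j != m by rewrite eq_sym.
exists (th K m j J), (th K j m J); split; [exact: sv_th|exact: th_inv|exact: th_inv|].
by move=> A QA; apply: th_cg1; apply: Qs_big QA => //; rewrite ?c1 ?c2.
Qed.

Lemma chain_UG (ordT : nat -> seq ({set 'I_n} * 'I_n)) ordE s0 u :
  (forall s, (s0 <= s <= n.-1)%N -> validT n S s (ordT s)) ->
  (forall s, (s0 <= s <= n.-1)%N -> validE n S s (ordE s)) ->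
  chain K n S ordT ordE s0 u -> UG (Qs s0) u.
Proof.
move=> vT vE; apply: UG_setprod => B hB.
have [s [s1 s2] hs] : exists2 s, (s0 <= s)%N /\ (s <= n.-1)%N & List.In B [:: Thtil K n S (ordT s); Etil K n S (ordE s)].
  have : forall r, (forall s, s \in r -> (s0 <= s)%N /\ (s <= n.-1)%N) ->
     List.In B (flatten [seq [:: Thtil K n S (ordT s); Etil K n S (ordE s)] | s <- r]) ->
     exists2 s, (s0 <= s)%N /\ (s <= n.-1)%N & List.In B [:: Thtil K n S (ordT s); Etil K n S (ordE s)].
    elim=> [//|s r IH] h /= [<-|[<-|hr]].
    - by exists s; [apply: h; rewrite mem_head|left].
    - by exists s; [apply: h; rewrite mem_head|right; left].
    - by apply: IH => // s' s'r; apply: h; rewrite inE s'r orbT.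
  apply; last exact: hB.
  by move=> s; rewrite mem_iota; lia.
have Q0 A : Qs s0 A -> Qs s A by case/orP => [h|h]; rewrite /Qs ?h //; apply/orP; right; lia.
have s12 : (s0 <= s <= n.-1)%N by rewrite s1.
move=> v Bv; apply: (UG_sub Q0); case: hs Bv => [<-|[<-|//]].
  apply: UG_setprod => B' /List.in_map_iff [p [<- hp]] v'; apply: UG_powers; apply: UG_thgen.
  have [_ hv] := vT s s12; rewrite -hv; elim: (ordT s) hp => //= q r IH [->|/IH h]; rewrite inE ?eqxx ?h ?orbT //.
apply: UG_setprod => B' /List.in_map_iff [I [<- hI]] v' /UE_lift.
have [_ hv] := vE s s12.
have : I \in ordE s by elim: (ordE s) hI => //= q r IH [->|/IH h]; rewrite inE ?eqxx ?h ?orbT //.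
rewrite hv => /andP [JI /eqP cI]; apply: UG_sub => A QA.
by apply: Qs_big QA => //; rewrite cI.
Qed.

Section Step.
Variables (s : nat) (oT : seq ({set 'I_n} * 'I_n)) (oE : seq {set 'I_n}).
Hypotheses (vT : validT n S s oT) (vE : validE n S s oE) (s0 : (0 < s)%N).
Variables (u u' : Sop).
Hypotheses (uu' : u * u' = 1) (u'u : u' * u = 1) (Qu : forall A, Qs s A -> cg A u 1).

(** Sets outside [J(p)] get trivial data, so that one total choice fits all faces and matches
    products that run over [J(p)] only. *)
Lemma level_data I : exists z : K * (('I_n -> nat) * ('I_n -> nat)) * Sop, #|I| = s ->
  [/\ z.1.1 != 0, Einf K n I (sv z.2), cg I u (Dd I z.1.1 z.1.2.1 z.1.2.2 * z.2) &
      ~~ Jp n S I -> z = (1, (z0, z0), 1)].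
Proof.
have [cI|//] := pselect (#|I| = s); last by exists (1, (z0, z0), 1).
case: (boolP (Jp n S I)) => JI; last first.
  exists (1, (z0, z0), 1) => _; split=> //=; [exact: oner_neq0|exact: gg1|].
  by rewrite Dd1 mulr1; apply: Qu; rewrite /Qs JI.
have [|k kI|l [a [b [g [l0 Eg h]]]]] := @level K n I u u' _ uu' u'u.
- by rewrite -card_gt0 cI.
- by apply: Qu; rewrite /Qs orbC; have := cardsD1 k I; rewrite kI cI => ->; rewrite ltnS leqnn.
by exists (l, (a, b), g) => _; split.
Qed.

(** The exponent at [l] on the face [I] is influenced only by the factor for the pair [(l |: I, l)]:
    the side effects of the [theta] fall on the variable [mval], which the condition on [l]
    excludes. Each power can thus be chosen separately. *)
Lemma theta_product (a b : {set 'I_n} -> 'I_n -> nat) r : uniq r -> {subset r <= oT} ->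
  exists T T' : Sop, exists ea eb : {set 'I_n} -> 'I_n -> nat,
  [/\ setprod K n [seq powers K n (thgen K n S p.1 p.2) | p <- r] (sv T), T * T' = 1, T' * T = 1,
      forall I, #|I| = s -> cg I T (Dd I 1 (ea I) (eb I)) &
      forall I l, #|I| = s -> l \notin I -> nat_of_ord l <> mval (l |: I) ->
        if (l |: I, l) \in r then (ea I l + b I l = a I l + eb I l)%N else ea I l = eb I l].
Proof.
elim: r => [_ _|[J j] r IH /= /andP [nr ur] sub].
  exists 1, 1, (fun _ => z0), (fun _ => z0); rewrite mulr1; split=> // I _.
  by rewrite Dd1; apply: cgR.
have [|T [T' [ea [eb [hT TT' T'T hcg hex]]]]] := IH ur.
  by move=> p pr; apply: sub; rewrite inE pr orbT.
have /thidx_facts : thidx n S s J j.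
  by have := sub (J, j) (mem_head _ _); have [_ ->] := vT.
case=> m [[em mJ jJ mj eth] [_ _ cm cj]]; have jm : j != m by rewrite eq_sym.
pose t := th K m j J; pose t' := th K j m J.
have tt' : t * t' = 1 by apply: th_inv. have t't : t' * t = 1 by apply: th_inv.
(* The integer [a - b] as two truncated differences, of which at most one is nonzero. *)
pose I0 := J :\ j; pose x := (a I0 j - b I0 j)%N; pose y := (b I0 j - a I0 j)%N.
have [P [P' [hP PP' P'P cP]]] : exists P P' : Sop, [/\ powers K n (thgen K n S J j) (sv P),
   P * P' = 1, P' * P = 1 & forall I, #|I| = s -> cg I P (Dd I 1
     (fun l => ((I == J :\ j) * (x * del j l) + (I == J :\ m) * (y * del m l))%N)
     (fun l => ((I == J :\ j) * (y * del j l) + (I == J :\ m) * (x * del m l))%N))].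
  have ct I : #|I| = s -> cg I t (Dd I 1 (fun l => ((I == J :\ j) * del j l)%N) (fun l => ((I == J :\ m) * del m l)%N)).
    move=> cI; case: (eqVneq I (J :\ j)) => [->|nj].
      apply: cgT (th_cgj K mJ jJ mj) _; apply: Dd_cg => l; rewrite mul1n.
      case: eqP => // e; exfalso; have := setD11 m J; rewrite -e !inE mJ mj //.
    case: (eqVneq I (J :\ m)) => [->|nm].
      by apply: cgT (th_cgi K mJ jJ mj) _; apply: Dd_cg => l _; rewrite mul1n.
    apply: cgT (cgS (Dd_eq1 K _)); last by [].
    apply: th_cg1; apply/negP => sub'.
      by case/eqP: nm; apply/eqP; rewrite eq_sym eqEcard sub' cm cI leqnn.
    by case/eqP: nj; apply/eqP; rewrite eq_sym eqEcard sub' cj cI leqnn.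
  have pw (w w' : Sop) m' : w * w' = 1 -> w ^+ m' * w' ^+ m' = 1.
    by move=> ww; elim: m' => [|m' IHm]; rewrite ?expr0 ?mulr1 // exprSr exprS mulrA -(mulrA (w ^+ m')) ww mulr1.
  case: (leqP (b I0 j) (a I0 j)) => ab.
    exists (t ^+ x), (t' ^+ x); split; [|exact: pw|exact: pw|].
      by exists x; left; rewrite sv_exp /t sv_th eth.
    move=> I cI; apply: cgT (cg_exp x (ct I cI)) _; apply: Dd_cg => l _.
    have y0 : y = 0%N by apply/eqP; rewrite /y subn_eq0.
    by rewrite y0 !mul0n !muln0 !add0n !addn0 !(mulnCA x).
  exists (t' ^+ y), (t ^+ y); split; [|exact: pw|exact: pw|].
    exists y; right; exists (sv t'); rewrite eth -(sv_th K m j J) -/t.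
    split; first by have := congr1 (@sv K n) tt'.
    split; first by have := congr1 (@sv K n) t't.
    by rewrite sv_exp.
  move=> I cI; have ct' : cg I t' (Dd I 1 (fun l => ((I == J :\ m) * del m l)%N) (fun l => ((I == J :\ j) * del j l)%N)).
    by apply: cg_inv (ct I cI); [rewrite t't; apply: cgR|apply: Dd_inv].
  apply: cgT (cg_exp y ct') _; apply: Dd_cg => l _.
  have x0 : x = 0%N by apply/eqP; rewrite /x subn_eq0 ltnW.
  by rewrite x0 !mul0n !muln0 !add0n !addn0 !(mulnCA y).
exists (P * T), (T' * P'), (fun I l => ((I == J :\ j) * (x * del j l) + (I == J :\ m) * (y * del m l) + ea I l)%N),
  (fun I l => ((I == J :\ j) * (y * del j l) + (I == J :\ m) * (x * del m l) + eb I l)%N); split.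
- by exists (sv P), (sv T); split=> //; split.
- by rewrite mulrA -(mulrA P) TT' mulr1.
- by rewrite mulrA -(mulrA T') P'P mulr1.
- move=> I cI; apply: cgT (cgM (cP I cI) (hcg I cI)) _.
  by have := @DdM K n I 1 (fun l => ((I == J :\ j) * (x * del j l) + (I == J :\ m) * (y * del m l))%N)
    (fun l => ((I == J :\ j) * (y * del j l) + (I == J :\ m) * (x * del m l))%N) 1 (ea I) (eb I); rewrite mulr1.
move=> I l cI lI nm; have := hex I l cI lI nm; rewrite inE.
have zm : ((I == J :\ m) * del m l = 0)%N.
  case: eqP => // eI; rewrite /del; case: eqP => // el; case: nm.
  by rewrite el eI setD1K.
have zm1 z : ((I == J :\ m) * (z * del m l) = 0)%N by rewrite mulnCA zm muln0.
rewrite !zm1 !addn0; case: (eqVneq (l |: I, l) (J, j)) => [[eJ el]|ne] /=.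
  have eI : I = J :\ j by rewrite -eJ el setU1K // -el.
  have -> : ((l |: I, l) \in r) = false by rewrite eJ el; apply: negbTE.
  by rewrite -eI eqxx el /del eqxx !muln1 !mul1n /x /y /I0 -eI => ->; lia.
have zj : ((I == J :\ j) * del j l = 0)%N.
  case: eqP => // eI; rewrite /del; case: eqP => // el; case/eqP: ne.
  by rewrite el eI setD1K.
have zj1 z : ((I == J :\ j) * (z * del j l) = 0)%N by rewrite mulnCA zj muln0.
by rewrite !zj1 !add0n.
Qed.

Lemma E_product (l : {set 'I_n} -> K) (g : {set 'I_n} -> Sop) r :
  (forall I, I \in r -> l I != 0 /\ Einf K n I (sv (g I))) ->
  setprod K n [seq UE K n J | J <- r] (sv (\prod_(I <- r) (Dd I (l I) z0 z0 * g I))).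
Proof.
elim: r => [|I r IH] h; first by rewrite big_nil.
rewrite big_cons; exists (sv (Dd I (l I) z0 z0 * g I)), (sv (\prod_(I <- r) (Dd I (l I) z0 z0 * g I))).
have [l0 Eg] := h I (mem_head _ _); split; last first.
  by split=> //; apply: IH => J Jr; apply: h; rewrite inE Jr orbT.
by exists (l I), (sv (g I)); rewrite -sv_mu.
Qed.

Lemma step : exists T G v v' : Sop, [/\ Thtil K n S oT (sv T), Etil K n S oE (sv G),
  u = T * (G * v) & [/\ v * v' = 1, v' * v = 1 & forall A, Qs s.+1 A -> cg A v 1]].
Proof.
have [z hz] := @choice _ _ _ level_data.
pose a I := (z I).1.2.1; pose b I := (z I).1.2.2; pose l I := (z I).1.1; pose g I := (z I).2.
have [T [T' [ea [eb [hT TT' T'T hcg hex]]]]] := theta_product a b (proj1 vT) (fun p hp => hp).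
pose G := \prod_(I <- oE) (Dd I (l I) z0 z0 * g I) : Sop.
have oEP I : I \in oE -> Jp n S I /\ #|I| = s by have [_ ->] := vE => /andP [-> /eqP].
have hG : Etil K n S oE (sv G).
  by apply: E_product => I /oEP [_ cI]; have [h1 h2 _ _] := hz I cI.
have QT : UG (Qs s) (sv T).
  apply: UG_setprod hT => B /List.in_map_iff [p [<- hp]] v'; apply: UG_powers; apply: UG_thgen.
  have [_ <-] := vT; elim: (oT) hp => //= q r IH [->|/IH h]; rewrite inE ?eqxx ?h ?orbT //.
have QG : UG (Qs s) (sv G).
  apply: UG_setprod hG => B /List.in_map_iff [I [<- hI]] v' /UE_lift; apply: UG_sub => A.
  have /oEP [JI cI] : I \in oE by elim: (oE) hI => //= q r IH [->|/IH h]; rewrite inE ?eqxx ?h ?orbT //.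
  by apply: Qs_big => //; rewrite cI.
have [T0 [T0' [/Sop_inj eT _ _ QT1]]] := QT; subst T0.
have [G0 [G' [/Sop_inj eG GG' G'G QG1]]] := QG; subst G0.
pose v := G' * (T' * u); pose v' := u' * (T * G).
have vv' : v * v' = 1.
  rewrite /v /v' mulrA -(mulrA G') -(mulrA T') uu' mulr1 mulrA -(mulrA G') T'T mulr1.
  exact: G'G.
have v'v : v' * v = 1.
  rewrite /v /v' mulrA -(mulrA u') -(mulrA T) GG' mulr1 mulrA -(mulrA u') TT' mulr1.
  exact: u'u.
exists T, G, v, v'; split=> //.
  by rewrite /v (mulrA G) GG' mul1r mulrA TT' mul1r.
split=> //.
pose al I k := (eb I k + a I k)%N; pose be I k := (ea I k + b I k)%N.
have Gcg I : #|I| = s -> cg I G (Dd I (l I) z0 z0 * g I).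
  move=> cI; apply: cgT (@cg_prod _ _ _ oE (fun I => Dd I (l I) z0 z0 * g I) I I (proj1 vE) _) _.
    move=> J /oEP [JJ cJ] JI; have [l0 Eg _ _] := hz J cJ.
    have : UG (fun A => ~~ (J \subset A)) (sv (Dd J (l J) z0 z0 * g J)).
      by apply: UE_lift; exists (l J), (sv (g J)); rewrite -sv_mu.
    case=> k [k' [/Sop_inj <- _ _ h]]; apply: h; apply: contra JI => JI.
    by rewrite eqEcard JI cJ cI leqnn.
  case: ifP => [_|/negbT]; first exact: cgR.
  have [_ ->] := vE; rewrite cI eqxx andbT => nJ.
  have [_ _ _ h] := hz I cI; rewrite /l /g (h nJ) /= Dd1 mulr1; exact: cgR.
have Tu I : #|I| = s -> cg I (T' * u) (Dd I 1 (al I) (be I) * G).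
  move=> cI; have [_ _ hu _] := hz I cI.
  have hT' : cg I T' (Dd I 1 (eb I) (ea I)).
    by apply: cg_inv (hcg I cI); [rewrite T'T; apply: cgR|apply: Dd_inv].
  apply: cgT (cgM hT' hu) _; rewrite mulrA.
  apply: (@cgT _ _ _ _ (Dd I 1 (al I) (be I) * (Dd I (l I) z0 z0 * g I))); last by apply/cgMl/cgS/Gcg.
  rewrite mulrA; apply: cgMr; apply: cgT (DdM _ _ _ _ _ _ _) _; apply: cgS.
  apply: cgT (DdM _ _ _ _ _ _ _) _; rewrite !mul1r; apply: Dd_cg => k _.
  by rewrite /al /be /a /b; lia.
(* The conjugate of [v] by [G]: modulo each [Z I] it is a pure [Dd], as the index argument
   requires. *)
pose w := T' * u * G'; pose w' := G * (u' * T).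
have ww' : w * w' = 1.
  by rewrite /w /w' mulrA -(mulrA (T' * u)) G'G mulr1 mulrA -(mulrA T') uu' mulr1 T'T.
have w'w : w' * w = 1.
  have tri (p q r p' q' r' : Sop) : p * p' = 1 -> q * q' = 1 -> r * r' = 1 ->
      p * (q * r) * (r' * q' * p') = 1.
    by move=> h1 h2 h3; rewrite -!mulrA (mulrA r) h3 mul1r (mulrA q) h2 mul1r.
  exact: tri GG' u'u TT'.
have wcg I : #|I| = s -> cg I w (Dd I 1 (al I) (be I)).
  move=> cI; have h : cg I (T' * u * G') (Dd I 1 (al I) (be I) * G * G').
    by apply: cgMr; exact: Tu.
  by rewrite -(mulrA (Dd I 1 (al I) (be I)) G G') GG' mulr1 in h.
(* Away from [mval] the exponent was corrected by a [theta], or it was zero because [I] is not in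
   [J(p)]. *)
have ab1 I k : #|I| = s -> k \notin I -> nat_of_ord k <> mval (k |: I) -> al I k = be I k.
  move=> cI kI nm; have := hex I k cI kI nm; rewrite /al /be; case: ifP => [_|nT]; first by move=> h; rewrite [LHS]addnC -h.
  suff [-> ->] : a I k = 0%N /\ b I k = 0%N by rewrite !addn0 => ->.
  have nJ : ~~ Jp n S I.
    apply/negP => JI; have := thidx_Jp JI cI kI nm; have [_ hv] := vT.
    by have e := hv (k |: I, k); rewrite /= in e; rewrite -e nT.
  by have [_ _ _ h] := hz I cI; rewrite /a /b (h nJ).
(* At [mval J] all other faces of [J] already have exponent zero, so [index_eq] applies. *)
have ab I k : #|I| = s -> k \notin I -> al I k = be I k.
  move=> cI kI; have [e|] := pselect (nat_of_ord k = mval (k |: I)); last exact: ab1.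
  pose J := k |: I; have cJ j : j \in J -> #|J :\ j| = s.
    by move=> jJ; have := cardsD1 j J; rewrite jJ cardsU1 kI cI => -[].
  have JK : J :\ k = I by rewrite /J setU1K.
  have H := @index_eq K n w w' J k (fun j => al (J :\ j)) (fun j => be (J :\ j)) ww' w'w (setU11 _ _).
  cbv beta in H; rewrite JK in H; apply: H => [j jJ|j jJ jk]; first exact: wcg (cJ j jJ).
  apply: ab1; [exact: cJ|by rewrite setD11|rewrite setD1K // => h].
  by case/eqP: jk; apply: val_inj; exact: (etrans h (esym e)).
move=> A QA; have [cA|cA] := pselect (#|A| = s).
  apply: (@cgT _ _ _ _ (G' * G)); last by rewrite G'G; apply: cgR.
  apply: cgMl; apply: cgT (Tu A cA) _; rewrite -[X in cg _ _ X]mul1r; apply: cgMr.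
  by apply: Dd_eq1 => k kA; apply: ab.
have QA' : Qs s A.
  case/orP: QA => [h|h]; rewrite /Qs ?h //; apply/orP; right.
  by rewrite ltn_neqAle -ltnS h andbT; exact/eqP.
have inv1 (y y' : Sop) : y' * y = 1 -> cg A y 1 -> cg A y' 1.
  by move=> yy h; apply: (@cg_inv _ _ A y y' 1 1); rewrite ?yy ?mulr1 //; apply: cgR.
have h : cg A (G' * (T' * u)) (1 * (1 * 1)).
  by apply: cgM; [exact: inv1 G'G (QG1 A QA')|apply: cgM; [exact: inv1 T'T (QT1 A QA')|exact: Qu]].
by rewrite !mulr1 in h.
Qed.
End Step.

Local Notation X := (X K (n := n)).
Local Notation Y := (Y K (n := n)).
Local Notation XX := (XX K (n := n)).
Local Notation E1 := (E1 K (n := n)).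
Local Notation pp := (pp K (n := n)).

Lemma UE_absorb r I (w v : op K n) : setprod K n [seq UE K n J | J <- rcons r I] w ->
  Einf K n I v -> setprod K n [seq UE K n J | J <- rcons r I] (omul K n w v).
Proof.
move=> hw Ev; elim: r w hw => [|J r IH] w /=.
  case=> a [b [[l [g [l0 [Eg ->]]]] [-> ->]]].
  exists (omul K n (mu K n I l) (omul K n g v)), (o1 K n); split; last by split.
  by exists l, (omul K n g v); split=> //; split=> //; apply: Einf_mul.
by case=> a [b [ha [/IH hb ->]]]; exists a, (omul K n b v).
Qed.

(** For the full set the congruence given by [level] is an equality. *)
Lemma last_level (v v' : Sop) (k j0 : 'I_n) : j0 != k -> v * v' = 1 -> v' * v = 1 ->
  (forall A, A != setT -> cg A v 1) -> Einf K n (~: [set k]) (sv v).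
Proof.
move=> jk vv' v'v hv.
have T0 : [set: 'I_n] != set0 by apply/set0Pn; exists k; rewrite inE.
have [|l [a [b [g [l0 Eg [N h]]]]]] := @level K n setT v v' T0 vv' v'v.
  by move=> i _; apply: hv; apply/eqP => /setP /(_ i); rewrite !inE eqxx.
have e0 : cst [set: 'I_n] N = (fun=> 0%N) by apply/funext => i; rewrite /cst inE.
have ev : v = Dd setT l a b * g by apply/eqP; rewrite -subr_eq0 -[_ - _]mulr1 -(XX0 K n) -e0 h.
rewrite ev Einf_Dd_setT //; apply: Einf_mulS; first by apply: (mu_Einf jk).
exact: (Einf_setT jk).
Qed.

Lemma card_lt_setT A : A != setT -> (#|A| < n)%N.
Proof.
move=> nT; have : A \proper [set: 'I_n] by rewrite properEneq nT subsetT.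
by move/proper_card; rewrite cardsT card_ord.
Qed.

Lemma Etil_absorb oE (G v v' : Sop) : validE n S n.-1 oE -> Etil K n S oE (sv G) ->
  v * v' = 1 -> v' * v = 1 -> (forall A, Qs n A -> cg A v 1) -> Etil K n S oE (sv (G * v)).
Proof.
move=> [_ hv] hG vv' v'v Hv.
(* The list is not empty: since [n >= 3], some index differs from [n] and from a chosen [i] in [S],
   and its complement is a member. *)
have [J JE] : exists J, J \in oE.
  case/set0Pn: HS0 => i iS.
  have [k kn] : exists k, k \notin [set lo; i].
    have : (0 < #|~: [set lo; i]|)%N.
      by have := cardsC [set lo; i]; rewrite card_ord cards2; case: (lo != i) => /=; lia.
    by rewrite card_gt0 => /set0Pn [k]; rewrite inE => h; exists k.
  have [kl ki] : lo != k /\ i != k.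
    by move: kn; rewrite !inE negb_or !(eq_sym k) => /andP [].
  exists (~: [set k]); rewrite hv JpE !inE kl /=; apply/andP; split.
    by apply/set0Pn; exists i; rewrite !inE ki.
  by rewrite cardsCs setCK cards1 card_ord subn1.
move: hv hG JE; rewrite /Etil; case/lastP: oE => [|r I] hv hG JE; first by rewrite in_nil in JE.
have : I \in rcons r I by rewrite mem_rcons mem_head.
rewrite hv => /andP [JI /eqP cI].
have /eqP/cards1P [k ek] : #|~: I| = 1%N by rewrite cardsCs setCK card_ord cI; lia.
have eI : I = ~: [set k] by rewrite -ek setCK.
have lI : lo \in I by move: JI; rewrite JpE => /andP [].
have lk : lo != k by move: lI; rewrite eI !inE.
apply: (UE_absorb hG); rewrite eI; apply: (last_level lk vv' v'v) => A nT.
by apply: Hv; rewrite /Qs card_lt_setT ?orbT.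
Qed.

Lemma UG_chain (ordT : nat -> seq ({set 'I_n} * 'I_n)) (ordE : nat -> seq {set 'I_n})
  (vT : forall s, (2 <= s <= n.-1)%N -> validT n S s (ordT s))
  (vE : forall s, (2 <= s <= n.-1)%N -> validE n S s (ordE s)) d s u :
  (2 <= s)%N -> (s + d = n.-1)%N -> UG (Qs s) u -> chain K n S ordT ordE s u.
Proof.
elim: d s u => [|d IH] s u s2 sd [g [g' [<- gg' g'g hg]]].
all: have sn : (2 <= s <= n.-1)%N by lia.
all: have s0 : (0 < s)%N by lia.
all: have [T [G [v [v' [hT hG eg [vv' v'v hv]]]]]] := step (vT s sn) (vE s sn) s0 gg' g'g hg.
all: rewrite /chain (_ : (n - s = (n - s.+1).+1)%N) /=; last by lia.
  rewrite (_ : (n - s.+1 = 0)%N) /=; last by lia.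
  have es : s = n.-1 by lia.
  have en : s.+1 = n by lia.
  exists (sv T), (sv (G * v)); split=> //; split; last by rewrite eg.
  exists (sv (G * v)), (o1 K n); split; last by split.
  apply: (@Etil_absorb _ _ _ v') => //; first by rewrite -es; apply: vE.
  by move=> A QA; apply: hv; rewrite en.
exists (sv T), (sv (G * v)); split=> //; split; last by rewrite eg.
exists (sv G), (sv v); split=> //; split=> //.
by apply: IH; [lia|lia|exists v, v'].
Qed.

(** Sets in [J(p)] have at least two elements because [n] is not in [S], so the level 2 imposes
    nothing new. *)
Lemma Qs2 A : Qs 2 A = ~~ Jp n S A.
Proof.
rewrite /Qs; case: (boolP (Jp n S A)) => //= JA; apply/negbTE; rewrite -leqNgt.
move: JA; rewrite JpE => /andP [lA /set0Pn [i]]; rewrite inE => /andP [iA iS].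
have il : lo != i by apply: contraTneq iS => <-; apply: loS.
have sub : [set lo; i] \subset A by apply/subsetP => y; rewrite !inE => /orP [] /eqP ->.
by have := subset_leq_card sub; rewrite cards2 il.
Qed.

Lemma QsT A : Qs n A = (A != setT).
Proof.
case: eqP => [->|/eqP nT]; last by rewrite /Qs card_lt_setT ?orbT.
by rewrite /Qs cardsT card_ord ltnn orbF JpE inE /= setTI HS0.
Qed.

(** * The congruence subgroup as matrices in the last variable *)

Local Notation SC := (Sin (fun k => ~~ lastb n k)).

Lemma SC_lo c z : SC c -> Sin (fun k => k == lo) z -> c * z = z * c :> Sop.
Proof. by move=> hc hz; apply: Sin_comm hc hz => k; rewrite lastbE => /negP h /h. Qed.

Lemma SC_E1 c s t : SC c -> c * E1 s t lo = E1 s t lo * c.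
Proof. by move=> hc; apply: SC_lo => //; apply: E1_in. Qed.

Lemma SC_E10 c : SC c -> c * E1 0%N 0%N lo = 0 -> c = 0.
Proof.
move=> hc h; have hc' : Sin (fun k => k \notin [set lo]) c.
  by apply: Sin_sub hc => k; rewrite lastbE inE.
have h' : c * e_ K [set lo] = 0 by rewrite /e_ /EE enum_set1 big_seq1.
exact: SC_e0 hc' h'.
Qed.

Lemma E1M s t s' t' : E1 s t lo * E1 s' t' lo = if t == s' then E1 s t' lo else 0.
Proof.
apply: SopP => f a; rewrite svME !E1E /= eqxx.
case: (t =P s') => [->|ne]; last by case: (a lo == s).
rewrite E1E; case: (a lo == s) => //; congr (f _); apply/funext => j.
by case: (j == lo).
Qed.

Definition lastmx m (C : 'I_m -> 'I_m -> Sop) : Sop := \sum_(k < m) \sum_(l < m) C k l * E1 k l lo.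
Definition kron m (k l : 'I_m) : Sop := if k == l then 1 else 0.

Lemma kron_SC m (k l : 'I_m) : SC (kron k l).
Proof. by rewrite /kron; case: ifP => _; [exact: Sin_1|exact: Sin_0]. Qed.

Lemma sum_kron_l m (C : 'I_m -> 'I_m -> Sop) k l : \sum_j kron k j * C j l = C k l.
Proof.
rewrite (bigD1 k) //= [X in _ + X]big1 ?addr0 => [|j jk]; first by rewrite /kron eqxx mul1r.
by rewrite /kron eq_sym (negbTE jk) mul0r.
Qed.

Lemma sum_kron_r m (C : 'I_m -> 'I_m -> Sop) k l : \sum_j C k j * kron j l = C k l.
Proof.
rewrite (bigD1 l) //= [X in _ + X]big1 ?addr0 => [|j jl]; first by rewrite /kron eqxx mulr1.
by rewrite /kron (negbTE jl) mulr0.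
Qed.

Lemma eq_lastmx m (C D : 'I_m -> 'I_m -> Sop) :
  (forall k l, C k l = D k l) -> lastmx C = lastmx D.
Proof. by move=> e; apply: eq_bigr => k _; apply: eq_bigr => l _; rewrite e. Qed.

Lemma lastmxD m (C D : 'I_m -> 'I_m -> Sop) :
  lastmx (fun k l => C k l + D k l) = lastmx C + lastmx D.
Proof.
rewrite /lastmx -big_split; apply: eq_bigr => k _ /=.
by rewrite -big_split; apply: eq_bigr => l _; rewrite mulrDl.
Qed.

Lemma lastmxB m (C D : 'I_m -> 'I_m -> Sop) :
  lastmx (fun k l => C k l - D k l) = lastmx C - lastmx D.
Proof.
rewrite /lastmx -sumrB; apply: eq_bigr => k _.
by rewrite -sumrB; apply: eq_bigr => l _; rewrite mulrBl.
Qed.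

Lemma lastmxM m (C D : 'I_m -> 'I_m -> Sop) : (forall k l, SC (D k l)) ->
  lastmx C * lastmx D = lastmx (fun k l => \sum_j C k j * D j l).
Proof.
move=> hD; rewrite {1}/lastmx mulr_suml; apply: eq_bigr => k _; rewrite mulr_suml.
under [RHS]eq_bigr do rewrite mulr_suml.
rewrite [RHS]exchange_big /=; apply: eq_bigr => j _.
have t (p l : 'I_m) : C k j * E1 k j lo * (D p l * E1 p l lo) =
    C k j * D p l * (E1 k j lo * E1 p l lo).
  by rewrite mulrA -(mulrA (C k j)) -(SC_E1 _ _ (hD p l)) mulrA -mulrA.
rewrite /lastmx mulr_sumr (bigD1 j) //= [X in _ + X]big1 ?addr0 => [|p pj].
  by rewrite mulr_sumr; apply: eq_bigr => l _; rewrite t E1M eqxx.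
rewrite mulr_sumr big1 // => l _; rewrite t E1M (_ : (nat_of_ord j == p) = false) ?mulr0 //.
by apply/negbTE; apply: contraNneq pj => /val_inj ->.
Qed.

Lemma lastmx_entry m (C : 'I_m -> 'I_m -> Sop) (i j : 'I_m) : (forall k l, SC (C k l)) ->
  E1 0%N i lo * lastmx C * E1 j 0%N lo = C i j * E1 0%N 0%N lo.
Proof.
move=> hC.
have t (k l : 'I_m) : E1 0%N i lo * (C k l * E1 k l lo) * E1 j 0%N lo =
    if (k == i) && (l == j) then C i j * E1 0%N 0%N lo else 0.
  rewrite mulrA -(SC_E1 _ _ (hC k l)) -!mulrA E1M.
  case: (eqVneq l j) => [->|lj]; last first.
    rewrite (_ : (nat_of_ord l == j) = false) ?andbF ?mulr0 //.
    by apply/negbTE; apply: contraNneq lj => /val_inj ->.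
  rewrite eqxx andbT E1M; case: (eqVneq k i) => [->|ki]; first by rewrite eqxx.
  rewrite (_ : (nat_of_ord i == k) = false) ?mulr0 //.
  by apply/negbTE; apply: contraNneq ki => /val_inj ->.
rewrite /lastmx mulr_sumr mulr_suml (bigD1 i) //= [X in _ + X]big1 ?addr0 => [|k ki].
  rewrite mulr_sumr mulr_suml (bigD1 j) //= [X in _ + X]big1 ?addr0 => [|l lj].
    by rewrite t !eqxx.
  by rewrite t (negbTE lj) andbF.
by rewrite mulr_sumr mulr_suml big1 // => l _; rewrite t (negbTE ki).
Qed.

(** The complement [1 - lastmx kron] of the matrix corner is an idempotent orthogonal to it, so
    products are formed in the corner. *)
Lemma lastmx_inv m (a b : 'I_m -> 'I_m -> Sop) : (forall k l, SC (b k l)) ->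
  (forall k l, \sum_j a k j * b j l = kron k l) ->
  (1 + lastmx (fun k l => a k l - kron k l)) * (1 + lastmx (fun k l => b k l - kron k l)) = 1.
Proof.
move=> hb ab; have hk := @kron_SC m.
have e (c : 'I_m -> 'I_m -> Sop) : 1 + lastmx (fun k l => c k l - kron k l) = 1 - lastmx (@kron m) + lastmx c.
  by rewrite lastmxB [X in 1 + X]addrC addrA.
have krl (c : 'I_m -> 'I_m -> Sop) : (forall k l, SC (c k l)) -> lastmx (@kron m) * lastmx c = lastmx c.
  by move=> hc; rewrite lastmxM //; apply: eq_lastmx => k l; exact: sum_kron_l.
have krr (c : 'I_m -> 'I_m -> Sop) : lastmx c * lastmx (@kron m) = lastmx c.
  by rewrite lastmxM //; apply: eq_lastmx => k l; exact: sum_kron_r.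
have r2 : (1 - lastmx (@kron m)) * (1 - lastmx (@kron m)) = 1 - lastmx (@kron m).
  by rewrite mulrBr mulr1 mulrBl mul1r krl // subrr subr0.
have rt : (1 - lastmx (@kron m)) * lastmx b = 0 by rewrite mulrBl mul1r krl // subrr.
have tr : lastmx a * (1 - lastmx (@kron m)) = 0 by rewrite mulrBr mulr1 krr subrr.
rewrite !e (corner_mul r2 rt tr) lastmxM //.
by rewrite (@eq_lastmx m _ (@kron m) ab) subrK.
Qed.

Lemma lastmx_inv_entries m (E F : 'I_m -> 'I_m -> Sop) :
  (forall k l, SC (E k l)) -> (forall k l, SC (F k l)) -> (1 + lastmx E) * (1 + lastmx F) = 1 ->
  forall k l, \sum_j (E k j + kron k j) * (F j l + kron j l) = kron k l.
Proof.
move=> hE hF H k l; pose G k l := E k l + F k l + \sum_j E k j * F j l.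
have hG k' l' : SC (G k' l').
  by apply: Sin_D; [apply: Sin_D|apply: Sin_sum => j _; apply: Sin_M].
have e : lastmx G = 0.
  rewrite /G (lastmxD (fun k l => E k l + F k l) (fun k l => \sum_j E k j * F j l)).
  rewrite (lastmxD E F) -(lastmxM E hF).
  move: H; rewrite mulrDl mul1r mulrDr mulr1 -addrA => /(canRL (addKr 1)).
  by rewrite addNr => h; rewrite -h [RHS]addrCA [RHS]addrA.
have z : E k l + F k l + \sum_j E k j * F j l = 0.
  by apply: (SC_E10 (hG k l)); have := lastmx_entry k l hG; rewrite e mulr0 mul0r => <-.
under eq_bigr do rewrite mulrDl !mulrDr.
rewrite !big_split /= (sum_kron_r E k l) (sum_kron_l F k l) (sum_kron_l (@kron m) k l).
by rewrite addrA -(addrA _ (E k l)) [_ + (E k l + F k l)]addrC z add0r.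
Qed.

Local Notation PF w := (pfrak K n S (sv w)).

Lemma PF_D (u v : Sop) : PF u -> PF v -> PF (u + v).
Proof. exact: igadd. Qed.

Lemma PF_Ml (u v : Sop) : SC u -> PF v -> PF (u * v).
Proof.
rewrite /pfrak => hu; rewrite (_ : sv (u * v) = omul K n (sv u) (sv v)) //.
elim=> {v} [|a g b Sa Gg Sb|v w _ IHv _ IHw].
- have -> : omul K n (sv u) (o0 K n) = o0 K n by apply: opP => f a; rewrite /omul sv0.
  exact: ig0.
- exact: (igg _ _ _ _ (omul K n (sv u) a) g b (sa_mul _ _ _ _ _ hu Sa) Gg Sb).
- have -> : omul K n (sv u) (oadd K n v w) = oadd K n (omul K n (sv u) v) (omul K n (sv u) w).
    by apply: opP => f a; rewrite /omul /oadd svD.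
  exact: igadd.
Qed.

Lemma Sn1_Sn (w : op K n) : Sn1 K n w -> Sn K n w.
Proof. by elim=> {w} *; [apply: sa_scal|apply: sa_X|apply: sa_Y|apply: sa_add|apply: sa_mul]. Qed.

Lemma E1_Z A (i : 'I_n) s t : i \notin A -> Z A (E1 s t i).
Proof.
move=> iA; have -> : E1 s t i = EE K (fun=> s) (fun=> t) [set i].
  by rewrite /EE enum_set1 big_seq1.
by apply: Z_EE; rewrite sub1set.
Qed.

Lemma pfrak_Z A (w : Sop) : A :&: S = set0 -> PF w -> Z A w.
Proof.
move=> AS H; apply: ZO_Z; apply: ideal_ZO H; first exact: Sn1_Sn.
move=> g [i [iS]]; apply: ideal_ZO; first exact: Sn1_Sn.
move=> _ ->; exists (E1 0%N 0%N i); first by rewrite sv_E1.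
apply: E1_Z; apply/negP => iA; have : i \in A :&: S by rewrite inE iA.
by rewrite AS inE.
Qed.

Lemma PF_XY (i : 'I_n) N : i \in S -> PF (1 - X i ^+ N * Y i ^+ N).
Proof.
move=> iS; have li : ~~ lastb n i by rewrite lastbE; apply: contraTneq iS => ->; exact: loS.
have h1 : Sn1 K n (o1 K n) := Sin_1 K (fun k => ~~ lastb n k).
elim: N => [|N IH]; first by rewrite !expr0 mulr1 subrr; apply: ig0.
have -> : 1 - X i ^+ N.+1 * Y i ^+ N.+1 = 1 - X i ^+ N * Y i ^+ N + E1 N N i.
  by rewrite /E1 addrA subrK.
apply: PF_D => //.
have -> : E1 N N i = X i ^+ N * (E1 0%N 0%N i * Y i ^+ N).
  by rewrite /E1 !expr0 mulr1 !expr1 mulrBl mul1r mulrBr -(mulrA (X i)) (mulrA _ (X i)) -exprSr -exprS.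
have SX : Sn1 K n (sv (X i ^+ N)) by apply: Sin_exp; apply: Sin_X.
have SY : Sn1 K n (sv (Y i ^+ N)) by apply: Sin_exp; apply: Sin_Y.
have pe : pid' K n i (sv (E1 0%N 0%N i)).
  rewrite sv_E1; exact: (igg K n _ _ (o1 K n) (eo K n i) (o1 K n) h1 erefl h1).
exact: (igg K n _ _ (sv (X i ^+ N)) (sv (E1 0%N 0%N i)) (sv (Y i ^+ N)) SX (ex_intro _ i (conj iS pe)) SY).
Qed.

Lemma XYprodE (s : seq 'I_n) N f a : sv (\prod_(k <- s) (X k ^+ N * Y k ^+ N)) f a =
  if all (fun k => (N <= a k)%N) s then f a else 0.
Proof.
elim: s => [|k s IH]; first by rewrite big_nil sv1E.
rewrite big_cons svME svME XnE YnE /=; case: ifP => //= h.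
rewrite (_ : (fun j => _) = a) ?IH //; apply/funext => j /=.
by case: eqP => [->|//]; rewrite subnK.
Qed.

Lemma PF_1pp N : PF (1 - pp (~: S) N).
Proof.
have -> : pp (~: S) N = \prod_(k <- enum S) (X k ^+ N * Y k ^+ N).
  apply: SopP => f a; rewrite ppE XYprodE.
  suff -> : [forall k, (k \in ~: S) || (N <= a k)%N] = all (fun k => (N <= a k)%N) (enum S) by [].
  apply/forallP/allP => [h k|h k]; first by rewrite mem_enum => kS; have := h k; rewrite inE kS.
  by rewrite inE; case: (boolP (k \in S)) => //= kS; apply: h; rewrite mem_enum.
have : {subset enum S <= S} by move=> k; rewrite mem_enum.
elim: (enum S) => [|k s IH] sub; first by rewrite big_nil subrr; apply: ig0.
have kS : k \in S by apply: sub; rewrite mem_head.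
have li : ~~ lastb n k by rewrite lastbE; apply: contraTneq kS => ->; exact: loS.
have one_sub (p q : Sop) : 1 - p * q = 1 - p + p * (1 - q) by rewrite mulrBr mulr1 addrA subrK.
rewrite big_cons one_sub; apply: PF_D; first exact: PF_XY.
apply: PF_Ml; last by apply: IH => j js; apply: sub; rewrite inE js orbT.
by apply: Sin_M; apply: Sin_exp; [apply: Sin_X|apply: Sin_Y].
Qed.

(** A power of the [x_k] with [k] in [S] kills [c], hence [c = c (1 - pp (~: S) N)], whose last
    factor lies in the ideal. *)
Lemma PF_Z c : SC c -> Z (~: S) (c * E1 0%N 0%N lo) -> PF c.
Proof.
move=> hc [N hN].
have hX : SC (XX (cst (~: S) N)).
  by apply: XX_in => k; rewrite negbK lastbE => /eqP ->; rewrite /cst inE loS.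
have cX : c * XX (cst (~: S) N) = 0.
  apply: SC_E10; first exact: Sin_M.
  by rewrite -mulrA (SC_E1 _ _ hX) mulrA hN.
have -> : c = c * (1 - pp (~: S) N) by rewrite mulrBr mulr1 /pp mulrA cX mul0r subr0.
by apply: PF_Ml => //; exact: PF_1pp.
Qed.

(** Finite columns at label 0 of the last variable. They form a left ideal of the whole algebra,
    which bounds the rows of an element column by column. *)
Inductive Col : Sop -> Prop :=
| Col0 : Col 0
| ColS c k v : SC c -> Col v -> Col (c * E1 k 0%N lo + v).

Lemma Col_D u v : Col u -> Col v -> Col (u + v).
Proof.
elim=> [|c k w hc _ IH] hv; first by rewrite add0r.
by rewrite -addrA; apply: ColS => //; exact: IH.
Qed.

Lemma X_E1 j : X lo * E1 j 0%N lo = E1 j.+1 0%N lo.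
Proof. by rewrite /E1 mulrBr !mulrA -!exprS. Qed.

Lemma YX k : Y k * X k = 1. Proof. by rewrite -YY_del -XX_del YYXX. Qed.

Lemma Col_SC a v : SC a -> Col v -> Col (a * v).
Proof.
move=> ha; elim=> [|c k w hc _ IH]; first by rewrite mulr0; exact: Col0.
by rewrite mulrDr mulrA; apply: ColS => //; apply: Sin_M.
Qed.

Lemma Col_Ml w v : Col v -> Col (w * v).
Proof.
move: v; elim/Sin_ind: w / (Sin_T w) => [a|k _|k _|u1 u2 _ _ h1 h2|u1 u2 _ _ h1 h2] v hv.
- by apply: Col_SC => //; exact: Sin_c.
- case: (eqVneq k lo) => [->|kl]; last by apply: Col_SC => //; apply: Sin_X; rewrite lastbE.
  have hX : Sin (fun k => k == lo) (X lo) by apply: Sin_X.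
  elim: hv => [|c j w' hc _ IH]; first by rewrite mulr0; exact: Col0.
  by rewrite mulrDr mulrA -(SC_lo hc hX) -mulrA X_E1; apply: ColS.
- case: (eqVneq k lo) => [->|kl]; last by apply: Col_SC => //; apply: Sin_Y; rewrite lastbE.
  have hY : Sin (fun k => k == lo) (Y lo) by apply: Sin_Y.
  elim: hv => [|c j w' hc _ IH]; first by rewrite mulr0; exact: Col0.
  rewrite mulrDr mulrA -(SC_lo hc hY) -mulrA; case: j => [|j]; last first.
    by rewrite -X_E1 (mulrA (Y lo)) YX mul1r; apply: ColS.
  have -> : Y lo * E1 0%N 0%N lo = 0.
    by rewrite /E1 !expr0 mulr1 !expr1 mulrBr mulr1 mulrA YX mul1r subrr.
  by rewrite mulr0 add0r.
- by rewrite mulrDl; apply: Col_D; [exact: h1|exact: h2].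
- by rewrite -mulrA; apply: h1; exact: h2.
Qed.

Lemma ColP v : Col v -> exists m, forall m', (m <= m')%N -> exists c : nat -> Sop,
  (forall k, SC (c k)) /\ v = \sum_(k < m') c k * E1 k 0%N lo.
Proof.
elim=> [|c k w hc _ [m IH]].
  exists 0%N => m' _; exists (fun=> 0); split; first by move=> ?; exact: Sin_0.
  by rewrite big1 // => i _; rewrite mul0r.
exists (maxn m k.+1) => m'; rewrite geq_max => /andP [mm km]; have [f [hf ->]] := IH _ mm.
exists (fun j => f j + (if j == k then c else 0)); split.
  by move=> j; apply: Sin_D => //; case: ifP => // _; exact: Sin_0.
under [RHS]eq_bigr do rewrite mulrDl.
rewrite big_split [LHS]addrC; congr (_ + _).
rewrite (bigD1 (Ordinal km)) //= eqxx [X in _ + X]big1 ?addr0 // => j jk.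
rewrite (_ : (nat_of_ord j == k) = false) ?mul0r //.
by apply/negbTE; apply: contraNneq jk => jk; apply/eqP; exact: val_inj.
Qed.

Lemma sum_E1 m : \sum_(l < m) E1 l l lo = 1 - X lo ^+ m * Y lo ^+ m.
Proof.
elim: m => [|m IH]; first by rewrite big_ord0 !expr0 mulr1 subrr.
by rewrite big_ord_recr /= IH /E1 addrA subrK.
Qed.

Lemma XX_lo N : XX (cst (~: [set lo]) N) = X lo ^+ N.
Proof.
apply: SopP => f a; rewrite XX_E XnE (_ : [forall k, _] = (N <= a lo)%N).
  case: ifP => // _; congr (f _); apply/funext => j; rewrite /cst !inE.
  by case: eqP => [->|_] /=; rewrite ?subn0.
apply/forallP/idP => [/(_ lo)|h j]; first by rewrite /cst !inE eqxx.
by rewrite /cst !inE; case: eqP => [->|].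
Qed.

(** A power [x_n^N] killed by [w] leaves only finitely many columns, and each column is finite. The
    size stays free above a bound, so that a unit and its inverse can share it. *)
Lemma finite_columns w : Z (~: [set lo]) w -> exists m, forall m', (m <= m')%N ->
  exists C : 'I_m' -> 'I_m' -> Sop, (forall k l, SC (C k l)) /\ w = lastmx C.
Proof.
case=> N; rewrite XX_lo => hN.
have Ecol l : Col (E1 l 0%N lo).
  by have := ColS l (Sin_1 K (fun k => ~~ lastb n k)) Col0; rewrite mul1r addr0.
have hc l := ColP (Col_Ml w (Ecol l)).
have [f hf] := choice hc.
exists (maxn N (\max_(l < N) f l)) => m'; rewrite geq_max => /andP [Nm fm].
have hl (l : 'I_m') : exists c : nat -> Sop,
    (forall k, SC (c k)) /\ w * E1 l 0%N lo = \sum_(k < m') c k * E1 k 0%N lo.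
  case: (ltnP l N) => lN.
    apply: hf; apply: leq_trans fm.
    exact: (@leq_bigmax _ (fun l : 'I_N => f l) (Ordinal lN)).
  exists (fun=> 0); split; first by move=> ?; exact: Sin_0.
  rewrite big1 => [|k _]; last by rewrite mul0r.
  have XnE1 a b : X lo ^+ a * E1 b 0%N lo = E1 (a + b) 0%N lo.
    by rewrite /E1 mulrBr !mulrA -!exprD addnS.
  by rewrite -(subnKC lN) -XnE1 mulrA hN mul0r.
have [c hcc] := choice hl.
exists (fun k l => c l k); split; first by move=> k l; case: (hcc l).
transitivity (\sum_(l < m') w * E1 l l lo).
  have hm : w * X lo ^+ m' = 0 by rewrite -(subnKC Nm) exprD mulrA hN mul0r.
  by rewrite -mulr_sumr sum_E1 mulrBr mulr1 mulrA hm mul0r subr0.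
rewrite /lastmx exchange_big /=; apply: eq_bigr => l _.
have <- : E1 l 0%N lo * E1 0%N l lo = E1 l l lo by rewrite E1M eqxx.
rewrite mulrA (proj2 (hcc l)) mulr_suml; apply: eq_bigr => k _.
by rewrite -mulrA E1M eqxx.
Qed.

Lemma sum_enum m (F : 'I_m -> Sop) : \sum_(j <- enum 'I_m) F j = \sum_(j < m) F j.
Proof. by rewrite big_enum; apply: eq_bigl. Qed.

Lemma sv_sum (T : Type) (s : seq T) (F : T -> Sop) :
  sv (\sum_(j <- s) F j) = osum K n [seq sv (F j) | j <- s].
Proof. by elim: s => [|j s IH]; rewrite ?big_nil // big_cons /= -IH. Qed.

Lemma osum_cat (s t : seq (op K n)) :
  osum K n (s ++ t) = oadd K n (osum K n s) (osum K n t).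
Proof.
elim: s => [|u s IH] /=; first by apply: opP => f a; rewrite /oadd add0r.
by rewrite IH; apply: opP => f a; rewrite /oadd addrA.
Qed.

Lemma sv_allpairs (T : Type) (s t : seq T) (F : T -> T -> Sop) :
  sv (\sum_(k <- s) \sum_(l <- t) F k l) = osum K n [seq sv (F k l) | k <- s, l <- t].
Proof.
elim: s => [|k s IH]; first by rewrite big_nil.
rewrite big_cons [RHS](_ : _ = osum K n ([seq sv (F k l) | l <- t] ++
  [seq sv (F k l) | k <- s, l <- t])) //.
by rewrite osum_cat -sv_sum -IH.
Qed.

Lemma sv_kron m (k l : 'I_m) : sv (kron k l) = delta K n k l.
Proof. by rewrite /kron /delta; case: ifP. Qed.

Lemma sv_lastmx m (a : 'I_m -> 'I_m -> Sop) :
  osum K n [seq omul K n (osub K n (sv (a k l)) (delta K n k l)) (Est K n k l n.-1)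
             | k <- enum 'I_m, l <- enum 'I_m] = sv (lastmx (fun k l => a k l - kron k l)).
Proof.
transitivity (sv (\sum_(k <- enum 'I_m) \sum_(l <- enum 'I_m) (a k l - kron k l) * E1 k l lo)).
  rewrite sv_allpairs; congr (osum K n (flatten _)); apply: eq_map => k; apply: eq_map => l.
  have eE : Est K n k l n.-1 = sv (E1 k l lo) by rewrite sv_E1.
  by rewrite eE -sv_kron.
congr (sv _); rewrite sum_enum; apply: eq_bigr => k _; exact: sum_enum.
Qed.

Lemma GLcong_UG u : GLcong K n (pfrak K n S) u -> UG (fun A => ~~ Jp n S A) u.
Proof.
case=> m [A [B [hS [hAB [hBA [hP hu]]]]]].
pose a k l : Sop := MkS (Sn1_Sn (proj1 (hS k l))).
pose b k l : Sop := MkS (Sn1_Sn (proj2 (hS k l))).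
have ha k l : SC (a k l) := proj1 (hS k l).
have hb k l : SC (b k l) := proj2 (hS k l).
have ab k l : \sum_j a k j * b j l = kron k l.
  by apply: Sop_inj; rewrite -sum_enum sv_sum sv_kron; exact: hAB.
have ba k l : \sum_j b k j * a j l = kron k l.
  by apply: Sop_inj; rewrite -sum_enum sv_sum sv_kron; exact: hBA.
have p k l : PF (a k l - kron k l).
  by have := hP k l; rewrite -sv_kron => h; exact: h.
have eu : u = sv (1 + lastmx (fun k l => a k l - kron k l)).
  by rewrite hu; exact: (congr1 (oadd K n (o1 K n)) (sv_lastmx a)).
rewrite eu; exists (1 + lastmx (fun k l => a k l - kron k l)), (1 + lastmx (fun k l => b k l - kron k l)).
split; [by []|exact: lastmx_inv|exact: lastmx_inv|move=> A' nJ].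
rewrite /cg addrAC subrr add0r; apply: Zsum => k _; apply: Zsum => l _.
case: (boolP (lo \in A')) => lA; last by apply: ZMl; exact: E1_Z.
apply: ZMr; apply: pfrak_Z (p k l); apply/eqP.
by move: nJ; rewrite JpE lA /= negbK.
Qed.

(** The complements of [n] and of [S] are the maximal sets outside [J(p)]: the first congruence
    gives a finite matrix, the second puts its entries in the ideal. *)
Lemma UG_GLcong u : UG (fun A => ~~ Jp n S A) u -> GLcong K n (pfrak K n S) u.
Proof.
case=> g [g' [<- gg' g'g hg]].
have hg' A : ~~ Jp n S A -> cg A g' 1.
  move=> nJ; apply: (@cg_inv _ _ A g g' 1 1); last exact: hg.
    by rewrite g'g; apply: cgR.
  by rewrite mulr1; apply: cgR.
have nlo : ~~ Jp n S (~: [set lo]) by rewrite JpE !inE eqxx.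
have nS : ~~ Jp n S (~: S) by rewrite JpE negb_and negbK setIC setICr eqxx orbT.
have [m1 h1] := finite_columns (hg _ nlo); have [m2 h2] := finite_columns (hg' _ nlo).
move: (h1 _ (leq_maxl m1 m2)) (h2 _ (leq_maxr m1 m2)); move: (maxn m1 m2) => m.
move=> [C [hC eC]] [D [hD eD]].
have eC' : 1 + lastmx C = g by rewrite -eC addrC subrK.
have eD' : 1 + lastmx D = g' by rewrite -eD addrC subrK.
have pC k l : PF (C k l).
  by apply: PF_Z => //; rewrite -(lastmx_entry k l hC) -eC; apply: ZMr; apply: ZMl; exact: hg.
have osE (E F : 'I_m -> 'I_m -> Sop) k l :
    osum K n [seq omul K n (sv (E k j)) (sv (F j l)) | j <- enum 'I_m] = sv (\sum_j E k j * F j l).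
  by rewrite -sum_enum sv_sum.
have iCD := lastmx_inv_entries hC hD; have iDC := lastmx_inv_entries hD hC.
exists m, (fun k l => sv (C k l + kron k l)), (fun k l => sv (D k l + kron k l)).
split; first by move=> k l; split; apply: Sin_D => //; exact: kron_SC.
split.
  move=> k l; rewrite -sv_kron -iCD ?eC' ?eD' //.
  exact: (osE (fun k l => C k l + kron k l) (fun k l => D k l + kron k l)).
split.
  move=> k l; rewrite -sv_kron -iDC ?eC' ?eD' //.
  exact: (osE (fun k l => D k l + kron k l) (fun k l => C k l + kron k l)).
split.
  move=> k l; rewrite -sv_kron.
  have -> : osub K n (sv (C k l + kron k l)) (sv (kron k l)) = sv (C k l) => //.
  by rewrite -[in RHS](addrK (kron k l) (C k l)).
transitivity (sv (1 + lastmx (fun k l => C k l + kron k l - kron k l))); last first.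
  exact: (esym (congr1 (oadd K n (o1 K n)) (sv_lastmx (fun k l => C k l + kron k l)))).
by rewrite (@eq_lastmx m _ C) ?eC' // => k l; rewrite addrK.
Qed.

Lemma GLcong_onePlus u : GLcong K n (pfrak K n S) u <-> onePlus K n (ppn K n S) u.
Proof.
have H := onePlusP u ppnP.
by split=> [/GLcong_UG /H|/H /UG_GLcong].
Qed.

Lemma onePlus_UG2 u : onePlus K n (ppn K n S) u <-> UG (Qs 2) u.
Proof.
have H := onePlusP u ppnP.
by split=> [/H|h]; [|apply/H; move: h]; apply: UG_sub => A; rewrite Qs2.
Qed.

Lemma onePlus_sn u : onePlus_s K n S n u <-> onePlus K n (Fn K n) u.
Proof.
have H1 := onePlus_sP n u; have H := onePlusP u FnP.
by split=> [/H1 h|/H h]; [apply/H|apply/H1]; move: h; apply: UG_sub => A; rewrite QsT.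
Qed.

Section ChainEquality.
Variables (ordT : nat -> seq ({set 'I_n} * 'I_n)) (ordE : nat -> seq {set 'I_n}).
Hypothesis vT : forall s, (2 <= s <= n.-1)%N -> validT n S s (ordT s).
Hypothesis vE : forall s, (2 <= s <= n.-1)%N -> validE n S s (ordE s).

Lemma UG_chainP s u : (2 <= s <= n.-1)%N -> UG (Qs s) u <-> chain K n S ordT ordE s u.
Proof.
move=> /andP [s2 sn]; split.
  by apply: (UG_chain vT vE (d := (n.-1 - s)%N)) => //; rewrite subnKC.
apply: chain_UG => s' /andP [s1 s1']; [apply: vT|apply: vE].
all: by rewrite (leq_trans s2 s1).
Qed.
End ChainEquality.

End Assembly.

Local Close Scope ring_scope.
Unset Implicit Arguments.

Theorem theorem5p2 (K : fieldType) (n : nat) (Hn : (3 <= n)%N)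
  (S : {set 'I_n}) (HS0 : S != set0)
  (HSn : forall k, k \in S -> nat_of_ord k != n.-1)
  (ordT : nat -> seq ({set 'I_n} * 'I_n)) (ordE : nat -> seq {set 'I_n})
  (HordT : forall s, (2 <= s <= n.-1)%N -> validT n S s (ordT s))
  (HordE : forall s, (2 <= s <= n.-1)%N -> validE n S s (ordE s)) :
  (forall u, GLcong K n (pfrak K n S) u <-> onePlus K n (ppn K n S) u) /\
  (forall u, onePlus K n (ppn K n S) u <-> chain K n S ordT ordE 2 u) /\
  (forall s, (2 <= s <= n.-1)%N ->
     forall u, onePlus_s K n S s u <-> chain K n S ordT ordE s u) /\
  (forall u, onePlus_s K n S n u <-> onePlus K n (Fn K n) u).
Proof.
have n2 : (2 <= 2 <= n.-1)%N by move: Hn; case: (n) => [|[|[]]].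
split; first by move=> u; apply: GLcong_onePlus.
split.
  move=> u; have H1 : onePlus K n (ppn K n S) u <-> UG (Qs S 2) u by apply: onePlus_UG2.
  have H2 : UG (Qs S 2) u <-> chain K n S ordT ordE 2 u by apply: UG_chainP.
  by split=> [/H1 /H2|/H2 /H1].
split; last by move=> u; apply: onePlus_sn.
move=> s hs u; have H1 : onePlus_s K n S s u <-> UG (Qs S s) u by apply: onePlus_sP.
have H2 : UG (Qs S s) u <-> chain K n S ordT ordE s u by apply: UG_chainP.
by split=> [/H1 /H2|/H2 /H1].
Qed.
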